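(* Let $\sigma>0$, let $k\ge1$ be an integer, and let $X=\{x_i:i\in\mathbb{Z}\}$, $\cdots<x_{i-1}<x_i<x_{i+1}<\cdots$, be a sequence of real numbers such that $\sup_{i\in\mathbb{Z}}(x_{i+1}-x_i)\le\frac{\nu_k}{\sigma}$. Then $X$ is a set of uniqueness of order $k-1$ for $\mathcal{B}_\sigma$; that is, if $f\in\mathcal{B}_\sigma$ satisfies $f^{(l)}(x_i)=0$ for all $i\in\mathbb{Z}$ and $l=0,1,\dots,k-1$, then $f\equiv0$.
   Context: The Fourier transform is $\widehat f(w)=\int_{\mathbb{R}} f(x)e^{-2\pi i w x}\,\mathrm{d}x$, extended to $L^2(\mathbb{R})$. For $\sigma>0$, $\mathcal{B}_\sigma=\{f\in L^2(\mathbb{R}):\operatorname{supp}\widehat f\subseteq[-\frac{\sigma}{2\pi},\frac{\sigma}{2\pi}]\}$; its elements are identified with entire functions of exponential type $\le\sigma$ that are square integrable on the real axis. The constant $\nu_k>0$ (Wirtinger-Cimmino constant): $\nu_k^2$ is the first (smallest) eigenvalue $\lambda>0$ of the boundary value problem $$u^{(2k)}(x)+\lambda u^{(2k-2)}(x)=0,\ x\in[0,1],\qquad u^{(l)}(0)=u^{(l)}(1)=0,\ 0\le l\le k-1,\qquad u\in C^{2k}[0,1],$$ i.e. the smallest $\lambda>0$ for which a non-zero solution $u$ exists. (For instance $\nu_1=\pi$ and $\nu_2=2\pi$.) *)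

(* Defs.v *)
From HB Require Import structures.
From mathcomp Require Import all_boot all_order all_algebra.
From mathcomp Require Import complex.
From mathcomp Require Import all_classical all_reals all_analysis.

Set Implicit Arguments.
Unset Strict Implicit.
Unset Printing Implicit Defensive.

Import Order.TTheory GRing.Theory Num.Theory.
Import numFieldNormedType.Exports.

Local Open Scope classical_set_scope.
Local Open Scope ring_scope.
Local Open Scope complex_scope.

(* Complex-valued functions of a real variable are handled through their real
   and imaginary parts: the library has no measurable or R-normed structure
   on R[i]. *)

Definition cmeasurable (R : realType) (f : R -> R[i]) : Prop :=
  measurable_fun setT (fun x => complex.Re (f x)) /\
  measurable_fun setT (fun x => complex.Im (f x)).

Definition cL1 (R : realType) (f : R -> R[i]) : Prop :=
  (@lebesgue_measure R).-integrable setT (fun x => (complex.Re (f x))%:E) /\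
  (@lebesgue_measure R).-integrable setT (fun x => (complex.Im (f x))%:E).

Definition cnorm2 (R : realType) (f : R -> R[i]) : \bar R :=
  Lnorm (@lebesgue_measure R) 2%:E (fun x => (ComplexField.Normc.normc (f x))%:E).

Definition cL2 (R : realType) (f : R -> R[i]) : Prop :=
  cmeasurable f /\ (cnorm2 f < +oo)%E.

Definition cintegral (R : realType) (f : R -> R[i]) : R[i] :=
  (\int[@lebesgue_measure R]_x complex.Re (f x)) +i*
  (\int[@lebesgue_measure R]_x complex.Im (f x)).

(* exp (i t) *)
Definition cis (R : realType) (t : R) : R[i] := cos t +i* sin t.

(* Meaningful for f in L^1 only. *)
Definition fourier (R : realType) (f : R -> R[i]) (w : R) : R[i] :=
  cintegral (fun x => f x * cis (- (2 * pi * w * x))).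

(* g is (a representative of) the Fourier transform of f in L^2, i.e. the value
   at f of the L^2-continuous extension of [fourier] from L^1 /\ L^2. *)
Definition is_fourierL2 (R : realType) (f g : R -> R[i]) : Prop :=
  [/\ cL2 f, cL2 g &
   exists h : nat -> R -> R[i],
     [/\ forall n, cL1 (h n) /\ cL2 (h n),
         cnorm2 (fun x => h n x - f x) @[n --> \oo] --> 0%E &
         cnorm2 (fun w => fourier (h n) w - g w) @[n --> \oo] --> 0%E]].

(* Support of a class of functions modulo null sets: the complement of the
   largest open set on which g vanishes almost everywhere. *)
Definition ae_support (R : realType) (g : R -> R[i]) : set R :=
  [set w | forall U : set R, open_nbhs w U ->
     ~ {ae @lebesgue_measure R, forall v, U v -> g v = 0}].

(* Differentiation at z in direction 1 over the scalar field R[i] is complex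
   differentiation. *)
Definition entire (R : realType) (F : R[i] -> R[i]) : Prop :=
  forall z : R[i], @derivable R[i] R[i]^o R[i]^o F z 1.

(* An element of the space B_sigma is an L^2-class; f is its representative that
   extends to an entire function. There is exactly one, since two continuous
   functions that agree almost everywhere are equal. *)
Definition bandlimited (R : realType) (sigma : R) (f : R -> R[i]) : Prop :=
  [/\ cL2 f,
      exists2 F : R[i] -> R[i], entire F & forall x : R, f x = F x%:C &
      exists2 g : R -> R[i], is_fourierL2 f g &
        ae_support g `<=` `[- (sigma / (2 * pi)), sigma / (2 * pi)]].

Definition cderive1n (R : realType) (l : nat) (f : R -> R[i]) (x : R) : R[i] :=
  derive1n l (fun y => complex.Re (f y)) x +i*
  derive1n l (fun y => complex.Im (f y)) x.

Definition uniqueness_set (R : realType) (m : nat) (sigma : R) (X : set R)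
    : Prop :=
  forall f : R -> R[i], bandlimited sigma f ->
    (forall (x : R) (l : nat), X x -> (l <= m)%N -> cderive1n l f x = 0) ->
    forall x : R, f x = 0.

(* Derivative relative to A: one-sided at the end points of an interval. *)
Definition dquot (R : realType) (f : R -> R) (x y : R) : R :=
  (f y - f x) / (y - x).

Definition derivable_within (R : realType) (A : set R) (f : R -> R) : Prop :=
  forall x, A x -> cvg (dquot f x y @[y --> within A x^']).

Definition derive1_within (R : realType) (A : set R) (f : R -> R) (x : R) : R :=
  lim (dquot f x y @[y --> within A x^']).

Definition derive1n_within (R : realType) (A : set R) (n : nat) (f : R -> R)
    : R -> R :=
  iter n (derive1_within A) f.

(* u belongs to C^n(A) *)
Definition Cn_within (R : realType) (A : set R) (n : nat) (u : R -> R) : Prop :=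
  (forall j, (j < n)%N -> derivable_within A (derive1n_within A j u)) /\
  {within A, continuous (derive1n_within A n u)}.

Definition wc_eigenvalue (R : realType) (k : nat) (lam : R) : Prop :=
  exists u : R -> R,
    let D l := derive1n_within `[0, 1] l u in
    [/\ Cn_within `[0, 1] (2 * k) u,
        forall x, x \in `[0, 1] -> D (2 * k)%N x + lam * D (2 * k - 2)%N x = 0,
        forall l, (l <= k - 1)%N -> D l 0 = 0 /\ D l 1 = 0 &
        exists2 x, x \in `[0, 1] & u x != 0].

(* nu is the Wirtinger-Cimmino constant of order k *)
Definition is_wirtinger_cimmino (R : realType) (k : nat) (nu : R) : Prop :=
  [/\ 0 < nu, wc_eigenvalue k (nu ^+ 2) &
      forall lam : R, 0 < lam -> wc_eigenvalue k lam -> nu ^+ 2 <= lam].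

(* Main.v *)
(* A function f in B_sigma and all its derivatives lie in L^2, with beta_l = ||f^(l)||^2 / sigma^(2l).
   Integrating by parts, beta is convex in l, and dominated convergence on the Fourier side gives
   beta_l -> 0, so beta is nonincreasing, strictly as long as it is nonzero. On each interval
   [x_i, x_(i+1)] the function and its first k-1 derivatives vanish at both ends, so the
   Wirtinger-type inequality nu_k^2 int (u^(k-1))^2 <= h^2 int (u^(k))^2, with h <= nu_k / sigma the
   length of the interval, sums to beta_(k-1) <= beta_k. Hence f^(k-1) = 0, and f = 0. If the x_i are
   bounded on one side they have a limit point, at which all derivatives vanish; then f = 0 because
   |f^(l)| <= C sigma^l.

   The inequality is the variational description of nu_k. Let mu be the infimum of the Rayleigh
   quotient of u^(k-1) over clamped u. If mu < nu_k^2 then mu is not an eigenvalue, so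
   y^(k+1) + mu y^(k-1) = - u^(k-1) modulo polynomials of degree < k-1 is solvable by a clamped y, with a
   bound uniform in u; testing nonnegativity of the form int (u^(k))^2 - mu int (u^(k-1))^2 on u - y/C
   shows that it is bounded below by 1/C on normalised u, contradicting the choice of mu.

   The real and imaginary parts of f are trigonometric integrals over [-sigma/2pi, sigma/2pi] of those of
   its transform g: smoothing the inversion formula with exp(-c|w|), whose transform is the Poisson
   kernel, it passes from L^1 /\ L^2 to L^2 by duality, and then c -> 0. Bessel's inequality for samples at
   spacing pi/sigma replaces Plancherel's theorem as an upper bound for ||f^(l)||. *)
Require Import Defs.
From mathcomp Require Import all_boot all_order all_algebra.
From mathcomp Require Import complex ring lra zify.
From mathcomp Require Import all_classical all_reals all_analysis.
From mathcomp Require Import measurable_realfun.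

Set Implicit Arguments.
Unset Strict Implicit.
Unset Printing Implicit Defensive.

Import Order.TTheory GRing.Theory Num.Theory.
Import numFieldNormedType.Exports.
Local Open Scope classical_set_scope.
Local Open Scope ring_scope.

(** * Derivatives and primitives of continuous functions *)

Section Primitives.
Context {R : realType}.
Implicit Types (f g h : R -> R) (a b c d x y : R).

(** The gap may equal [nu / sigma], so the Wirtinger step has no margin and yields only a non-strict
    inequality. This suffices because a midpoint-convex sequence that once fails to decrease never
    decreases again, while the energies tend to 0. A minimiser of the Rayleigh quotient would call
    for a compactness argument. It is replaced by explicit solutions: those of the equation of order
    2k with k vanishing derivatives at 0 are generated by k derivatives of one function, so clamping
    at 1 becomes a k by k linear system, and a singular matrix yields an eigenvalue. The equation is
    used after k - 1 integrations; the polynomials left undetermined are orthogonal to u^(k-1) for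
    clamped u and do not affect the form. The transform g is given only as an L^2 limit, whereas
    point values of the continuous representative are needed. Damping by exp(-c|w|) makes every
    pairing one of square integrable functions, so the limit is taken with c fixed; the values
    reappear as c -> 0 because the Poisson kernels form an approximate identity. *)

Definition der f g := forall x, is_derive x 1 f (g x).

Lemma der_continuous f g : der f g -> continuous f.
Proof.
move=> fg x; apply/differentiable_continuous/derivable1_diffP.
by have [] := fg x.
Qed.

Lemma cst_cts a : continuous ((fun=> a) : R -> R).
Proof. by move=> x; exact: cvg_cst. Qed.

Lemma ctsD f g : continuous f -> continuous g -> continuous (fun x => f x + g x).
Proof. by move=> cf cg x; apply: continuousD; [exact: cf|exact: cg]. Qed.

Lemma ctsB f g : continuous f -> continuous g -> continuous (fun x => f x - g x).
Proof. by move=> cf cg x; apply: continuousB; [exact: cf|exact: cg]. Qed.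

Lemma ctsN f : continuous f -> continuous (fun x => - f x).
Proof. by move=> cf x; apply: continuousN; exact: cf. Qed.

Lemma ctsM f g : continuous f -> continuous g -> continuous (fun x => f x * g x).
Proof. by move=> cf cg x; apply: continuousM; [exact: cf|exact: cg]. Qed.

Lemma ctsZ a f : continuous f -> continuous (fun x => a * f x).
Proof. by move=> cf; apply: ctsM => //; exact: cst_cts. Qed.

Lemma ctsX f n : continuous f -> continuous (fun x => f x ^+ n).
Proof.
move=> cf; elim: n => [|n IH]; first exact: (@cst_cts 1).
by under eq_fun do rewrite exprS; exact: ctsM.
Qed.

Lemma continuous_normr f : continuous f -> continuous (fun x => `|f x|).
Proof.
by move=> cf x; apply: (continuous_comp (cf x)); exact: norm_continuous.
Qed.

Lemma ctsA f a b : continuous f -> continuous (fun x => f (a + b * x)).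
Proof.
move=> cf x; apply: (@continuous_comp _ _ _ (fun x => a + b * x) f); last exact: cf.
by apply: ctsD; [exact: cst_cts|apply: ctsZ => y; exact: cvg_id].
Qed.

Lemma der_eq f g h : der f g -> g =1 h -> der f h.
Proof. by move=> fg gh x; rewrite -gh. Qed.

Lemma derD f g f' g' : der f f' -> der g g' ->
  der (fun x => f x + g x) (fun x => f' x + g' x).
Proof. by move=> ff' gg' x; have := ff' x; have := gg' x => *; exact: is_deriveD. Qed.

Lemma derN f f' : der f f' -> der (fun x => - f x) (fun x => - f' x).
Proof. by move=> ff' x; have := ff' x => *; exact: is_deriveN. Qed.

Lemma derB f g f' g' : der f f' -> der g g' ->
  der (fun x => f x - g x) (fun x => f' x - g' x).
Proof. by move=> ff' gg'; apply: derD => //; exact: derN. Qed.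

Lemma derZ a f f' : der f f' -> der (fun x => a * f x) (fun x => a * f' x).
Proof. by move=> ff' x; have := ff' x => *; exact: is_deriveZ. Qed.

Lemma derM f g f' g' : der f f' -> der g g' ->
  der (fun x => f x * g x) (fun x => f x * g' x + f' x * g x).
Proof.
move=> ff' gg' x; have ? := ff' x; have ? := gg' x.
apply: is_derive_eq (_ : _ = _); rewrite /GRing.scale/=; ring.
Qed.

Lemma der_sum n (f f' : 'I_n -> R -> R) : (forall i, der (f i) (f' i)) ->
  der (fun x => \sum_(i < n) f i x) (fun x => \sum_(i < n) f' i x).
Proof.
move=> ff' x; have := @is_derive_sum R R R n f x 1 (fun i => f' i x) (fun i => ff' i x).
by congr (is_derive _ _ _ _); apply/funext => y; rewrite fct_sumE.
Qed.

Lemma der_affine f f' a b : der f f' ->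
  der (fun x => f (a + b * x)) (fun x => b * f' (a + b * x)).
Proof.
move=> ff' x; have ? := ff' (a + b * x).
have ? : is_derive x 1 (fun x => a + b * x) b.
  have -> : (fun x => a + b * x) = (cst a + b \*: id)%R by apply/funext => y.
  by apply: is_derive_eq; rewrite add0r /GRing.scale/= mulr1.
by rewrite mulrC; exact: (is_derive1_comp (f := f)).
Qed.

Lemma der_cst a : der (fun=> a) (fun=> 0).
Proof. by move=> x; exact: is_derive_cst. Qed.

Lemma der_id : der id (fun=> 1).
Proof. by move=> x; exact: is_derive_id. Qed.

Lemma der_MVT f g c d : der f g -> c <= d ->
  exists2 z, c <= z <= d & f d - f c = g z * (d - c).
Proof.
move=> fg cd; have [||z] := @MVT_segment _ f g c d cd.
- by move=> x _; exact: fg.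
- exact/continuous_subspaceT/(der_continuous fg).
- by rewrite in_itv/= => ? ?; exists z.
Qed.

Lemma der0_cst f c d : der f (fun=> 0) -> f c = f d.
Proof.
move=> f0; wlog cd : c d / c <= d.
  by move=> H; have [/H//|/ltW/H//] := leP c d.
by have [z _ /eqP] := der_MVT f0 cd; rewrite mul0r subr_eq0 => /eqP.
Qed.

Lemma der_inj f g h c d : der f h -> der g h -> f d - f c = g d - g c.
Proof.
move=> fh gh; have := @der0_cst (fun x => f x - g x) c d.
have /[swap]/[apply] : der (fun x => f x - g x) (fun=> 0).
  by apply: der_eq (derB fh gh) _ => x; rewrite subrr.
lra.
Qed.

Lemma continuous_integrable f c d : continuous f ->
  (@lebesgue_measure R).-integrable `[c, d] (EFin \o f).
Proof.
move=> cf; apply: continuous_compact_integrable; first exact: segment_compact.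
exact: continuous_subspaceT.
Qed.

Lemma continuous_has_primitive f : continuous f ->
  exists F, der F f /\ F 0 = 0.
Proof.
(* The fundamental theorem needs a fixed base point [- r]. For [r >= 0] with [- r <= x] the value
   [G r x] does not depend on [r], so the base may move with [x]. *)
move=> cf; pose G r x := \int[@lebesgue_measure R]_(t in `[-r, x]) f t -
  \int[@lebesgue_measure R]_(t in `[-r, 0]) f t.
have GE (r s x : R) : 0 <= r -> r <= s -> - r <= x -> G r x = G s x.
  move=> r0 rs rx.
  have E y : - r <= y -> \int[@lebesgue_measure R]_(t in `[-s, y]) f t -
     \int[@lebesgue_measure R]_(t in `[-s, - r]) f t =
     \int[@lebesgue_measure R]_(t in `[- r, y]) f t.
    move=> ry; rewrite Rintegral_itvB ?bnd_simp ?lerN2//; last exact: continuous_integrable.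
    rewrite Rintegral_itv_obnd_cbnd//; apply: integrableS (continuous_integrable (-r) y cf) => //.
    by move=> t /=; rewrite !in_itv/= => /andP[/ltW-> ->].
  rewrite /G -E// -E ?oppr_le0//; ring.
exists (fun x => G (`|x| + 1) x); split; last by rewrite /G subrr.
move=> x; pose r : R := `|x| + 2.
have r0 : - r < x by rewrite /r; case: (ger0P x) => ?; lra.
have x1 : x < x + 1 by rewrite ltrDl.
have [dG G'] := continuous_FTC1_closed x1 (continuous_integrable _ _ cf) r0 (cf x).
have GD : is_derive x 1 (G r) (f x).
  rewrite -[f x]subr0 -G' derive1E; apply: is_deriveB; exact: derivableP.
apply: near_eq_is_derive GD; near=> y; apply/esym/GE => //.
- have : `|y - x| < 1 by near: y; apply/nbhs_normP; exists 1 => //= z; rewrite distrC.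
  rewrite /r; have := lerB_dist y x; lra.
- have := ler_norm (- y); rewrite normrN; lra.
Unshelve. all: by end_near.
Qed.

(** Made total by the value 0 off the continuous functions, so that [ig] can be written without a
    proof of continuity. *)
Definition prim f : R -> R :=
  match pselect (continuous f) with
  | left cf => projT1 (cid (continuous_has_primitive cf))
  | right _ => cst 0
  end.

Lemma der_prim f : continuous f -> der (prim f) f.
Proof. by rewrite /prim; case: pselect => // cf _; case: cid => F /= []. Qed.

Lemma prim0 f : prim f 0 = 0.
Proof. by rewrite /prim; case: pselect => // cf; case: cid => F /= []. Qed.

(** An oriented integral: additivity holds for endpoints in any order, and [Rintegral_ig] links it
    to Lebesgue measure when [c <= d]. *)
Definition ig f c d := prim f d - prim f c.

Lemma ig_der f g c d : continuous g -> der f g -> ig g c d = f d - f c.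
Proof.
by move=> cg fg; apply: der_inj fg; exact: der_prim.
Qed.

Lemma ig_cat f a b c : ig f a b + ig f b c = ig f a c.
Proof. by rewrite /ig; ring. Qed.

Lemma igxx f a : ig f a a = 0.
Proof. by rewrite /ig subrr. Qed.

Lemma igD f g c d : continuous f -> continuous g ->
  ig (fun x => f x + g x) c d = ig f c d + ig g c d.
Proof.
move=> cf cg; rewrite (ig_der _ _ _ (derD (der_prim cf) (der_prim cg))) /ig; first by ring.
exact: ctsD.
Qed.

Lemma igZ a f c d : continuous f -> ig (fun x => a * f x) c d = a * ig f c d.
Proof.
move=> cf; rewrite (ig_der _ _ _ (derZ a (der_prim cf))) /ig; first by ring.
exact: ctsZ.
Qed.

Lemma igB f g c d : continuous f -> continuous g ->
  ig (fun x => f x - g x) c d = ig f c d - ig g c d.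
Proof.
move=> cf cg; rewrite (ig_der _ _ _ (derB (der_prim cf) (der_prim cg))) /ig; first by ring.
exact: ctsB.
Qed.

Lemma sum_continuous n (f : 'I_n -> R -> R) : (forall i, continuous (f i)) ->
  continuous (fun x => \sum_(i < n) f i x).
Proof.
move=> cf; apply: (@continuous_big _ _ +%R) => [|i _]; last exact: cf.
exact: add_continuous.
Qed.

Lemma ig_sum n (f : 'I_n -> R -> R) c d : (forall i, continuous (f i)) ->
  ig (fun x => \sum_(i < n) f i x) c d = \sum_(i < n) ig (f i) c d.
Proof.
move=> cf; rewrite (ig_der _ _ _ (der_sum (fun i => der_prim (cf i)))) ?sumrB//.
exact: sum_continuous.
Qed.

Lemma ig_cst a c d : ig (fun=> a) c d = a * (d - c).
Proof.
have /(ig_der _ _ (@cst_cts a)) -> : der (fun x => a * x) (fun=> a).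
  by apply: der_eq (derZ a der_id) _ => x; rewrite mulr1.
by ring.
Qed.

Lemma ig_affine f a b c d : continuous f ->
  b * ig (fun x => f (a + b * x)) c d = ig f (a + b * c) (a + b * d).
Proof.
move=> cf; have H := der_affine a b (der_prim cf).
have cfab : continuous (fun x => f (a + b * x)) by exact: ctsA.
rewrite -igZ// (ig_der _ _ _ H)//.
exact: ctsZ.
Qed.

Lemma ig_ge0 f c d : continuous f -> c <= d ->
  (forall x, c <= x <= d -> 0 <= f x) -> 0 <= ig f c d.
Proof.
move=> cf cd f0; rewrite /ig; have [z zcd ->] := der_MVT (der_prim cf) cd.
by rewrite mulr_ge0 ?f0// subr_ge0.
Qed.

Lemma le_ig f g c d : continuous f -> continuous g -> c <= d ->
  (forall x, c <= x <= d -> f x <= g x) -> ig f c d <= ig g c d.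
Proof.
move=> cf cg cd fg; rewrite -subr_ge0 -igB//; apply: ig_ge0 => //.
  exact: ctsB.
by move=> x /fg; rewrite subr_ge0.
Qed.

Lemma ler_norm_ig f g c d : continuous f -> continuous g -> c <= d ->
  (forall x, c <= x <= d -> `|f x| <= g x) -> `|ig f c d| <= ig g c d.
Proof.
move=> cf cg cd fg; rewrite ler_norml; apply/andP; split.
  rewrite -mulN1r -igZ//; apply: le_ig => //.
    exact: ctsZ.
  by move=> x /fg; rewrite ler_norml mulN1r => /andP[].
by apply: le_ig => // x /fg; rewrite ler_norml => /andP[].
Qed.

Lemma ig_eq0 f c d : continuous f -> c < d -> (forall x, c <= x <= d -> 0 <= f x) ->
  ig f c d = 0 -> forall x, c <= x <= d -> f x = 0.
Proof.
move=> cf cd f0 I0.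
have P y : c <= y <= d -> prim f y = prim f c.
  move=> /andP[cy yd]; apply/eqP; rewrite -subr_eq0; apply/eqP.
  have := ig_cat f c y d; rewrite I0.
  have f1 x : c <= x <= y -> 0 <= f x.
    by move=> /andP[? xy]; apply: f0; rewrite (le_trans xy)// andbT.
  have f2 x : y <= x <= d -> 0 <= f x.
    by move=> /andP[yx ?]; apply: f0; rewrite (le_trans _ yx)//.
  have := ig_ge0 cf cy f1; have := ig_ge0 cf yd f2; rewrite -/(ig f c y); lra.
move=> x xcd; apply/eqP; rewrite eq_le f0 ?andbT// leNgt; apply/negP => fx0.
have /cvgrPdist_lt /(_ _ fx0) /nbhs_normP [e /= e0 He] := cf x.
(* A neighbourhood of [x] cut to [[c, d]]. The primitive is constant there, so the mean value
   theorem produces a zero of [f] closer to [x] than positivity of [f x] allows. *)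
pose p := Num.max c (x - e / 2); pose q := Num.min d (x + e / 2).
have [cx xd] := andP xcd.
have pq : p < q by rewrite /p /q gt_max !lt_min; apply/andP; split; apply/andP; split; lra.
have [z /andP[pz zq]] := der_MVT (der_prim cf) (ltW pq).
have [cp [xp [qd qx]]] : c <= p /\ x - e / 2 <= p /\ q <= d /\ q <= x + e / 2.
  by rewrite /p /q !le_max !ge_min !lexx !orbT.
rewrite !P; [|by apply/andP; lra..].
move/eqP; rewrite subrr eq_sym mulf_eq0 subr_eq0 (gt_eqF pq) orbF => /eqP fz0.
have xz : `|x - z| < e by rewrite ltr_norml; apply/andP; lra.
by have := He z xz; rewrite /= fz0 subr0 gtr0_norm// ltxx.
Qed.

Lemma ig_parts f g f' g' c d : der f f' -> der g g' -> continuous f' -> continuous g' ->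
  ig (fun x => f x * g' x) c d = f d * g d - f c * g c - ig (fun x => f' x * g x) c d.
Proof.
move=> ff' gg' cf' cg'.
have c1 := ctsM (der_continuous ff') cg'.
have c2 := ctsM cf' (der_continuous gg').
rewrite -(ig_der _ _ _ (derM ff' gg')) ?igD//; first by ring.
exact: ctsD.
Qed.

Lemma Rintegral_ig f c d : continuous f -> c <= d ->
  \int[@lebesgue_measure R]_(x in `[c, d]) f x = ig f c d.
Proof.
move=> cf; rewrite le_eqVlt => /predU1P[->|cd].
  by rewrite set_itv1 Rintegral_set1 igxx.
have pf := der_prim cf.
rewrite /Rintegral (@continuous_FTC2 R f (prim f))//.
- exact: continuous_subspaceT.
- split.
  + by move=> x _; have [] := pf x.
  + apply: cvg_at_right_filter; exact: der_continuous pf c.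
  + apply: cvg_at_left_filter; exact: der_continuous pf d.
- by move=> x _; rewrite derive1E; have [] := pf x.
Qed.

End Primitives.

(** * One-sided derivatives on the unit interval *)

Section DerivativeWithin.
Context {R : realType}.
Implicit Types (u : R -> R) (U : nat -> R -> R) (x y : R).
Notation I01 := (`[0, 1]%classic : set R).

(** Properness makes the limit in [derive1_within] unique. At 0 and 1 only one side is available, so
    the witness moves from [x] towards the far end. *)
Lemma within01_proper x : I01 x -> ProperFilter (within I01 x^').
Proof.
rewrite /= in_itv/= => /andP[x0 x1].
apply: Build_ProperFilter_ex => P; rewrite /dnbhs /within /= => /nbhs_normP[e /= e0 H].
pose d : R := Num.min (e / 2) (1 / 2).
have [d0 de d1] : [/\ 0 < d, d < e & d <= 1 / 2].
  rewrite /d; split; rewrite ?lt_min ?gt_min ?ge_min; first (by apply/andP; lra).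
  + by apply/orP; left; lra.
  + by rewrite lexx orbT.
have [xh|xh] := lerP x (1 / 2).
- exists (x + d); apply: (H (x + d)).
  + by rewrite /= opprD addNKr normrN gtr0_norm.
  + by rewrite gt_eqF// ltrDl.
  + by rewrite /= in_itv/=; apply/andP; lra.
- exists (x - d); apply: (H (x - d)).
  + by rewrite /= opprB addrCA subrr addr0 gtr0_norm.
  + by rewrite lt_eqF// gtrBl.
  + by rewrite /= in_itv/=; apply/andP; lra.
Qed.

Lemma dquot_within_cvg u f f' x : der f f' -> (forall y, I01 y -> u y = f y) ->
  I01 x -> dquot u x y @[y --> within I01 x^'] --> f' x.
Proof.
move=> ff' uf Ix; have [df dv] := ff' x.
apply/cvgrPdist_lt => e e0; rewrite near_withinE /dnbhs near_withinE.
have : h^-1 *: ((f \o shift x) (h *: 1) - f x) @[h --> 0^'] --> f' x by rewrite -dv.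
move=> /cvgrPdist_lt /(_ e e0); rewrite near_withinE => /nbhs_normP[d /= d0 H].
apply/nbhs_normP; exists d => //= y xy yx Iy.
have := H (y - x); rewrite /= sub0r normrN distrC => /(_ xy).
rewrite subr_eq0 => /(_ yx); rewrite /dquot uf// uf//.
by rewrite /GRing.scale/= mulr1 subrK mulrC.
Qed.

Lemma derive1_within_jet u f f' x : der f f' -> (forall y, I01 y -> u y = f y) ->
  I01 x -> derive1_within I01 u x = f' x.
Proof.
move=> ff' uf Ix; have ? := within01_proper Ix.
by apply: cvg_lim => //; exact: dquot_within_cvg ff' uf Ix.
Qed.

Lemma derive1n_within_jet u U x l : (forall l, der (U l) (U l.+1)) ->
  (forall y, I01 y -> u y = U 0 y) -> I01 x -> derive1n_within I01 l u x = U l x.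
Proof.
move=> dU uU; elim: l x => [|l IH] x Ix; first exact: uU.
exact: derive1_within_jet (dU l) IH Ix.
Qed.

(** Eigenfunctions are constructed as smooth functions on the whole line, whose derivatives relative
    to [[0, 1]] agree with the ordinary ones. *)
Lemma wc_eigenvalue_jet k (lam : R) U : (forall l, der (U l) (U l.+1)) ->
  (forall x, U (2 * k)%N x + lam * U (2 * k - 2)%N x = 0) ->
  (forall l, (l <= k - 1)%N -> U l 0 = 0 /\ U l 1 = 0) ->
  (exists2 x, I01 x & U 0 x != 0) -> wc_eigenvalue k lam.
Proof.
move=> dU eU bU nU; exists (U 0%N) => D.
have DE l x : I01 x -> D l x = U l x by move=> Ix; exact: derive1n_within_jet dU _ Ix.
have I0 : I01 (0 : R) by rewrite /= in_itv/= lexx ler01.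
have I1 : I01 (1 : R) by rewrite /= in_itv/= lexx ler01.
split => //.
- split.
  + move=> j _ x Ix; apply/cvg_ex; exists (U j.+1 x).
    exact: dquot_within_cvg (dU j) (DE j) Ix.
  + apply: (@subspace_eq_continuous _ _ _ (U (2 * k)%N)).
      by move=> x /set_mem Ix; apply/esym/DE.
    apply: continuous_subspaceT; exact: der_continuous (dU _).
- by move=> x Ix; rewrite !DE.
- by move=> l lk; rewrite !DE//; exact: bU.
Qed.
End DerivativeWithin.

(** * The Wirtinger-Cimmino inequality *)

Section ClampedSolutions.
Context {R : realType} (w : R) (w0 : 0 < w).
Implicit Types (x : R) (n l i : nat).

Definition monom n x : R := x ^+ n / n`!%:R.

Lemma der_monom n : der (monom n.+1) (monom n).
Proof.
have H : der (fun x : R => x ^+ n.+1) (fun x => n.+1%:R * x ^+ n).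
  move=> x; have := @is_deriveX R R id n.+1 x 1 1 (@is_derive_id _ _ x 1).
  rewrite /GRing.scale/= mulr1; congr (is_derive _ _ _ _).
  by apply/funext => y; rewrite exprfctE.
have -> : monom n.+1 = fun x => (n.+1)`!%:R^-1 * x ^+ n.+1.
  by apply/funext => x; rewrite mulrC.
apply: der_eq (derZ _ H) _ => x; rewrite /monom factS natrM invfM mulrACA.
by rewrite mulVf ?pnatr_eq0// mul1r mulrC.
Qed.

Lemma monom_at0 n : monom n 0 = (n == 0)%:R.
Proof. by rewrite /monom expr0n; case: n => [|n]; rewrite ?divr1 ?mul0r. Qed.

(* [trig n] is the [n]-fold primitive of [cos (w x)] with zero Cauchy data. *)
Fixpoint trig n x : R :=
  match n with
  | 0 => cos (w * x)
  | 1 => sin (w * x) / w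
  | n'.+2 => (monom n' x - trig n' x) / w ^+ 2
  end.

Let wn0 : w != 0. Proof. by rewrite gt_eqF. Qed.

Lemma der_trig0 : der (trig 0) (fun x => - w ^+ 2 * trig 1 x).
Proof.
have := @der_affine R cos (fun x => - sin x) 0 w (fun x => is_derive_cos x).
under eq_fun do rewrite add0r.
move=> /der_eq; apply => x; rewrite add0r /=; field; exact: wn0.
Qed.

Lemma der_trig1 : der (trig 1) (trig 0).
Proof.
have := @der_affine R sin cos 0 w (fun x => is_derive_sin x).
under eq_fun do rewrite add0r.
move=> /(derZ w^-1) H; have -> : trig 1 = (fun x => w^-1 * sin (w * x)).
  by apply/funext => x /=; rewrite mulrC.
by apply: der_eq H _ => x; rewrite /= add0r mulKf.
Qed.

Lemma der_trig n : der (trig n.+1) (trig n).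
Proof.
suff [] : der (trig n.+1) (trig n) /\ der (trig n.+2) (trig n.+1) by [].
elim: n => [|n [IH1 IH2]]; split => //; first exact: der_trig1.
- have -> : trig 2 = (fun x => w ^- 2 * (1 - trig 0 x)).
    by apply/funext => x /=; rewrite /monom expr0 divr1 mulrC.
  apply: der_eq (derZ _ (derB (der_cst 1) der_trig0)) _ => x /=.
  by field; exact: wn0.
- have -> : trig n.+3 = (fun x => w ^- 2 * (monom n.+1 x - trig n.+1 x)).
    by apply/funext => x /=; rewrite mulrC.
  apply: der_eq (derZ _ (derB (der_monom n) IH1)) _ => x /=.
  by rewrite mulrC.
Qed.

Lemma trig_at0 n : trig n 0 = (n == 0)%:R.
Proof.
suff [] : trig n 0 = (n == 0)%:R /\ trig n.+1 0 = 0 by [].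
elim: n => [|n [IH1 IH2]]; first by rewrite /= mulr0 cos0 sin0 mul0r.
by rewrite /= IH1 monom_at0 subrr mul0r.
Qed.

(** [trigd n] is the [n]-th derivative of [cos (w x)]; it continues [trig] beyond order zero. *)
Fixpoint trigd n x : R :=
  match n with
  | 0 => trig 0 x
  | 1 => - w ^+ 2 * trig 1 x
  | n'.+2 => - w ^+ 2 * trigd n' x
  end.

Lemma der_trigd n : der (trigd n) (trigd n.+1).
Proof.
suff [] : der (trigd n) (trigd n.+1) /\ der (trigd n.+1) (trigd n.+2) by [].
elim: n => [|n [IH1 IH2]]; split => //; first exact: der_trig0.
  exact: derZ der_trig1.
exact: derZ IH1.
Qed.

Variable m : nat.
Let M := (2 * m).+1.

(* The [l]-th derivative of the function with Cauchy data [T^(l) 0 = (l == M)] for [l <= M] such that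
   [T'' + w^2 T] is a polynomial and [T^(2m+2) + w^2 T^(2m) = 0]. *)
Definition cjet l x : R := if (l <= M)%N then trig (M - l) x else trigd (l - M) x.

Lemma der_cjet l : der (cjet l) (cjet l.+1).
Proof.
rewrite /cjet; have [lM|lM|lM] := ltngtP l M.
- have -> : (M - l = (M - l.+1).+1)%N by lia.
  exact: der_trig.
- have -> : (l.+1 - M = (l - M).+1)%N by lia.
  exact: der_trigd.
- rewrite lM subnn subSnn; exact: der_trigd 0.
Qed.

(** For [l = i + m] the right-hand side is 0 or a monomial of degree below [m], orthogonal to the
    [m]-th derivative of a clamped function; for [l = i + 2m] it is 0, which is the eigenvalue
    equation. *)
Lemma cjet_eq l x : cjet l.+2 x + w ^+ 2 * cjet l x =
  if (l.+2 <= M)%N then monom (M - l.+2) x else 0.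
Proof.
rewrite /cjet; have [lM|lM] := leqP l.+2 M.
  have -> : (l <= M)%N by lia.
  have -> : (M - l = (M - l.+2).+2)%N by lia.
  by rewrite /=; field; exact: wn0.
have [lM'|lM'|lM'] := ltngtP l M.
- have [-> ->] : (l.+2 - M = 1 /\ M - l = 1)%N by lia.
  by rewrite /=; field; exact: wn0.
- have -> : (l.+2 - M = (l - M).+2)%N by lia.
  by rewrite /=; ring.
- rewrite lM' subnn (_ : M.+2 - M = 2)%N; last by lia.
  by rewrite /=; ring.
Qed.

Lemma cjet_at0 l : (l < M)%N -> cjet l 0 = 0.
Proof. by move=> lM; rewrite /cjet ltnW// trig_at0 subn_eq0 leqNgt lM. Qed.

Lemma cjetM_at0 : cjet M 0 = 1.
Proof. by rewrite /cjet leqnn subnn trig_at0. Qed.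

(* The derivatives [cspan c] of the combinations of [T, T', .., T^(m)] all vanish at 0 up to order [m];
   [hankel] is the matrix of their derivatives at 1, so that it is singular iff one of them is clamped. *)
Definition hankel : 'M[R]_m.+1 := \matrix_(i, l) cjet (i + l) 1.

Definition cspan (c : 'rV[R]_m.+1) l x := \sum_(i < m.+1) c 0 i * cjet (i + l) x.

Lemma der_cspan c l : der (cspan c l) (cspan c l.+1).
Proof.
by apply: der_sum => i; apply: derZ; rewrite addnS; exact: der_cjet.
Qed.

Lemma cspan_at0 c l : (l <= m)%N -> cspan c l 0 = 0.
Proof.
by move=> lm; rewrite /cspan big1// => i _; rewrite cjet_at0 ?mulr0// /M; have := ltn_ord i; lia.
Qed.

Lemma cspan_at1 c (l : 'I_m.+1) : cspan c l 1 = (c *m hankel) 0 l.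
Proof. by rewrite mxE; apply: eq_bigr => i _; rewrite mxE. Qed.

(** Triangularity: at 0 the derivative of order [M - j] kills the terms [i < j] and has coefficient
    1 at [i = j], so the [c 0 j] vanish by descending induction on [j]. *)
Lemma cspan_inj c : (forall l, cspan c l 0 = 0) -> c = 0.
Proof.
move=> c0; apply/rowP => j; rewrite mxE.
suff : forall n (j : 'I_m.+1), (m - j < n)%N -> c 0 j = 0 by move=> /(_ (m.+1) j); apply; lia.
elim=> // n IH {}j jn; have := c0 (M - j)%N; rewrite /cspan (bigD1 j)//=.
rewrite subnKC; last by rewrite /M; have := ltn_ord j; lia.
rewrite cjetM_at0 mulr1 big1 ?addr0// => i ij.
have [ilj|jli] := leqP i j.
  have {}ilj : (i < j)%N by rewrite ltn_neqAle ilj andbT; move: ij; rewrite -val_eqE.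
  by rewrite cjet_at0 ?mulr0// /M; have := ltn_ord j; lia.
by rewrite IH ?mul0r//; have := ltn_ord i; lia.
Qed.

Lemma hankel_eigenvalue : hankel \notin unitmx -> wc_eigenvalue m.+1 (w ^+ 2).
Proof.
rewrite unitmxE unitfE negbK => /det0P[c cn0 cH].
apply: (@wc_eigenvalue_jet _ _ _ (cspan c)).
- exact: der_cspan.
- move=> x; have -> : (2 * m.+1 = (2 * m).+2)%N by lia.
  have -> : ((2 * m).+2 - 2 = 2 * m)%N by lia.
  rewrite /cspan mulr_sumr -big_split/= big1// => i _.
  rewrite [X in _ + X]mulrCA -mulrDr !addnS cjet_eq.
  by rewrite /M ifF ?mulr0//; lia.
- move=> l lm; rewrite cspan_at0; last by lia.
  have lm' : (l < m.+1)%N by lia.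
  by have := cspan_at1 c (Ordinal lm'); rewrite cH mxE.
(* A combination that vanishes on [[0, 1]] has all derivatives 0 at the point 0, against
   [cspan_inj]. *)
- apply: contrapT => H; move/negP: cn0; apply; apply/eqP/cspan_inj => l.
  have Z y : `[0, 1]%classic y -> (fun=> 0 : R) y = cspan c 0 y.
    move=> Iy; apply/esym/eqP/negP => /negP ?; apply: H; by exists y.
  have I0 : `[0, 1]%classic (0 : R) by rewrite /= in_itv/= lexx ler01.
  rewrite -(derive1n_within_jet l (der_cspan c) Z I0).
  by rewrite (@derive1n_within_jet _ _ (fun _ _ => 0) _ l)// => ?; exact: der_cst.
Qed.

End ClampedSolutions.

(** * Clamped functions and the quadratic form *)

Section Clamped.
Context {R : realType} (m : nat).
Implicit Types (U V : nat -> R -> R) (a mu x : R).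

(** With k = m + 1, [U l] stands for the [l]-th derivative of [U 0]. Regularity stops at order
    [m + 2], which is what [clamped_solve] delivers for a merely continuous right-hand side. *)
Definition clamped U :=
  [/\ forall l, (l <= m.+1)%N -> der (U l) (U l.+1), continuous (U m.+2) &
      forall l, (l <= m)%N -> U l 0 = 0 /\ U l 1 = 0].

Lemma clamped_continuous U l : clamped U -> (l <= m.+2)%N -> continuous (U l).
Proof.
move=> [dU cU _]; rewrite leq_eqVlt => /predU1P[->//|lm].
exact: der_continuous (dU _ _).
Qed.

Definition comb U a V l x := U l x + a * V l x.

Lemma clamped_comb U a V : clamped U -> clamped V -> clamped (comb U a V).
Proof.
move=> aU aV; have [dU cU bU] := aU; have [dV cV bV] := aV; split.
- by move=> l lm; apply: derD (dU _ lm) (derZ _ (dV _ lm)).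
- exact: ctsD cU (ctsZ cV).
- by move=> l lm; have [U0 U1] := bU _ lm; have [V0 V1] := bV _ lm;
    rewrite /comb U0 U1 V0 V1 mulr0 addr0.
Qed.

Definition dot l U V := ig (fun x => U l x * V l x) 0 1.

Lemma dotC l U V : dot l U V = dot l V U.
Proof. by congr ig; apply/funext => x; rewrite mulrC. Qed.

Lemma dot_comb l U a V : clamped U -> clamped V -> (l <= m.+2)%N ->
  dot l (comb U a V) (comb U a V) =
  dot l U U + 2 * a * dot l U V + a ^+ 2 * dot l V V.
Proof.
move=> aU aV lm; have cU := clamped_continuous aU lm.
have cV := clamped_continuous aV lm; rewrite /dot /comb.
have -> : (fun x => (U l x + a * V l x) * (U l x + a * V l x)) =
  (fun x => U l x * U l x + 2 * a * (U l x * V l x) + a ^+ 2 * (V l x * V l x)).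
  by apply/funext => x; ring.
have cUU := ctsM cU cU; have cUV := ctsM cU cV; have cVV := ctsM cV cV.
by rewrite !igD// ?igZ//; [exact: ctsZ|apply: ctsD => //; exact: ctsZ|exact: ctsZ].
Qed.

Lemma dot_ge0 l U : clamped U -> (l <= m.+2)%N -> 0 <= dot l U U.
Proof.
move=> aU lm; have cU := clamped_continuous aU lm.
by apply: ig_ge0 => //; [exact: ctsM|move=> x _; rewrite -expr2 sqr_ge0].
Qed.

Definition bform mu U V := dot m.+1 U V - mu * dot m U V.

Lemma bform_comb mu U a V : clamped U -> clamped V ->
  bform mu (comb U a V) (comb U a V) =
  bform mu U U + 2 * a * bform mu U V + a ^+ 2 * bform mu V V.
Proof. by move=> aU aV; rewrite /bform !dot_comb//; [ring|lia..]. Qed.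

(** Integration by parts moves one derivative from [U] to [V]; the boundary terms vanish with
    [U m]. *)
Lemma bform_weak mu U V : clamped U -> clamped V ->
  bform mu U V = - ig (fun x => U m x * (V m.+2 x + mu * V m x)) 0 1.
Proof.
move=> aU aV; have cU l := clamped_continuous (l := l) aU.
have cV l := clamped_continuous (l := l) aV.
have [[dU _ bU] [dV _ _]] := (aU, aV).
have := ig_parts 0 1 (dV m.+1 _) (dU m _) (cV m.+2 _) (cU m.+1 _).
have [|-> ->] := bU m _ => //; rewrite !mulr0 subrr sub0r => /(_ _ _ _ _)/esym P.
rewrite /bform [dot m.+1 _ _]dotC {1}/dot -P//.
have -> : (fun x => U m x * (V m.+2 x + mu * V m x)) =
    (fun x => V m.+2 x * U m x + mu * (U m x * V m x)).
  by apply/funext => x; ring.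
have mm : (m <= m.+2)%N by lia.
have cm1 := ctsM (cV m.+2 (leqnn _)) (cU m mm).
have cm2 := ctsM (cU m mm) (cV m mm).
rewrite /dot igD ?igZ ?opprD//; exact: ctsZ.
Qed.

(** Each integration by parts lowers the degree by one and leaves no boundary term; [U m] is an
    [m]-th derivative, so [i < m] leaves room for [i + 1] of them. *)
Lemma clamped_orth U i : clamped U -> (i < m)%N ->
  ig (fun x => monom i x * U m x) 0 1 = 0.
Proof.
move=> aU; have cU l := clamped_continuous (l := l) aU; have [dU _ bU] := aU.
have cm n : continuous (@monom R n)
  by apply: ctsM; [apply: (@ctsX _ id) => x; exact: cvg_id|exact: cst_cts].
suff H n : forall l, (n <= l)%N -> (l < m)%N ->
    ig (fun x => monom n x * U l.+1 x) 0 1 = 0.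
  by move=> im; rewrite -(prednK (leq_ltn_trans (leq0n _) im)); apply: (H i); lia.
elim: n => [|n IH] l nl lm.
  have -> : (fun x => monom 0 x * U l.+1 x) = U l.+1.
    by apply/funext => x; rewrite /monom expr0 divr1 mul1r.
  rewrite (ig_der _ _ _ (dU l _)); [|apply: cU; lia|lia].
  by have [|-> ->] := bU l _; [lia|rewrite subrr].
rewrite (ig_parts _ _ (@der_monom R n) (dU l _) _ (cU l.+1 _))//; [|lia|lia].
have [|-> ->] := bU l _; first lia.
by rewrite !mulr0 subrr sub0r -(prednK (leq_ltn_trans (leq0n _) nl)) IH ?oppr0//; lia.
Qed.

Lemma continuous_bounded01 (f : R -> R) : continuous f ->
  exists2 K, 0 <= K & forall x, 0 <= x <= 1 -> `|f x| <= K.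
Proof.
move=> cf; have cnf : {within `[0, 1], continuous (fun x => `|f x|)}.
  exact/continuous_subspaceT/continuous_normr.
have [c _ H] := EVT_max ler01 cnf; by exists `|f c|.
Qed.

Section Solve.
Variables (w : R) (w0 : 0 < w) (v : R -> R) (cv : continuous v).
Hypothesis v1 : ig (fun x => `|v x|) 0 1 <= 1.

Let wn0 : w != 0. Proof. by rewrite gt_eqF. Qed.

Let cw x := cos (0 + w * x).
Let sw x := sin (0 + w * x).

Let dcw : der cw (fun x => - w * sw x).
Proof.
by apply: der_eq (@der_affine R cos _ 0 w (fun x => is_derive_cos x)) _ => x;
   rewrite /sw; ring.
Qed.

Let dsw : der sw (fun x => w * cw x).
Proof. exact: (@der_affine R sin _ 0 w (fun x => is_derive_sin x)). Qed.

Let ccw : continuous cw. Proof. exact: der_continuous dcw. Qed.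
Let csw : continuous sw. Proof. exact: der_continuous dsw. Qed.

Let Ic := prim (fun x => cw x * v x).
Let Is := prim (fun x => sw x * v x).

Let dIc : der Ic (fun x => cw x * v x). Proof. exact/der_prim/ctsM. Qed.
Let dIs : der Is (fun x => sw x * v x). Proof. exact/der_prim/ctsM. Qed.

Let prim_le1 (f : R -> R) x : continuous f -> (forall t, `|f t| <= 1) ->
  0 <= x <= 1 -> `|prim (fun t => f t * v t) x| <= 1.
Proof.
move=> cf f1 /andP[x0 x1].
have -> : prim (fun t => f t * v t) x = ig (fun t => f t * v t) 0 x.
  by rewrite /ig prim0 subr0.
have cva := continuous_normr cv.
apply: le_trans (_ : ig (fun t => `|v t|) 0 x <= 1).
  apply: ler_norm_ig => //; first exact: ctsM.
  by move=> t _; rewrite normrM ler_piMl.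
rewrite (le_trans _ v1)// -(ig_cat _ 0 x 1) lerDl; apply: ig_ge0 => //.
Qed.

(** Duhamel's formula [- w^-1 int_0^x sin (w (x - t)) v t dt] for W'' + w^2 W = - v with zero Cauchy
    data at 0, expanded by the addition theorem so that it can be differentiated through [Ic] and
    [Is]. *)
Let W0 x : R := - w^-1 * (sw x * Ic x - cw x * Is x).
Let W1 x := - (cw x * Ic x + sw x * Is x).
Let W2 x := - v x - w ^+ 2 * W0 x.

Let dW0 : der W0 W1.
Proof.
apply: der_eq (derZ (- w^-1) (derB (derM dsw dIc) (derM dcw dIs))) _ => x.
rewrite /W1; field; exact: wn0.
Qed.

Let dW1 : der W1 W2.
Proof.
apply: der_eq (derN (derD (derM dcw dIc) (derM dsw dIs))) _ => x.
have E : cw x ^+ 2 + sw x ^+ 2 = 1 by rewrite cos2Dsin2.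
rewrite /W2 /W0.
transitivity (- (cw x ^+ 2 + sw x ^+ 2) * v x + w * (sw x * Ic x - cw x * Is x)).
  by ring.
by rewrite E; field; exact: wn0.
Qed.

Let cW0 : continuous W0. Proof. exact: der_continuous dW0. Qed.
Let cW2 : continuous W2. Proof. by apply: ctsB; [exact: ctsN|exact: ctsZ]. Qed.

(** [W0] has to be the [m]-th derivative, so the lower orders are its iterated primitives, which
    vanish at 0. *)
Let Y l x := if (l <= m)%N then iter (m - l) prim W0 x
             else if l == m.+1 then W1 x else W2 x.

Let citer n : continuous (iter n prim W0).
Proof.
by elim: n => [//|n IH]; exact: der_continuous (der_prim IH).
Qed.

Let dY l : (l <= m.+1)%N -> der (Y l) (Y l.+1).
Proof.
rewrite /Y leq_eqVlt => /predU1P[->|]; first by rewrite ltnn eqxx ltnNge leqnSn/= gtn_eqF.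
rewrite ltnS => lm; rewrite lm; case: ltngtP lm => // [lm _|-> _].
  have -> : (m - l = (m - l.+1).+1)%N by lia.
  by apply: der_prim; exact: citer.
by rewrite subnn eqxx.
Qed.

Let W0_at0 : W0 0 = 0.
Proof. by rewrite /W0 /Ic /Is !prim0 !mulr0 subrr mulr0. Qed.

Let Y_at0 l : (l <= m)%N -> Y l 0 = 0.
Proof. by rewrite /Y => ->; case: (m - l)%N => //= n; rewrite prim0. Qed.

Let W0_le x : 0 <= x <= 1 -> `|W0 x| <= 2 / w.
Proof.
move=> x01; rewrite /W0 normrM normrN normfV (gtr0_norm w0) mulrC ler_pM2r ?invr_gt0//.
rewrite (le_trans (ler_normB _ _))// !normrM.
have sc t : `|sin t : R| <= 1 /\ `|cos t : R| <= 1.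
  by rewrite !ler_norml sin_le1 sin_geN1 cos_le1 cos_geN1.
have -> : 2 = 1 * 1 + 1 * 1 :> R by rewrite !mulr1.
by apply: lerD; apply: ler_pM; rewrite ?normr_ge0//; try apply: prim_le1 => //;
   try (by move=> t; apply sc); apply sc.
Qed.

Let iter_le n x : 0 <= x <= 1 -> `|iter n prim W0 x| <= 2 / w.
Proof.
elim: n x => [|n IH] x x01; first exact: W0_le.
have [x0 x1] := andP x01.
have -> : iter n.+1 prim W0 x = ig (iter n prim W0) 0 x by rewrite /ig prim0 subr0.
have W2w : 0 <= 2 / w by rewrite divr_ge0// ltW.
apply: (@le_trans _ _ (ig (fun=> 2 / w) 0 x)).
  apply: ler_norm_ig => //; first exact: cst_cts.
  by move=> t /andP[t0 tx]; apply: IH; rewrite t0 (le_trans tx).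
by rewrite ig_cst subr0 ler_piMr.
Qed.

Let r : 'rV[R]_m.+1 := \row_l Y l 1.
Let c := - r *m invmx (hankel w m).

(* Variation of constants, followed by a correction by [cspan] restoring the conditions at 1. *)
Lemma clamped_solve : hankel w m \in unitmx ->
  exists V (c : 'rV[R]_m.+1), [/\ clamped V,
    (forall x, V m.+2 x + w ^+ 2 * V m x = - v x + \sum_(i < m.+1) c 0 i *
       (if (i < m)%N then monom (m.-1 - i) x else 0)),
    (forall x, 0 <= x <= 1 -> `|V m x| <= 2 / w + \sum_(i < m.+1) `|c 0 i| * `|cjet w m (i + m) x|) &
    forall i, `|c 0 i| <= \sum_l 2 / w * `|invmx (hankel w m) l i|].
Proof.
move=> Hu; exists (fun l x => Y l x + cspan w c l x), c; split.
- split.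
  + by move=> l lm; exact: derD (dY lm) (der_cspan w0 c l).
  + apply: ctsD; last exact: der_continuous (der_cspan w0 c _).
    by rewrite /Y ltnNge leqnSn/= gtn_eqF.
  + move=> l lm; split; first by rewrite Y_at0// cspan_at0// addr0.
    have lm' : (l < m.+1)%N by [].
    by rewrite (cspan_at1 w c (Ordinal lm')) /c mulmxKV// !mxE subrr.
- move=> x; rewrite mulrDr addrACA; congr (_ + _).
    rewrite /Y ltnNge leqnSn/= gtn_eqF// leqnn subnn /= /W2; ring.
  rewrite /cspan mulr_sumr -big_split/=; apply: eq_bigr => i _.
  rewrite [X in _ + X]mulrCA -mulrDr !addnS cjet_eq//; congr (_ * _).
  have -> : ((i + m).+2 <= (2 * m).+1)%N = (i < m)%N by lia.
  by case: ifPn => // im; congr monom; lia.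
- move=> x x01; rewrite (le_trans (ler_normD _ _))// lerD//.
    by rewrite /Y leqnn; exact: iter_le.
  rewrite (le_trans (ler_norm_sum _ _ _))//; apply: ler_sum => i _.
  by rewrite normrM.
- move=> i; rewrite mxE (le_trans (ler_norm_sum _ _ _))//; apply: ler_sum => l _.
  rewrite !mxE normrM normrN ler_wpM2r//.
  by rewrite /Y -ltnS ltn_ord; apply: iter_le; rewrite ler01 lexx.
Qed.

End Solve.
End Clamped.

(** * The infimum of the Rayleigh quotient *)

Section Wirtinger.
Context {R : realType} (m : nat).
Implicit Types (U V : nat -> R -> R) (a mu x : R).

Lemma ig_norm_le1 (f : R -> R) : continuous f -> ig (fun x => f x * f x) 0 1 = 1 ->
  ig (fun x => `|f x|) 0 1 <= 1.
Proof.
move=> cf f1; have cff := ctsM cf cf.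
apply: (@le_trans _ _ (ig (fun x => 2^-1 + 2^-1 * (f x * f x)) 0 1)).
  apply: le_ig => //; first exact: continuous_normr.
    by apply: ctsD; [exact: cst_cts|exact: ctsZ].
  move=> x _; rewrite -expr2 -real_normK ?num_real//.
  have := sqr_ge0 (`|f x| - 1); lra.
rewrite igD ?igZ ?ig_cst ?f1//; [lra|exact: cst_cts|exact: ctsZ].
Qed.

(** The resolvent estimate off the spectrum. What matters is that [C] depends on [w] and [m] alone
    and not on the normalised [U]. *)
Lemma bform_small w : 0 < w -> hankel w m \in unitmx -> exists2 C, 0 < C &
  forall U, clamped m U -> dot m U U = 1 -> exists V,
    [/\ clamped m V, bform m (w ^+ 2) U V = 1 & bform m (w ^+ 2) V V <= C].
Proof.
move=> w0 Hu; pose B i := \sum_l 2 / w * `|invmx (hankel w m) l i|.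
have B0 i : 0 <= B i by apply: sumr_ge0 => l _; rewrite mulr_ge0// divr_ge0// ltW.
have K i := continuous_bounded01 (der_continuous (der_cjet w0 m i)).
pose K' i := sval (cid2 (K i)).
have K'0 i : 0 <= K' i by rewrite /K'; case: cid2.
have K'P i x : 0 <= x <= 1 -> `|cjet w m i x| <= K' i.
  by rewrite /K'; case: cid2 => /= ? _; exact.
(* A bound for [V m] on [[0, 1]]: [2 / w] for the Duhamel part, and for the correction [B i] bounds
   the coefficients and [K'] the functions [cjet]. *)
pose C := 2 / w + \sum_(i < m.+1) B i * K' (i + m)%N.
have C0 : 0 < C by rewrite ltr_pwDl ?divr_gt0// sumr_ge0// => i _; rewrite mulr_ge0.
exists C => // U aU U1; have mm : (m <= m.+2)%N by lia.
have cU := clamped_continuous aU mm; have Ua := ig_norm_le1 cU U1.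
have [V [c [aV eqV leV cB]]] := clamped_solve w0 cU Ua Hu.
have cV := clamped_continuous aV mm.
(* [V] represents the functional [dot m W U] for the form: the equation for [V] leaves [- U m] and
   polynomials of degree below [m], which are orthogonal to [W m]. *)
have eqI W : clamped m W -> bform m (w ^+ 2) W V = dot m W U.
  move=> aW; have cW := clamped_continuous aW mm.
  rewrite bform_weak//; under eq_fun do rewrite eqV.
  have -> : (fun x => W m x * (- U m x + \sum_(i < m.+1) c 0 i *
       (if (i < m)%N then monom (m.-1 - i) x else 0))) = (fun x =>
     -1 * (W m x * U m x) + \sum_(i < m.+1) c 0 i * ((if (i < m)%N then monom (m.-1 - i) x else 0) * W m x)).
    apply/funext => x; rewrite mulrDr mulrN mulN1r mulr_sumr; congr (_ + _).
    by apply: eq_bigr => i _; ring.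
  have cM i : continuous (fun x : R => (if (i < m)%N then monom (m.-1 - i) x else 0) * W m x).
    apply: ctsM => //; case: (i < m)%N; last exact: cst_cts.
    by apply: ctsM; [apply: (@ctsX _ id) => x; exact: cvg_id|exact: cst_cts].
  have cS : continuous (fun x : R => \sum_(i < m.+1) c 0 i * ((if (i < m)%N then monom (m.-1 - i) x else 0) * W m x)).
    by apply: sum_continuous => i; exact: ctsZ.
  rewrite igD//; last by apply: ctsZ; exact: ctsM.
  rewrite igZ; last exact: ctsM.
  rewrite ig_sum; last by move=> i; exact: ctsZ.
  rewrite big1 ?addr0 ?mulN1r ?opprK// => i _; rewrite igZ//.
  have [im|im] := boolP (i < m)%N; first by rewrite clamped_orth ?mulr0//; lia.
  by under eq_fun do rewrite mul0r; rewrite ig_cst mul0r mulr0.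
exists V; split => //; first by rewrite eqI.
rewrite eqI//; apply: le_trans (_ : ig (fun x => C * `|U m x|) 0 1 <= _).
  apply: le_trans (ler_norm _) _; apply: ler_norm_ig => //; first exact: ctsM.
    by apply: ctsZ; exact: continuous_normr.
  move=> x x01; rewrite normrM ler_wpM2r// (le_trans (leV _ x01))// lerD2l.
  by apply: ler_sum => i _; apply: ler_pM => //; exact: K'P.
by rewrite igZ ?ler_piMr// ?ltW//; exact: continuous_normr.
Qed.

Definition scal a U l x := a * U l x.

Lemma clamped_scal a U : clamped m U -> clamped m (scal a U).
Proof.
move=> [dU cU bU]; split; first by move=> l lm; exact: derZ (dU l lm).
  exact: ctsZ.
by move=> l lm; rewrite /scal; have [-> ->] := bU l lm; rewrite mulr0.
Qed.

Lemma dot_scal l a U : clamped m U -> (l <= m.+2)%N ->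
  dot l (scal a U) (scal a U) = a ^+ 2 * dot l U U.
Proof.
move=> aU lm; have cU := clamped_continuous aU lm.
rewrite /dot -igZ; last exact: ctsM.
by congr ig; apply/funext => x; rewrite /scal; ring.
Qed.

(** A positive lower bound allows the infimum of the Rayleigh quotient to be written [w ^+ 2] with
    [w > 0]. If the quotient were below 1, integrating [U m.+1] from 0 would give [|U m| < 1]
    throughout, against the normalisation. *)
Lemma clamped_poincare U : clamped m U -> dot m U U = 1 -> 1 <= dot m.+1 U U.
Proof.
move=> aU U1; have [dU _ bU] := aU; have cU l := clamped_continuous (l := l) aU.
rewrite leNgt; apply/negP => U'1; set D := dot m.+1 U U in U'1.
have D0 : 0 <= D by apply: dot_ge0 aU _; lia.
have cm := cU m _; have cm1 := cU m.+1 _; have cff := ctsM (cm1 _) (cm1 _).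
have H x : 0 <= x <= 1 -> `|U m x| <= (1 + D) / 2.
  move=> /andP[x0 x1].
  have -> : U m x = ig (U m.+1) 0 x.
    rewrite (ig_der _ _ _ (dU m _))//; last by apply: cm1; lia.
    by have [//|-> _] := bU m _; rewrite subr0.
  have cg : continuous (fun x => 2^-1 + 2^-1 * (U m.+1 x * U m.+1 x)).
    by apply: ctsD; [exact: cst_cts|apply: ctsZ; exact: cff].
  apply: (@le_trans _ _ (ig (fun x => 2^-1 + 2^-1 * (U m.+1 x * U m.+1 x)) 0 x)).
    apply: ler_norm_ig => //; first by apply: cm1; lia.
    move=> t _; rewrite -expr2 -real_normK ?num_real//.
    have := sqr_ge0 (`|U m.+1 t| - 1); lra.
  apply: (@le_trans _ _ (ig (fun x => 2^-1 + 2^-1 * (U m.+1 x * U m.+1 x)) 0 1)).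
    rewrite -(ig_cat _ 0 x 1) lerDl; apply: ig_ge0 => // t _.
    by rewrite addr_ge0// mulr_ge0// -expr2 sqr_ge0.
  rewrite igD ?igZ ?ig_cst -/(dot m.+1 U U) -/D; [lra|by apply: cff; lia|exact: cst_cts|].
  by apply: ctsZ; apply: cff; lia.
have : dot m U U <= ig (fun=> ((1 + D) / 2) ^+ 2) 0 1.
  apply: le_ig => //; [apply: ctsM; apply: cm; lia|exact: cst_cts|].
  by move=> x /H Hx; rewrite -expr2 -real_normK ?num_real// lerXn2r// nnegrE; lra.
by rewrite U1 ig_cst subr0 mulr1 leNgt expr_lt1//; lra.
Qed.

Lemma wirtinger_clamped nu U : is_wirtinger_cimmino m.+1 nu -> clamped m U ->
  nu ^+ 2 * dot m U U <= dot m.+1 U U.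
Proof.
move=> [nu0 _ nu_min] aU; rewrite leNgt; apply/negP => lt_nu.
have mm : (m <= m.+2)%N by lia.
have m1 : (m.+1 <= m.+2)%N by lia.
have nrm V : clamped m V -> 0 < dot m V V -> exists W, [/\ clamped m W, dot m W W = 1 &
    dot m.+1 W W = dot m.+1 V V / dot m V V].
  move=> aV V0; exists (scal (Num.sqrt (dot m V V))^-1 V); split.
  - exact: clamped_scal.
  - by rewrite dot_scal// exprVn sqr_sqrtr ?mulVf ?gt_eqF// ltW.
  - by rewrite dot_scal// exprVn sqr_sqrtr; [rewrite mulrC|rewrite ltW].
pose E := [set e | exists V, [/\ clamped m V, dot m V V = 1 & dot m.+1 V V = e]].
have U0 : 0 < dot m U U.
  rewrite lt_neqAle (dot_ge0 aU)// andbT eq_sym; apply/eqP => U0; move: lt_nu.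
  by rewrite U0 mulr0 ltNge (dot_ge0 aU).
have E1 : lbound E 1 by move=> e [V [aV V1 <-]]; exact: clamped_poincare.
have [W [aW W1 W2]] := nrm _ aU U0.
have hE : has_inf E by split; [exists (dot m.+1 W W), W|exists 1].
pose mu := inf E; have mu1 : 1 <= mu by apply: lb_le_inf => //; exact: hE.1.
have mu_nu : mu < nu ^+ 2.
  apply: le_lt_trans (_ : dot m.+1 W W < _).
    by apply: ge_inf; [exact: hE.2|exists W].
  by rewrite W2 ltr_pdivrMr.
have mu_min V : clamped m V -> mu * dot m V V <= dot m.+1 V V.
  move=> aV; have := dot_ge0 aV mm; rewrite le_eqVlt => /predU1P[<-|V0].
    by rewrite mulr0 (dot_ge0 aV).
  have [Z [aZ Z1 Z2]] := nrm _ aV V0; rewrite -ler_pdivlMr// -Z2.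
  by apply: ge_inf; [exact: hE.2|exists Z].
pose w := Num.sqrt mu; have w0 : 0 < w by rewrite sqrtr_gt0; lra.
have ww : w ^+ 2 = mu by rewrite sqr_sqrtr//; lra.
have [Hu|Hu] := boolP (hankel w m \in unitmx); last first.
  have := nu_min (w ^+ 2) _ (hankel_eigenvalue w0 Hu).
  by rewrite ww leNgt mu_nu => /(_ _)/notF; apply; lra.
have [C C0 HC] := bform_small w0 Hu.
have [e [V [aV V1 Ve]] eC] : exists2 e, E e & e < mu + C^-1.
  by apply: inf_adherent => //; rewrite invr_gt0.
have [Z [aZ VZ ZC]] := HC V aV V1.
(* Along [V + a Z] the form is at most its value at [V] plus [2 a + a^2 C]. The minimum, at
   [a = - 1 / C], lowers it by [1 / C], more than the excess of [V] over the infimum. *)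
have aY := clamped_comb (- C^-1) aV aZ.
have := mu_min _ aY; rewrite -subr_ge0 -/(bform m mu _ _) bform_comb// -ww VZ.
rewrite mulr1 /bform V1 mulr1 Ve ww.
have : C^-1 ^+ 2 * bform m (w ^+ 2) Z Z <= C^-1.
  rewrite [C^-1 ^+ 2]expr2 -mulrA ler_piMr ?invr_ge0 ?(ltW C0)//.
  by rewrite mulrC ler_pdivrMr// mul1r.
rewrite /bform ww sqrrN; lra.
Qed.

Lemma wirtinger_interval nu sigma (P : nat -> R -> R) a b :
  is_wirtinger_cimmino m.+1 nu -> 0 < sigma -> (forall l, der (P l) (P l.+1)) ->
  a < b -> b - a <= nu / sigma ->
  (forall l, (l <= m)%N -> P l a = 0 /\ P l b = 0) ->
  sigma ^+ 2 * ig (fun x => P m x ^+ 2) a b <= ig (fun x => P m.+1 x ^+ 2) a b.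
Proof.
move=> nuP s0 dP ab lab P0; pose h := b - a; have h0 : 0 < h by rewrite subr_gt0.
have cP l : continuous (P l) by exact: der_continuous (dP l).
pose U l x := h ^+ l * P l (a + h * x).
have dU l : der (U l) (U l.+1).
  by apply: der_eq (derZ _ (der_affine a h (dP l))) _ => x; rewrite /U exprSr mulrA.
have aU : clamped m U.
  split => //; first exact: der_continuous (dU _).
  move=> l /P0[Pa Pb]; rewrite /U mulr0 addr0 mulr1 Pa mulr0.
  by rewrite (_ : a + h = b) ?Pb ?mulr0// /h; ring.
have E l : h * dot l U U = h ^+ l ^+ 2 * ig (fun x => P l x ^+ 2) a b.
  have cPa : continuous (fun x => P l (a + h * x) ^+ 2) by exact/ctsX/ctsA.
  have := ig_affine a h 0 1 (ctsX (n := 2) (cP l)).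
  rewrite mulr0 addr0 mulr1 (_ : a + h = b) => [<-|]; last by rewrite /h; ring.
  rewrite mulrCA; congr (h * _); rewrite -igZ// /dot; congr ig.
  by apply/funext => x; rewrite /U; ring.
have : nu ^+ 2 * (h * dot m U U) <= h * dot m.+1 U U.
  by rewrite mulrCA ler_pM2l//; exact: wirtinger_clamped.
rewrite !E => H0.
have H : nu ^+ 2 * ig (fun x => P m x ^+ 2) a b <= h ^+ 2 * ig (fun x => P m.+1 x ^+ 2) a b.
  rewrite -(@ler_pM2l _ (h ^+ m ^+ 2)) ?exprn_gt0//.
  rewrite mulrCA (le_trans H0)// le_eqVlt; apply/orP; left; apply/eqP.
  by rewrite [h ^+ m.+1]exprS; ring.
set I1 := ig (fun x => P m.+1 x ^+ 2) a b in H *.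
have I10 : 0 <= I1.
  by apply: ig_ge0 => [||x _]; [exact: ctsX|exact: ltW|exact: sqr_ge0].
have [nu0 _ _] := nuP.
have H2 : h ^+ 2 <= (nu / sigma) ^+ 2
  by rewrite lerXn2r ?nnegrE// ltW// divr_gt0.
have := le_trans H (ler_wpM2r I10 H2).
have -> : (nu / sigma) ^+ 2 * I1 = nu ^+ 2 * (I1 / sigma ^+ 2).
  by field; rewrite gt_eqF.
by rewrite ler_pM2l ?exprn_gt0// ler_pdivlMr ?exprn_gt0// mulrC.
Qed.

End Wirtinger.

(** * Uniqueness from energy bounds on the derivatives *)

Lemma young4 (R : realType) (a b c d : R) :
  a * b - c * d <= 2^-1 * (a ^+ 2 + b ^+ 2 + (c ^+ 2 + d ^+ 2)).
Proof. have := sqr_ge0 (a - b); have := sqr_ge0 (c + d); nra. Qed.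

Lemma young_scaled (R : realType) (s a b : R) : 0 < s ->
  -1 * (a * b) <= 2^-1 * (s ^+ 2 * b ^+ 2 + s ^- 2 * a ^+ 2).
Proof.
move=> s0; have := sqr_ge0 (s * b + s^-1 * a).
have -> : (s * b + s^-1 * a) ^+ 2 = s ^+ 2 * b ^+ 2 + s ^- 2 * a ^+ 2 + 2 * (a * b).
  by field; rewrite gt_eqF.
lra.
Qed.

Section EnergyConvexity.
Context {R : realType}.
Variables (P : nat -> R -> R) (sigma : R) (beta : nat -> R).
Hypothesis s0 : 0 < sigma.
Hypothesis dP : forall l, der (P l) (P l.+1).
Hypothesis bP : forall l c d, c <= d ->
  ig (fun x => P l x ^+ 2) c d <= sigma ^+ (2 * l) * beta l.

Let cP l : continuous (P l). Proof. exact: der_continuous (dP l). Qed.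
Let cP2 l : continuous (fun x => P l x ^+ 2). Proof. exact: ctsX. Qed.

Let J l A := ig (fun x => P l x ^+ 2) (- A) A.

(** The squared L^2 norm of [P l] on the line. [beta] is only a majorant, so convexity is proved for
    [S], and [beta] serves for finiteness and for the limit. *)
Let S l := sup [set J l A | A in [set A | 0 <= A]].

Let has_sup_J l : has_sup [set J l A | A in [set A | 0 <= A]].
Proof.
split; first by exists (J l 0), 0 => /=.
by exists (sigma ^+ (2 * l) * beta l) => _ [A /= A0 <-]; apply: bP; lra.
Qed.

Let J_le l A : 0 <= A -> J l A <= S l.
Proof. by move=> A0; apply: ub_le_sup; [have [] := has_sup_J l|exists A]. Qed.

Let S_le l M : (forall A, 0 <= A -> J l A <= M) -> S l <= M.
Proof.
move=> H; apply: ge_sup; first by have [] := has_sup_J l.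
by move=> _ [A /= A0 <-]; exact: H.
Qed.

Let S_beta l : S l <= sigma ^+ (2 * l) * beta l.
Proof. by apply: S_le => A A0; apply: bP; lra. Qed.

Let ig_mono l a b c d : a <= b -> b <= c -> c <= d ->
  ig (fun x => P l x ^+ 2) b c <= ig (fun x => P l x ^+ 2) a d.
Proof.
move=> ab bc cd; rewrite -(ig_cat _ a b d) -(ig_cat _ b c d).
have c2 : continuous (fun x => P l x ^+ 2) := @cP2 l.
have := ig_ge0 c2 ab (fun x _ => sqr_ge0 _).
have := ig_ge0 c2 cd (fun x _ => sqr_ge0 _); lra.
Qed.

Let ig_leS l c d : c <= d -> ig (fun x => P l x ^+ 2) c d <= S l.
Proof.
move=> cd; pose A := `|c| + `|d|.
have A0 : 0 <= A by rewrite addr_ge0.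
apply: le_trans (J_le l A0); apply: ig_mono => //.
- by have := ler_norm (- c); have := normr_ge0 d; rewrite normrN /A; lra.
- by have := ler_norm d; have := normr_ge0 c; rewrite /A; lra.
Qed.

Let S_ge0 l : 0 <= S l.
Proof. by rewrite -(igxx (fun x => P l x ^+ 2) 0); exact: ig_leS. Qed.

Let bdry l A := P l A * P l.+1 A - P l (- A) * P l.+1 (- A).

(* The boundary terms are integrable at infinity, hence small somewhere. *)
Let bdry_small l A0 e : 0 <= A0 -> 0 < e -> exists2 A, A0 <= A & bdry l A <= e.
Proof.
move=> A00 e0; apply: contrapT => H.
have {}H A : A0 <= A -> e < bdry l A.
  by move=> AA; rewrite ltNge; apply/negP => ?; apply: H; exists A.
(* Over a window of this length the constant [e] integrates to [S l + S l.+1 + e], more than the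
   Young bound for [bdry] permits. *)
pose T := (S l + S l.+1) / e + 1.
have T0 : 0 <= T by rewrite addr_ge0// divr_ge0 ?addr_ge0// ltW.
pose g x := P l x ^+ 2 + P l.+1 x ^+ 2.
have cg : continuous g by exact: ctsD.
have cgN : continuous (fun x : R => g (0 + (-1) * x)) by exact: ctsA.
have : ig (fun=> e) A0 (A0 + T) <=
       ig (fun x => 2^-1 * (g x + g (0 + (-1) * x))) A0 (A0 + T).
  apply: le_ig; [exact: cst_cts|by apply: ctsZ; exact: ctsD|by rewrite lerDl|].
  move=> x /andP[/H xe _]; apply: le_trans (ltW xe) _.
  by rewrite /bdry /g add0r mulN1r young4.
rewrite ig_cst igZ; last exact: ctsD.
have EN : ig (fun x : R => g (0 + (-1) * x)) A0 (A0 + T) = ig g (- (A0 + T)) (- A0).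
  have := ig_affine 0 (-1) A0 (A0 + T) cg; rewrite !add0r !mulN1r => /(congr1 -%R).
  by rewrite opprK /ig opprB.
rewrite igD// EN /g !igD//.
have le0T : A0 <= A0 + T by rewrite lerDl.
have leNT : - (A0 + T) <= - A0 by rewrite lerN2.
have B1 k := @ig_leS k A0 (A0 + T) le0T.
have B2 k := @ig_leS k (- (A0 + T)) (- A0) leNT.
have := B1 l; have := B1 l.+1; have := B2 l; have := B2 l.+1.
have : e * (A0 + T - A0) = S l + S l.+1 + e.
  by rewrite /T; field; rewrite gt_eqF.
lra.
Qed.

(** Integration by parts up to a small boundary term, then Young's inequality. The weights
    [sigma ^+ 2] and [sigma ^- 2] turn the estimate into midpoint convexity of
    [S l / sigma ^+ (2 * l)]. *)
Let S_convex l : S l.+1 <= 2^-1 * (sigma ^+ 2 * S l + sigma ^- 2 * S l.+2).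
Proof.
apply: S_le => A0 A00; apply/ler_addgt0Pl => e e0.
have [A A0A Ae] := bdry_small l A00 e0.
have A1 : 0 <= A := le_trans A00 A0A.
apply: (@le_trans _ _ (J l.+1 A)); first by apply: ig_mono; lra.
have -> : J l.+1 A = bdry l A - ig (fun x => P l.+2 x * P l x) (- A) A.
  have := ig_parts (- A) A (@dP l.+1) (@dP l) (@cP l.+2) (@cP l.+1).
  rewrite /J /bdry; under [in X in X -> _]eq_fun do rewrite -expr2.
  by move=> ->; ring.
have cPP : continuous (fun x => P l.+2 x * P l x) by exact: ctsM.
have cSS : continuous (fun x => 2^-1 * (sigma ^+ 2 * P l x ^+ 2 + sigma ^- 2 * P l.+2 x ^+ 2)).
  by apply: ctsZ; apply: ctsD; exact: ctsZ.
have : ig (fun x => -1 * (P l.+2 x * P l x)) (- A) A <=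
    ig (fun x => 2^-1 * (sigma ^+ 2 * P l x ^+ 2 + sigma ^- 2 * P l.+2 x ^+ 2)) (- A) A.
  apply: le_ig => //; [exact: ctsZ|lra|move=> x _].
  exact: young_scaled.
rewrite igZ// igZ ?igD ?igZ//; [|exact: ctsZ|exact: ctsZ|by apply: ctsD; exact: ctsZ].
rewrite -/(J l A) -/(J l.+2 A) mulN1r => H.
have H1 : sigma ^+ 2 * J l A <= sigma ^+ 2 * S l by rewrite ler_pM2l ?exprn_gt0// J_le.
have H2 : sigma ^- 2 * J l.+2 A <= sigma ^- 2 * S l.+2.
  by rewrite ler_pM2l ?invr_gt0 ?exprn_gt0// J_le.
lra.
Qed.

(** The second hypothesis gives [b m <= b m.+1]; convexity then makes [b] nondecreasing from [m] on,
    and [b] lies below [beta], which tends to 0. Hence [b m = 0]. *)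
Lemma energy_vanish m : beta @ \oo --> 0 ->
  (forall A, 0 <= A -> exists c d, [/\ c <= - A, A <= d &
    sigma ^+ 2 * ig (fun x => P m x ^+ 2) c d <= ig (fun x => P m.+1 x ^+ 2) c d]) ->
  forall x, P m x = 0.
Proof.
move=> beta0 W; pose b l := S l / sigma ^+ (2 * l).
have sn0 : sigma != 0 by rewrite gt_eqF.
have b_convex l : b l.+1 <= 2^-1 * (b l + b l.+2).
  rewrite /b ler_pdivrMr ?exprn_gt0//; apply: le_trans (S_convex l) _.
  rewrite le_eqVlt; apply/orP; left; apply/eqP.
  rewrite !mulnS !exprD; field.
  by rewrite sn0 expf_neq0.
have b_m : b m <= b m.+1.
  rewrite /b mulnS exprD invfM mulrA ler_pM2r ?invr_gt0 ?exprn_gt0//.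
  rewrite ler_pdivlMr ?exprn_gt0// mulrC -ler_pdivlMl ?exprn_gt0//.
  apply: S_le => A A0; have [c [d [cA Ad]]] := W A A0.
  rewrite -ler_pdivlMl ?exprn_gt0// => H; apply: le_trans (le_trans _ H) _.
    by apply: ig_mono => //; lra.
  by rewrite ler_pM2l ?invr_gt0 ?exprn_gt0// ig_leS//; lra.
have b_incr n : b (m + n)%N <= b (m + n).+1.
  elim: n => [|n IH]; first by rewrite addn0.
  by rewrite addnS; have := b_convex (m + n)%N; lra.
have b_ge n : b m <= b (m + n)%N.
  by elim: n => [|n IH]; [rewrite addn0|rewrite addnS (le_trans IH)].
have bm0 : b m <= 0.
  rewrite -(cvg_lim (@Rhausdorff R) beta0); apply: limr_ge; first exact: cvgP beta0.
  exists m => // n /= mn; rewrite -(subnKC mn); apply: le_trans (b_ge _) _.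
  by rewrite /b ler_pdivrMr ?exprn_gt0// mulrC.
have Sm0 : S m = 0.
  by apply/eqP; rewrite eq_le S_ge0 andbT; move: bm0; rewrite /b ler_pdivrMr ?exprn_gt0// mul0r.
move=> x; have [x1 xx] : - (`|x| + 1) < `|x| + 1 /\ - (`|x| + 1) <= x <= `|x| + 1.
  have := ler_norm x; have := ler_norm (- x); rewrite normrN => *.
  by split; [|apply/andP]; have := normr_ge0 x; lra.
have /eqP : P m x ^+ 2 = 0.
  apply: (ig_eq0 (@cP2 m) x1 (fun x _ => sqr_ge0 _) _ xx).
  apply/eqP; rewrite eq_le; apply/andP; split; first by rewrite -Sm0; apply: J_le; rewrite addr_ge0.
  by apply: ig_ge0 => //; [exact: ltW|move=> *; exact: sqr_ge0].
by rewrite sqrf_eq0 => /eqP.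
Qed.

End EnergyConvexity.

(** * Accumulation of zeros and the uniqueness argument *)

Section Uniqueness.
Context {R : realType}.
Variables (P : nat -> R -> R) (sigma C : R).
Hypothesis s0 : 0 < sigma.
Hypothesis dP : forall l, der (P l) (P l.+1).
Hypothesis Pbnd : forall l x, `|P l x| <= C * sigma ^+ l.

Let C0 : 0 <= C.
Proof. by have := Pbnd 0 0; rewrite expr0 mulr1; apply: le_trans. Qed.

Let der_MVT_norm f g (c x : R) : der f g -> f c = 0 ->
  exists2 z, `|z - c| <= `|x - c| & `|f x| = `|g z| * `|x - c|.
Proof.
move=> fg fc; have [cx|/ltW xc] := lerP c x.
  have [z /andP[cz zx]] := der_MVT fg cx; rewrite fc subr0 => ->.
  exists z; first by rewrite ger0_norm ?subr_ge0//; lra.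
  by rewrite normrM (@ger0_norm _ (x - c)) ?subr_ge0.
have [z /andP[xz zc]] := der_MVT fg xc; rewrite fc sub0r => /(congr1 Num.norm).
rewrite normrN normrM (@ger0_norm _ (c - x)) ?subr_ge0// => ->.
by exists z => //; rewrite ler0_norm ?subr_le0//; lra.
Qed.

(** Each use of the mean value theorem passes to the next derivative at the cost of a factor [sigma]
    and gains [|x - c| <= (2 * sigma)^-1], hence a net factor 1/2; iterate. *)
Let flat_ball c : (forall l, P l c = 0) ->
  forall l x, `|x - c| <= (2 * sigma)^-1 -> P l x = 0.
Proof.
move=> Pc l x xc.
have H n : forall l x, `|x - c| <= (2 * sigma)^-1 -> `|P l x| <= C * sigma ^+ l * 2^-1 ^+ n.
  elim: n => [|n IH] {}l {}x {}xc; first by rewrite expr0 mulr1.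
  have [z zx ->] := der_MVT_norm x (dP l) (Pc l).
  apply: le_trans (ler_pM _ _ (IH _ _ (le_trans zx xc)) xc) _ => //.
  rewrite le_eqVlt; apply/orP; left; apply/eqP.
  by rewrite !exprS; field; rewrite gt_eqF.
apply/eqP; rewrite -normr_le0.
have cv : (fun n => C * sigma ^+ l * 2^-1 ^+ n) @ \oo --> (C * sigma ^+ l * 0 : R).
  apply: cvgM; first exact: cvg_cst.
  by apply: cvg_expr; rewrite ger0_norm//; lra.
rewrite mulr0 in cv; rewrite -(cvg_lim (@Rhausdorff R) cv).
by apply: limr_ge; [exact: cvgP cv|near=> n; exact: H].
Unshelve. all: by end_near. Qed.

Lemma flat_vanish c : (forall l, P l c = 0) -> forall x, P 0 x = 0.
Proof.
move=> Pc x; pose r := (2 * sigma)^-1.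
have r0 : 0 < r by rewrite invr_gt0 mulr_gt0.
suff H n : forall x, `|x - c| <= n%:R * r -> forall l, P l x = 0.
  have xn := archi_boundP (divr_ge0 (normr_ge0 (x - c)) (ltW r0)).
  by apply: (H (Num.bound (`|x - c| / r))); rewrite -ler_pdivrMr// ltW.
elim: n => [|n IH] {}x xc l.
  by move: xc; rewrite mul0r normr_le0 subr_eq0 => /eqP ->.
have n1 : (n.+1%:R : R) != 0 by rewrite pnatr_eq0.
(* The point of the segment from [c] to [x] that is within [n r] of [c] and within [r] of [x]. *)
pose c' := c + (x - c) * (n%:R / n.+1%:R).
apply: (@flat_ball c').
  apply: IH; rewrite /c' addrAC subrr add0r normrM (@ger0_norm _ (_ / _))//.
  rewrite mulrCA ler_wpM2l// ler_pdivrMr ?ltr0n// mulrC; exact: xc.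
have -> : x - c' = (x - c) / n.+1%:R.
  by rewrite /c' -(@natr1 _ n); field; rewrite natr1.
by rewrite normrM normfV (@ger0_norm _ n.+1%:R)// ler_pdivrMr ?ltr0n// mulrC.
Qed.

(** By Rolle's theorem a zero of [P l] near its zero [c] produces a zero of [P l.+1] still closer to
    [c], so accumulation at [c] passes to every derivative. *)
Lemma zeros_flat (c : R) : (forall e : R, 0 < e -> exists y : R, [/\ y != c, `|y - c| < e & P 0 y = 0]) ->
  forall l, P l c = 0.
Proof.
move=> H l.
suff : P l c = 0 /\ forall e : R, 0 < e -> exists y : R, [/\ y != c, `|y - c| < e & P l y = 0] by case.
have cont0 n : (forall e : R, 0 < e -> exists y : R, [/\ y != c, `|y - c| < e & P n y = 0]) -> P n c = 0.
  move=> Hn; apply/eqP; rewrite -normr_le0 leNgt; apply/negP => Pn0.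
  have cPn : continuous (P n) := der_continuous (@dP n).
  have /cvgrPdist_lt /(_ _ Pn0) /nbhs_normP[e /= e0 He] := cPn c.
  have [y [_ yc Py]] := Hn e e0; have := He y; rewrite /= distrC Py subr0 ltxx.
  by move=> /(_ yc).
elim: l => [|l [IH0 IH]]; first by split; [exact: cont0|].
suff H1 (e : R) : 0 < e -> exists y : R, [/\ y != c, `|y - c| < e & P l.+1 y = 0].
  by split=> //; exact: cont0.
move=> e0; have [y [yc ye Py]] := IH e e0.
have [z [zc ze Pz]] : exists z : R, [/\ z != c, `|z - c| < `|y - c| & P l.+1 z = 0].
  have R1 (a b : R) : a < b -> P l a = 0 -> P l b = 0 -> exists2 z, a < z < b & P l.+1 z = 0.
    move=> ab Pa Pb.
    have [||z zab ] := @MVT R (P l) (P l.+1) a b ab.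
    - by move=> z _; exact: dP.
    - exact/continuous_subspaceT/der_continuous/dP.
    rewrite Pa Pb subrr => /esym/eqP; rewrite mulf_eq0 subr_eq0 (gt_eqF ab) orbF => /eqP ?.
    by exists z => //; move: zab; rewrite in_itv.
  have [yc'|cy'|yc'] := ltgtP y c.
  - have [z /andP[yz zc] Pz] := R1 _ _ yc' Py IH0; exists z; split => //.
      by rewrite lt_eqF.
    by rewrite !ltr0_norm ?subr_lt0//; lra.
  - have [z /andP[yz zc] Pz] := R1 _ _ cy' IH0 Py; exists z; split => //.
      by rewrite gt_eqF.
    by rewrite !gtr0_norm ?subr_gt0//; lra.
  - by rewrite yc' eqxx in yc.
by exists z; split => //; exact: lt_trans ze ye.
Qed.

Variables (m : nat) (nu : R) (x : int -> R) (beta : nat -> R).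
Hypothesis nuP : is_wirtinger_cimmino m.+1 nu.
Hypothesis xlt : forall i : int, x i < x (i + 1).
Hypothesis xgap : forall i : int, x (i + 1) - x i <= nu / sigma.
Hypothesis Px : forall i l, (l <= m)%N -> P l (x i) = 0.
Hypothesis bP : forall l c d, c <= d ->
  ig (fun x => P l x ^+ 2) c d <= sigma ^+ (2 * l) * beta l.
Hypothesis beta0 : beta @ \oo --> 0.

Let x_homo i (n : nat) : x i <= x (i + n%:Z).
Proof.
elim: n => [|n IH]; first by rewrite addr0.
by rewrite (le_trans IH)// intS addrCA addrC ltW.
Qed.

Let wirt_sum i (n : nat) :
  sigma ^+ 2 * ig (fun x => P m x ^+ 2) (x i) (x (i + n%:Z)) <=
  ig (fun x => P m.+1 x ^+ 2) (x i) (x (i + n%:Z)).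
Proof.
elim: n => [|n IH]; first by rewrite addr0 !igxx mulr0.
rewrite intS addrCA (addrC 1) -(ig_cat _ (x i) (x (i + n%:Z))).
rewrite -[leRHS](ig_cat _ (x i) (x (i + n%:Z))) mulrDr lerD//.
by apply: wirtinger_interval nuP s0 dP _ _ _ => // l lm; rewrite !Px.
Qed.

Lemma uniqueness_jet y : P 0 y = 0.
Proof.
(* Without an accumulation point of zeros, [x] is unbounded in both directions: a finite supremum or
   infimum would be one, since strict monotonicity keeps it from being attained. *)
have [cluster|ncluster] := pselect (exists c : R, forall e : R, 0 < e ->
    exists z : R, [/\ z != c, `|z - c| < e & P 0 z = 0]).
  by have [c /zeros_flat Pc] := cluster; exact: (flat_vanish Pc).
have ub A : exists i, A <= x i.
  apply: contrapT => H; apply: ncluster.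
  have {}H i : x i < A by rewrite ltNge; apply/negP => ?; apply: H; exists i.
  have hs : has_sup (range x) by split; [exists (x 0), 0|exists A => _ [i _ <-]; exact: ltW].
  exists (sup (range x)) => e e0.
  have [_ [i _ <-] xi] := sup_adherent e0 hs.
  have xs : x i < sup (range x).
    by apply: lt_le_trans (xlt i) _; apply: ub_le_sup; [case: hs|exists (i + 1)].
  by exists (x i); split; [rewrite lt_eqF|rewrite ltr0_norm ?subr_lt0//; lra|exact: Px].
have lb A : exists i, x i <= A.
  apply: contrapT => H; apply: ncluster.
  have {}H i : A < x i by rewrite ltNge; apply/negP => ?; apply: H; exists i.
  have hs : has_inf (range x) by split; [exists (x 0), 0|exists A => _ [i _ <-]; exact: ltW].
  exists (inf (range x)) => e e0.
  have [_ [i _ <-] xi] := inf_adherent e0 hs.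
  have xs : inf (range x) < x i.
    apply: le_lt_trans (_ : x (i - 1) < _); last by have := xlt (i - 1); rewrite subrK.
    by apply: ge_inf; [case: hs|exists (i - 1)].
  by exists (x i); split; [rewrite gt_eqF|rewrite gtr0_norm ?subr_gt0//; lra|exact: Px].
have Pm0 : forall z, P m z = 0.
  apply: (energy_vanish s0 dP bP beta0) => A A0.
  have [i xi] := lb (- A); have [j xj] := ub A; exists (x i), (x j); split => //.
  have [ij|ji] := lerP i j.
    have -> : j = i + `|j - i|%N%:Z by lia.
    exact: wirt_sum.
  have : x (j + 1) <= x i.
    have -> : i = j + 1 + `|i - (j + 1)%R|%N%:Z by lia.
    exact: x_homo.
  by have := xlt j; lra.
(* Descent in the order: a function with zero derivative is constant, and [P (m - n)] vanishes at
   [x 0]. *)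
suff H n : (n <= m)%N -> forall z, P (m - n) z = 0 by rewrite -(subnn m); exact: H.
elim: n => [|n IH] nm z; first by rewrite subn0.
have Pn : der (P (m - n.+1)) (fun=> 0).
  apply: der_eq (dP _) _ => t; rewrite (_ : (m - n.+1).+1 = m - n)%N; last by lia.
  exact/IH/ltnW.
by rewrite (der0_cst z (x 0) Pn) Px//; lia.
Qed.

End Uniqueness.

(** * Trigonometric integrals of square integrable functions *)

Section RealIntegrable.
Context {R : realType} (D : set (measurableTypeR R)) (mD : measurable D).
Notation mu := (@lebesgue_measure R).
Implicit Types (f g : R -> R).

Definition rint f := mu.-integrable D (EFin \o f).

Lemma rintD f g : rint f -> rint g -> rint (fun x => f x + g x).
Proof.
move=> hf hg; have := integrableD mD hf hg; exact: eq_integrable.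
Qed.

Lemma rintZ c f : rint f -> rint (fun x => c * f x).
Proof.
move=> hf; have := integrableZl mD c hf; exact: eq_integrable.
Qed.

Lemma rintN f : rint f -> rint (fun x => - f x).
Proof. by move=> /(rintZ (-1)); apply: eq_integrable => // x _; rewrite /= mulN1r. Qed.

Lemma rintB f g : rint f -> rint g -> rint (fun x => f x - g x).
Proof. by move=> hf /rintN; exact: rintD. Qed.

Lemma rint0 : rint (fun=> 0).
Proof. exact: integrable0. Qed.

Lemma rint_sum n (f : 'I_n -> R -> R) : (forall i, rint (f i)) ->
  rint (fun x => \sum_(i < n) f i x).
Proof.
elim: n f => [|n IH] f hf.
  by under eq_fun do rewrite big_ord0; exact: rint0.
by under eq_fun do rewrite big_ord_recr/=; apply: rintD => //; exact: IH.
Qed.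

Lemma rint_le f g : measurable_fun D f -> (forall x, D x -> `|f x| <= g x) ->
  rint g -> rint f.
Proof.
move=> mf fg; apply: le_integrable => //; first exact/measurable_EFinP.
by move=> x Dx /=; rewrite lee_fin (le_trans (fg _ Dx))// ler_norm.
Qed.

Lemma rint_normr f : rint f -> rint (fun x => `|f x|).
Proof. exact: integrable_norm. Qed.

Lemma rint_measurable f : rint f -> measurable_fun D f.
Proof. by move=> /measurable_int/measurable_EFinP. Qed.

Lemma rint_mul_bounded f g K : measurable_fun D g -> (forall x, D x -> `|g x| <= K) ->
  rint f -> rint (fun x => f x * g x).
Proof.
move=> mg gK hf; apply: (@rint_le _ (fun x => K * `|f x|)).
- by apply: measurable_funM => //; exact: rint_measurable.
- by move=> x Dx; rewrite normrM mulrC ler_wpM2r// gK.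
- exact/rintZ/rint_normr.
Qed.

Lemma RintegralZ c f : rint f -> \int[mu]_(x in D) (c * f x) = c * \int[mu]_(x in D) f x.
Proof. by move=> hf; rewrite RintegralZl. Qed.

Lemma RintegralDr f g : rint f -> rint g ->
  \int[mu]_(x in D) (f x + g x) = \int[mu]_(x in D) f x + \int[mu]_(x in D) g x.
Proof. by move=> hf hg; rewrite RintegralD. Qed.

Lemma RintegralBr f g : rint f -> rint g ->
  \int[mu]_(x in D) (f x - g x) = \int[mu]_(x in D) f x - \int[mu]_(x in D) g x.
Proof. by move=> hf hg; rewrite RintegralB. Qed.

Lemma Rintegral_sum n (f : 'I_n -> R -> R) : (forall i, rint (f i)) ->
  \int[mu]_(x in D) (\sum_(i < n) f i x) = \sum_(i < n) \int[mu]_(x in D) f i x.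
Proof.
elim: n f => [|n IH] f hf.
  by under eq_fun do rewrite big_ord0; rewrite big_ord0 /Rintegral integral0.
under eq_fun do rewrite big_ord_recr/=.
by rewrite RintegralDr//; [rewrite big_ord_recr/= IH|exact: rint_sum].
Qed.

(** Expand the nonnegative integral of [(a - h^-1 * sum c_i e_i) ^+ 2], where [h] is the common
    squared norm of the orthogonal family. *)
Lemma bessel (e : nat -> R -> R) (h : R) (a : R -> R) n : 0 < h ->
  (forall i, measurable_fun D (e i)) -> (forall i x, D x -> `|e i x| <= 1) ->
  rint (fun=> 1) ->
  (forall i j, \int[mu]_(x in D) (e i x * e j x) = if i == j then h else 0) ->
  rint a -> rint (fun x => a x ^+ 2) ->
  \sum_(i < n) (\int[mu]_(x in D) (a x * e i x)) ^+ 2 <=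
    h * \int[mu]_(x in D) (a x ^+ 2).
Proof.
move=> h0 me e1 i1 orth ia ia2.
have iae i : rint (fun x => a x * e i x) by exact: rint_mul_bounded (me i) (e1 i) ia.
have ie i : rint (e i).
  apply: rint_le (me i) (e1 i) i1.
have iee i j : rint (fun x => e i x * e j x) by exact: rint_mul_bounded (me j) (e1 j) (ie i).
pose c i := \int[mu]_(x in D) (a x * e i x); set T := \sum_(i < n) _.
set A := \int[mu]_(x in D) (a x ^+ 2).
pose E x := \sum_(i < n) c i * e i x.
have iaE : rint (fun x => \sum_(i < n) c i * (a x * e i x)).
  by apply: rint_sum => i; exact: rintZ.
have iEE : rint (fun x => \sum_(i < n) \sum_(j < n) c i * (c j * (e i x * e j x))).
  by apply: rint_sum => i; apply: rint_sum => j; do 2 apply: rintZ.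
have aE : \int[mu]_(x in D) (\sum_(i < n) c i * (a x * e i x)) = T.
  rewrite Rintegral_sum => [|i]; last exact: rintZ.
  by apply: eq_bigr => i _; rewrite RintegralZ// -expr2.
have EE : \int[mu]_(x in D) (\sum_(i < n) \sum_(j < n) c i * (c j * (e i x * e j x))) = h * T.
  rewrite Rintegral_sum => [|i]; last by apply: rint_sum => j; do 2 apply: rintZ.
  rewrite /T mulr_sumr; apply: eq_bigr => i _.
  rewrite Rintegral_sum => [|j]; last by do 2 apply: rintZ.
  rewrite (bigD1 i)//= !RintegralZ//; last exact: rintZ.
  rewrite orth eqxx big1 ?addr0 => [|j ji]; first by rewrite -/(c i); ring.
  rewrite !RintegralZ//; last exact: rintZ.
  by rewrite orth ifF ?mulr0//; apply/negbTE; rewrite eq_sym.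
have : 0 <= \int[mu]_(x in D) (a x - h^-1 * E x) ^+ 2.
  by apply: Rintegral_ge0 => x _; exact: sqr_ge0.
have -> : (fun x => (a x - h^-1 * E x) ^+ 2) = (fun x => a x ^+ 2 +
    (- (2 * h^-1) * (\sum_(i < n) c i * (a x * e i x)) +
     h^-1 ^+ 2 * (\sum_(i < n) \sum_(j < n) c i * (c j * (e i x * e j x))))).
  apply/funext => x.
  have -> : \sum_(i < n) c i * (a x * e i x) = a x * E x.
    by rewrite /E mulr_sumr; apply: eq_bigr => i _; rewrite mulrCA.
  have -> : \sum_(i < n) \sum_(j < n) c i * (c j * (e i x * e j x)) = E x * E x.
    rewrite /E mulr_suml; apply: eq_bigr => i _; rewrite mulr_sumr.
    by apply: eq_bigr => j _; ring.
  by ring.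
rewrite RintegralDr//; last by apply: rintD; exact: rintZ.
rewrite RintegralDr//; [|exact: rintZ|exact: rintZ].
rewrite !RintegralZ// aE EE -/A.
have -> : A + (- (2 * h^-1) * T + h^-1 ^+ 2 * (h * T)) = h^-1 * (h * A - T).
  by field; rewrite gt_eqF.
by rewrite pmulr_rge0 ?invr_gt0// subr_ge0.
Qed.

End RealIntegrable.

(** * Orthogonality of cosines and sines on a symmetric interval *)

Section TrigOrthogonality.
Context {R : realType} (tau : R) (tau0 : 0 < tau).
Notation mu := (@lebesgue_measure R).
Let D : set (measurableTypeR R) := `[- tau, tau]%classic.

Lemma sin_natpi n : sin (n%:R * pi) = 0 :> R.
Proof.
elim: n => [|n IH]; first by rewrite mul0r sin0.
by rewrite -natr1 mulrDl mul1r sinDpi IH oppr0.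
Qed.

Lemma continuous_cosl k : continuous (fun w : R => cos (k * w)).
Proof.
move=> w; apply: (@continuous_comp _ _ _ (fun w : R => k * w) cos).
  by apply: ctsZ => ?; exact: cvg_id.
exact: continuous_cos.
Qed.

Lemma continuous_sinl k : continuous (fun w : R => sin (k * w)).
Proof.
move=> w; apply: (@continuous_comp _ _ _ (fun w : R => k * w) sin).
  by apply: ctsZ => ?; exact: cvg_id.
exact: continuous_sin.
Qed.

Lemma ig_cos_period k : k != 0 -> sin (k * tau) = 0 ->
  ig (fun w : R => cos (k * w)) (- tau) tau = 0.
Proof.
move=> k0 sk; have H := derZ k^-1 (@der_affine R sin cos 0 k (fun x => is_derive_sin x)).
have /(ig_der _ _ (continuous_cosl (k := k))) -> :
    der (fun w => k^-1 * sin (0 + k * w)) (fun w : R => cos (k * w)).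
  by apply: der_eq H _ => x; rewrite add0r mulKf.
by rewrite !add0r mulrN sinN sk; ring.
Qed.

(** Starting at 1 leaves out the constant mode, whose squared norm is [2 * tau] where all the others
    have [tau]. *)
Definition freq n : R := n.+1%:R * pi / tau.

Let freq_gt0 n : 0 < freq n.
Proof. by rewrite divr_gt0// mulr_gt0// pi_gt0. Qed.

Let freq_tau n : freq n * tau = n.+1%:R * pi.
Proof. by rewrite divfK// gt_eqF. Qed.

Let ig_cosD i j : ig (fun w => cos ((freq i + freq j) * w)) (- tau) tau = 0.
Proof.
apply: ig_cos_period; first by rewrite gt_eqF// addr_gt0.
by rewrite mulrDl !freq_tau sinD !sin_natpi mul0r mulr0 addr0.
Qed.

Let ig_cosB i j : ig (fun w => cos ((freq i - freq j) * w)) (- tau) tau =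
  if i == j then 2 * tau else 0.
Proof.
have [->|ij] := eqVneq i j.
  under eq_fun do rewrite subrr mul0r cos0.
  by rewrite ig_cst; ring.
apply: ig_cos_period.
  apply: contra ij; rewrite subr_eq0 /freq => /eqP /(congr1 ( *%R^~ tau)).
  rewrite !divfK ?(gt_eqF tau0)// => /(mulIf (lt0r_neq0 (pi_gt0 R)))/eqP.
  by rewrite eqr_nat eqSS.
by rewrite mulrBl !freq_tau sinB !sin_natpi mul0r mulr0 subrr.
Qed.

Let ntt : - tau <= tau.
Proof. by rewrite (@le_trans _ _ 0)// ?oppr_le0 ltW. Qed.

Lemma cos_orth i j : \int[mu]_(w in D) (cos (freq i * w) * cos (freq j * w)) =
  if i == j then tau else 0.
Proof.
rewrite Rintegral_ig//; last by apply: ctsM; exact: continuous_cosl.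
have -> : (fun w : R => cos (freq i * w) * cos (freq j * w)) =
  (fun w => 2^-1 * (cos ((freq i - freq j) * w) + cos ((freq i + freq j) * w))).
  by apply/funext => w; rewrite mulrBl mulrDl cosB cosD; field.
rewrite igZ ?igD ?ig_cosD ?ig_cosB//; [|exact: continuous_cosl|exact: continuous_cosl|].
  by case: ifP => _; field.
by apply: ctsD; exact: continuous_cosl.
Qed.

Lemma sin_orth i j : \int[mu]_(w in D) (sin (freq i * w) * sin (freq j * w)) =
  if i == j then tau else 0.
Proof.
rewrite Rintegral_ig//; last by apply: ctsM; exact: continuous_sinl.
have -> : (fun w : R => sin (freq i * w) * sin (freq j * w)) =
  (fun w => 2^-1 * (cos ((freq i - freq j) * w) - cos ((freq i + freq j) * w))).
  by apply/funext => w; rewrite mulrBl mulrDl cosB cosD; field.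
rewrite igZ ?igB ?ig_cosD ?ig_cosB//; [|exact: continuous_cosl|exact: continuous_cosl|].
  by case: ifP => _; field.
by apply: ctsB; exact: continuous_cosl.
Qed.

End TrigOrthogonality.

(** * The energy bound for trigonometric integrals *)

Section TrigTransform.
Context {R : realType} (tau : R) (tau0 : 0 < tau).
Notation mu := (@lebesgue_measure R).
Let D : set (measurableTypeR R) := `[- tau, tau]%classic.
Implicit Types (A B : R -> R) (x s w c d : R).

Let mD : measurable D. Proof. exact: measurable_itv. Qed.

Definition sqint A := measurable_fun D A /\ rint D (fun w => A w ^+ 2).

(** The real part of the inverse Fourier integral of [A - i B] over the band. *)
Definition ttrans A B x :=
  \int[mu]_(w in D) (A w * cos (2 * pi * x * w) + B w * sin (2 * pi * x * w)).

Lemma rint_continuous (f : R -> R) : continuous f -> rint D f.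
Proof. exact: continuous_integrable. Qed.

Lemma mfun_continuous (f : R -> R) : continuous f -> measurable_fun D f.
Proof. by move=> /rint_continuous/rint_measurable. Qed.

Lemma sqint_rint A : sqint A -> rint D A.
Proof.
move=> [mA iA]; apply: (rint_le mD mA (g := fun w => 2^-1 * (1 + A w ^+ 2))).
  move=> w _; have := sqr_ge0 (`|A w| - 1).
  rewrite -[A w ^+ 2]real_normK ?num_real//; lra.
by apply: rintZ => //; apply: rintD => //; apply: rint_continuous; exact: cst_cts.
Qed.

Lemma sqint_comb A B (f g : R -> R) K : sqint A -> sqint B -> continuous f -> continuous g ->
  (forall w, D w -> `|f w| <= K /\ `|g w| <= K) ->
  sqint (fun w => A w * f w + B w * g w).
Proof.
move=> [mA iA] [mB iB] cf cg fg; have mf := mfun_continuous cf; have mg := mfun_continuous cg.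
have mAB : measurable_fun D (fun w => A w * f w + B w * g w).
  by apply: measurable_funD; apply: measurable_funM.
split => //; apply: (rint_le mD (g := fun w => 2 * K ^+ 2 * (A w ^+ 2 + B w ^+ 2))).
- exact: measurable_funX.
- move=> w /fg[fK gK]; rewrite ger0_norm ?sqr_ge0//.
  have f2 : f w ^+ 2 <= K ^+ 2.
    by rewrite -[f w ^+ 2]real_normK ?num_real// lerXn2r// nnegrE (le_trans _ fK).
  have g2 : g w ^+ 2 <= K ^+ 2.
    by rewrite -[g w ^+ 2]real_normK ?num_real// lerXn2r// nnegrE (le_trans _ gK).
  have := sqr_ge0 (A w * f w - B w * g w).
  have := ler_wpM2l (sqr_ge0 (A w)) f2; have := ler_wpM2l (sqr_ge0 (B w)) g2.
  rewrite -!exprMn; set p := A w * f w; set q := B w * g w.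
  nra.
- by apply: rintZ => //; exact: rintD.
Qed.

Lemma cos_sin_le1 (t : R) : `|cos t| <= 1 /\ `|sin t| <= 1.
Proof. by rewrite !ler_norml sin_le1 sin_geN1 cos_le1 cos_geN1. Qed.

Lemma sqint_cossin A B k : sqint A -> sqint B ->
  sqint (fun w => A w * cos (k * w) + B w * sin (k * w)).
Proof.
move=> sA sB; apply: (@sqint_comb A B (fun w => cos (k * w)) (fun w => sin (k * w)) 1) => //.
- exact: continuous_cosl.
- exact: continuous_sinl.
- by move=> w _; exact: cos_sin_le1.
Qed.

Lemma sqintN A : sqint A -> sqint (fun w => - A w).
Proof.
move=> [mA iA]; split; first exact: measurable_funN.
by apply: eq_integrable iA => // w _; rewrite /= sqrrN.
Qed.

(* The samples are Fourier coefficients on [-tau, tau] for the orthogonal families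
   [cos (pi (i+1) w / tau)] and [sin (pi (i+1) w / tau)]. *)
Lemma bessel_ttrans A B s n : sqint A -> sqint B ->
  \sum_(i < n) ttrans A B (s + i.+1%:R / (2 * tau)) ^+ 2 <=
  2 * tau * \int[mu]_(w in D) (A w ^+ 2 + B w ^+ 2).
Proof.
move=> sA sB; pose k := 2 * pi * s.
(* Rotating [(A, B)] by the angle [k w] absorbs the shift [s] and preserves [A ^+ 2 + B ^+ 2]
   pointwise. *)
pose A' w := A w * cos (k * w) + B w * sin (k * w).
pose B' w := B w * cos (k * w) + (- A w) * sin (k * w).
have sA' : sqint A' by exact: sqint_cossin.
have sB' : sqint B' by apply: sqint_cossin => //; exact: sqintN.
have i1 : rint D (fun=> 1) by apply: rint_continuous; exact: cst_cts.
have bA := @bessel R D mD (fun i w => cos (freq tau i * w)) tau A' n tau0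
  (fun i => mfun_continuous (continuous_cosl (k := _))) (fun i w _ => (cos_sin_le1 _).1) i1
  (cos_orth tau0) (sqint_rint sA') sA'.2.
have bB := @bessel R D mD (fun i w => sin (freq tau i * w)) tau B' n tau0
  (fun i => mfun_continuous (continuous_sinl (k := _))) (fun i w _ => (cos_sin_le1 _).2) i1
  (sin_orth tau0) (sqint_rint sB') sB'.2.
have E i : ttrans A B (s + i.+1%:R / (2 * tau)) =
    \int[mu]_(x in D) (A' x * cos (freq tau i * x)) +
    \int[mu]_(x in D) (B' x * sin (freq tau i * x)).
  rewrite -RintegralDr//; last 2 first.
  - apply: (rint_mul_bounded mD (K := 1) (mfun_continuous (continuous_cosl (k := _)))).
      by move=> w _; apply cos_sin_le1.
    exact: sqint_rint.
  - apply: (rint_mul_bounded mD (K := 1) (mfun_continuous (continuous_sinl (k := _)))).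
      by move=> w _; apply cos_sin_le1.
    exact: sqint_rint.
  apply: eq_Rintegral => w _; rewrite /A' /B'.
  have -> : 2 * pi * (s + i.+1%:R / (2 * tau)) * w = k * w + freq tau i * w.
    by rewrite /k /freq; field; rewrite gt_eqF.
  by rewrite cosD sinD; ring.
have -> : \int[mu]_(w in D) (A w ^+ 2 + B w ^+ 2) =
    \int[mu]_(w in D) (A' w ^+ 2) + \int[mu]_(w in D) (B' w ^+ 2).
  rewrite -RintegralDr//; [|exact: sA'.2|exact: sB'.2].
  apply: eq_Rintegral => w _; rewrite /A' /B'.
  transitivity ((A w ^+ 2 + B w ^+ 2) * (cos (k * w) ^+ 2 + sin (k * w) ^+ 2)).
    by rewrite cos2Dsin2 mulr1.
  by ring.
(* A sample is a sum [p + q] of a cosine and a sine coefficient, and [(p + q)^2 <= 2 (p^2 + q^2)].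
   The resulting factor [2 * tau] is the inverse of the spacing, so averaging over [s] leaves the
   constant 1. *)
apply: (@le_trans _ _ (2 * (\sum_(i < n) (\int[mu]_(x in D) (A' x * cos (freq tau i * x))) ^+ 2 +
  \sum_(i < n) (\int[mu]_(x in D) (B' x * sin (freq tau i * x))) ^+ 2))).
  rewrite -big_split/= mulr_sumr; apply: ler_sum => i _; rewrite E.
  set p := Rintegral _ _ _; set q := Rintegral _ _ _.
  have := sqr_ge0 (p - q); nra.
rewrite -mulrA ler_pM2l// mulrDr; exact: lerD.
Qed.

(* Average of [bessel_ttrans] over [s] in an interval of length [1 / (2 tau)]. *)
Lemma ttrans_energy A B c d : sqint A -> sqint B -> continuous (ttrans A B) -> c <= d ->
  ig (fun x => ttrans A B x ^+ 2) c d <= \int[mu]_(w in D) (A w ^+ 2 + B w ^+ 2).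
Proof.
move=> sA sB cT cd; pose q := (2 * tau)^-1; have q0 : 0 < q by rewrite invr_gt0 mulr_gt0.
set N2 := \int[mu]_(w in D) _; pose f x := ttrans A B x ^+ 2.
have cf : continuous f by exact: ctsX.
have trans i a b : ig (fun s => f (i.+1%:R * q + 1 * s)) a b = ig f (a + i.+1%:R * q) (b + i.+1%:R * q).
  by rewrite -[LHS]mul1r ig_affine// !mul1r [a + _]addrC [b + _]addrC.
have sumE n a : ig f (a + q) (a + n.+1%:R * q) = \sum_(i < n) ig (fun s => f (i.+1%:R * q + 1 * s)) a (a + q).
  elim: n => [|n IH]; first by rewrite big_ord0 mul1r igxx.
  rewrite big_ord_recr/= -IH trans (_ : a + q + _ = a + n.+2%:R * q) ?ig_cat//.
  by rewrite -(natr1 n.+1); ring.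
have cfi i : continuous (fun s => f (i.+1%:R * q + 1 * s)) by exact: ctsA.
have window n a : ig f (a + q) (a + n.+1%:R * q) <= N2.
  rewrite sumE -ig_sum//.
  apply: (@le_trans _ _ (ig (fun=> 2 * tau * N2) a (a + q))).
    apply: le_ig => [||| s _]; [exact: sum_continuous|exact: cst_cts|by rewrite lerDl ltW|].
    apply: le_trans (bessel_ttrans s n sA sB); apply: ler_sum => i _.
    by rewrite /f mul1r addrC.
  rewrite ig_cst (addrC a) addrK /q.
  by rewrite mulrAC mulfV ?mul1r// gt_eqF// mulr_gt0.
have xn := archi_boundP (divr_ge0 (_ : 0 <= d - c) (ltW q0)).
set n := Num.bound _ in xn.
have {}xn : d - c <= n%:R * q by rewrite -ler_pdivrMr// ltW// xn// subr_ge0.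
(* The samples begin at index 1, so the window starting at [c] is the one based at [c - q]. *)
apply: le_trans (window n (c - q)); rewrite subrK.
have dn : d <= c - q + n.+1%:R * q by rewrite -natr1 mulrDl; lra.
rewrite -(ig_cat _ c d (c - q + _)) lerDl; apply: ig_ge0 => // *; exact: sqr_ge0.
Qed.

End TrigTransform.

(** * Derivatives of trigonometric integrals *)

Section TrigJets.
Context {R : realType} (tau : R) (tau0 : 0 < tau).
Notation mu := (@lebesgue_measure R).
Let D : set (measurableTypeR R) := `[- tau, tau]%classic.
Implicit Types (A B : R -> R) (x w : R).
Let mD : measurable D. Proof. exact: measurable_itv. Qed.

Let D_le w : D w -> `|w| <= tau.
Proof. by rewrite /D /= in_itv/= ler_norml. Qed.

Let pi2 : 0 < 2 * pi :> R. Proof. by rewrite mulr_gt0// pi_gt0. Qed.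

Lemma sqint_mulid A k : sqint tau A -> sqint tau (fun w => k * w * A w).
Proof.
move=> sA.
have := @sqint_comb R tau A A (fun w => k * w) (fun=> 0) (`|k| * tau) sA sA.
have -> : (fun w => A w * (k * w) + A w * 0) = (fun w => k * w * A w).
  by apply/funext => w; rewrite mulr0 addr0 mulrC.
apply.
- by apply: ctsZ => ?; exact: cvg_id.
- exact: cst_cts.
- by move=> w /D_le wt; rewrite normr0 normrM ler_wpM2l// mulr_ge0// ltW.
Qed.

Lemma der_ttrans A B : sqint tau A -> sqint tau B ->
  der (ttrans tau A B)
      (ttrans tau (fun w => 2 * pi * w * B w) (fun w => - (2 * pi * w * A w))).
Proof.
move=> sA sB a.
pose f x w := A w * cos (2 * pi * x * w) + B w * sin (2 * pi * x * w).
have df w : der (f ^~ w) (fun x => 2 * pi * w * B w * cos (2 * pi * x * w) +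
    - (2 * pi * w * A w) * sin (2 * pi * x * w)).
  have dc := derZ (A w) (@der_affine R cos _ 0 (2 * pi * w) (fun x => is_derive_cos x)).
  have ds := derZ (B w) (@der_affine R sin _ 0 (2 * pi * w) (fun x => is_derive_sin x)).
  have -> : f ^~ w = (fun x => A w * cos (0 + 2 * pi * w * x) + B w * sin (0 + 2 * pi * w * x)).
    by apply/funext => x; rewrite /f add0r mulrAC.
  by apply: der_eq (derD dc ds) _ => x; rewrite add0r (mulrAC (2 * pi) x w); ring.
have d1 x w : partial1of2 f x w = 2 * pi * w * B w * cos (2 * pi * x * w) +
    - (2 * pi * w * A w) * sin (2 * pi * x * w).
  by rewrite partial1of2E; have [] := df w x.
have intf x : rint D (f x).
  exact/sqint_rint/sqint_cossin.
pose G w := 2 * pi * tau * (`|A w| + `|B w|).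
have G0 w : 0 <= G w by rewrite mulr_ge0 ?addr_ge0// mulr_ge0 ?ltW.
have intG : rint D G.
  by apply: rintZ => //; apply: rintD => //; apply: rint_normr => //; exact: sqint_rint.
have aI : `]a - 1, a + 1[%classic a by rewrite /= in_itv/=; apply/andP; lra.
have dff x w : `]a - 1, a + 1[%classic x -> D w -> derivable (f ^~ w) x 1.
  by move=> _ _; have [] := df w x.
have Gub x w : `]a - 1, a + 1[%classic x -> D w -> `|partial1of2 f x w| <= G w.
  move=> _ /D_le wt; rewrite d1 (le_trans (ler_normD _ _))// addrC /G (mulrDr (2 * pi * tau)).
  have [c1 s1] := cos_sin_le1 (2 * pi * x * w).
  have wpi : `|2 * pi * w| <= 2 * pi * tau by rewrite normrM (gtr0_norm pi2) ler_pM2l.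
  by apply: lerD; rewrite normrM -[leRHS]mulr1 ler_pM// ?normrN normrM ler_wpM2r.
have dT := @derivable_under_integral R _ _ mu f D mD a (a - 1) (a + 1) aI
  (fun x _ => intf x) dff G G0 intG Gub.
have DT := @differentiation_under_integral R _ _ mu f D mD a (a - 1) (a + 1) aI
  (fun x _ => intf x) dff G G0 intG Gub.
apply: DeriveDef => //.
by rewrite -derive1E [LHS]DT; apply: eq_Rintegral => w _; rewrite d1.
Qed.

Variables (a b : R -> R) (sa : sqint tau a) (sb : sqint tau b).

(** With [(A, B)] read as [A - i B], one differentiation is multiplication by [2 pi i w]. *)
Fixpoint tcoef l : (R -> R) * (R -> R) :=
  match l with
  | 0 => (a, b)
  | l'.+1 => (fun w => 2 * pi * w * (tcoef l').2 w, fun w => - (2 * pi * w * (tcoef l').1 w))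
  end.

Definition tjet l := ttrans tau (tcoef l).1 (tcoef l).2.

Lemma sqint_tcoef l : sqint tau (tcoef l).1 /\ sqint tau (tcoef l).2.
Proof.
elim: l => [//|l [IH1 IH2]]; split; first exact: sqint_mulid.
exact/sqintN/sqint_mulid.
Qed.

Lemma der_tjet l : der (tjet l) (tjet l.+1).
Proof. by have [? ?] := sqint_tcoef l; exact: der_ttrans. Qed.

Lemma derive1n_tjet l : derive1n l (tjet 0) = tjet l.
Proof.
elim: l => [//|l IH]; rewrite derive1nS IH.
by apply/funext => x; rewrite derive1E; have [] := der_tjet l x.
Qed.

Let sigma := 2 * pi * tau.

Lemma tjet_bound : exists C, forall l x, `|tjet l x| <= C * sigma ^+ l.
Proof.
have ia := sqint_rint sa; have ib := sqint_rint sb.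
have iab : rint D (fun w => `|a w| + `|b w|).
  by apply: rintD => //; exact: rint_normr.
exists (\int[mu]_(w in D) (`|a w| + `|b w|)) => l x.
have tc w : D w -> `|(tcoef l).1 w| + `|(tcoef l).2 w| <= sigma ^+ l * (`|a w| + `|b w|).
  move=> Dw; elim: l => [|l IH]; first by rewrite expr0 mul1r.
  have wpi : `|2 * pi * w| <= sigma by rewrite normrM (gtr0_norm pi2) ler_pM2l// D_le.
  rewrite /= normrN !(normrM (2 * pi * w)) -(mulrDr `|2 * pi * w|) addrC.
  by rewrite exprS -[leRHS]mulrA ler_pM.
have [s1 s2] := sqint_tcoef l.
have := sqint_cossin (2 * pi * x) s1 s2 => /sqint_rint it.
apply: le_trans (le_normr_Rintegral mD it) _.
rewrite [leRHS]mulrC -(RintegralZ mD _ iab); apply: le_Rintegral => //.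
- exact: rint_normr.
- exact: rintZ.
- move=> w Dw; apply: le_trans (tc w Dw); apply: le_trans (ler_normD _ _) _.
  have [c1 s1'] := cos_sin_le1 (2 * pi * x * w).
  by apply: lerD; rewrite normrM ler_piMr.
Qed.

(** The energy of order [l] on the Fourier side, divided by [sigma ^+ (2 * l)]: since
    [sigma = 2 * pi * tau], the multiplier [2 * pi * w] becomes [w / tau]. *)
Let beta l := \int[mu]_(w in D) ((w / tau) ^+ (2 * l) * (a w ^+ 2 + b w ^+ 2)).

Let iab2 : rint D (fun w => a w ^+ 2 + b w ^+ 2).
Proof. by apply: rintD => //; [exact: sa.2|exact: sb.2]. Qed.

Let ratio_le1 w : D w -> `|w / tau| <= 1.
Proof.
by move=> /D_le wt; rewrite normrM normfV (gtr0_norm tau0) ler_pdivrMr// mul1r.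
Qed.

Let ib l : rint D (fun w => (w / tau) ^+ (2 * l) * (a w ^+ 2 + b w ^+ 2)).
Proof.
under eq_fun do rewrite mulrC; apply: (rint_mul_bounded mD (K := 1)) iab2.
  apply: mfun_continuous; apply: ctsX; under eq_fun do rewrite mulrC.
  by apply: ctsZ => ?; exact: cvg_id.
by move=> w Dw; rewrite normrX exprn_ile1// ratio_le1.
Qed.

Lemma tjet_energy l c d : c <= d ->
  ig (fun x => tjet l x ^+ 2) c d <= sigma ^+ (2 * l) * beta l.
Proof.
move=> cd; have [s1 s2] := sqint_tcoef l.
apply: le_trans (ttrans_energy tau0 s1 s2 (der_continuous (der_tjet l)) cd) _.
rewrite -(RintegralZ mD _ (ib l)) le_eqVlt; apply/orP; left; apply/eqP; apply: eq_Rintegral => w _.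
elim: l {s1 s2} => [|l IH]; first by rewrite muln0 !expr0 !mul1r.
have E2 (z : R) : z ^+ (2 * l.+1) = z ^+ 2 * z ^+ (2 * l) by rewrite mulnS exprD.
rewrite !E2 /=.
transitivity ((2 * pi * w) ^+ 2 * ((tcoef l).1 w ^+ 2 + (tcoef l).2 w ^+ 2)); first by ring.
have -> : (2 * pi * w) ^+ 2 = sigma ^+ 2 * (w / tau) ^+ 2.
  by rewrite /sigma; field; rewrite gt_eqF.
rewrite IH; move: (sigma ^+ _) (sigma ^+ _) ((w / tau) ^+ _) ((w / tau) ^+ _) (_ + _).
by move=> p q r s t; ring.
Qed.

Lemma beta_cvg0 : beta @ \oo --> 0.
Proof.
have H := @dominated_convergence _ _ R mu D mD
  (fun l w => ((w / tau) ^+ (2 * l) * (a w ^+ 2 + b w ^+ 2))%:E) (fun=> 0%E)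
  (fun w => (a w ^+ 2 + b w ^+ 2)%:E).
have [|||||] := H.
- by move=> l; exact: measurable_int (ib l).
- exact: measurable_cst.
(* At the ends of the band the ratio [w / tau] has modulus 1 and its powers do not decay; these two
   points form a null set. *)
- exists [set tau; - tau]; split.
  + by apply: measurableU; exact: measurable_set1.
  + exact/countable_lebesgue_measure0/finite_set_countable/finite_set2.
  + move=> w /= nw; apply: contrapT => wt; apply: nw => Dw.
    have wt1 : `|w / tau| < 1.
      rewrite normrM normfV (gtr0_norm tau0) ltr_pdivrMr// mul1r lt_neqAle D_le// andbT.
      by apply/eqP => wE; apply: wt; move: wE; case: (ger0P w) => _ wE; [left|right; rewrite -wE opprK].
    have cv : (w / tau) ^+ (2 * l) @[l --> \oo] --> (0 : R).
      under eq_cvg do rewrite exprM.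
      apply: cvg_expr; rewrite normrX expr_lt1//.
    apply/fine_cvgP; split; first exact: nearW.
    rewrite -[X in _ --> X](mul0r (a w ^+ 2 + b w ^+ 2)).
    by apply: cvgM => //; exact: cvg_cst.
- exact: iab2.
- apply/aeW => w l Dw /=; rewrite lee_fin normrM (ger0_norm (addr_ge0 (sqr_ge0 _) (sqr_ge0 _))).
  by rewrite ler_piMl ?addr_ge0 ?sqr_ge0// normrX exprn_ile1// ratio_le1.
- move=> _ _; rewrite integral0 => /fine_cvgP[_].
  exact.
Qed.

Lemma ttrans_uniqueness m nu (x : int -> R) :
  is_wirtinger_cimmino m.+1 nu -> (forall i : int, x i < x (i + 1)) ->
  (forall i : int, x (i + 1) - x i <= nu / sigma) ->
  (forall i l, (l <= m)%N -> derive1n l (ttrans tau a b) (x i) = 0) ->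
  forall y, ttrans tau a b y = 0.
Proof.
move=> nuP xlt xgap xz; have [C bC] := tjet_bound.
have s0 : 0 < sigma by rewrite mulr_gt0.
apply: (uniqueness_jet s0 der_tjet bC nuP xlt xgap _ tjet_energy beta_cvg0).
by move=> i l lm; rewrite -derive1n_tjet xz.
Qed.

End TrigJets.

(** * Fourier inversion with the Poisson kernel *)

Section Improper.
Context {R : realType}.
Notation mu := (@lebesgue_measure R).
Let T0 : set (measurableTypeR R) := setT.
Let mT0 : measurable T0. Proof. exact: measurableT. Qed.
Let I n : set (measurableTypeR R) := `[- n%:R, n%:R]%classic.
Implicit Types (u : R -> R).

Let I_cover x : exists N, forall n, (N <= n)%N -> I n x.
Proof.
exists (Num.bound `|x|) => n Nn; rewrite /I /= in_itv/= -ler_norml.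
by rewrite (le_trans (ltW (archi_boundP _)))// ler_nat.
Qed.

Let nnle n : - n%:R <= n%:R :> R.
Proof. by rewrite ge0_cp. Qed.

Lemma continuous_measurable_funR u : continuous u -> measurable_fun T0 u.
Proof. exact: continuous_measurable_fun. Qed.

Lemma rintT_ge0 u M : continuous u -> (forall x, 0 <= u x) ->
  (forall n, ig u (- n%:R) n%:R <= M) -> rint T0 u.
Proof.
move=> cu u0 uM; apply/integrableP; split.
  by apply/measurable_EFinP; exact: continuous_measurable_funR.
under eq_integral do rewrite /= ger0_norm//.
have Ic : \bigcup_n I n = T0.
  by apply/seteqP; split=> // x _; have [N HN] := I_cover x; exists N => //; exact: HN.
have := @ge0_nondecreasing_set_cvg_integral _ _ R I (EFin \o u) mu.
rewrite Ic => H.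
have cvgI : (\int[mu]_(x in I n) (u x)%:E)%E @[n --> \oo] --> (\int[mu]_(x in T0) (u x)%:E)%E.
  apply: H => //.
  - move=> m n mn; apply/subsetPset => x; rewrite /I /= !in_itv/= => /andP[mx xm].
    by rewrite (le_trans _ mx) ?lerN2 ?(le_trans xm) ?ler_nat.
  - by move=> n; exact: measurable_itv.
  - by move=> n; apply: measurable_funTS; apply/measurable_EFinP; exact: continuous_measurable_funR.
  - by move=> n x _; rewrite lee_fin.
apply: (@le_lt_trans _ _ M%:E); last exact: ltry.
rewrite -(cvg_lim _ cvgI)//; apply: lime_le; first exact: cvgP cvgI.
apply: nearW => n.
have := uM n; rewrite -Rintegral_ig// -lee_fin /Rintegral fineK//.
exact: integrable_fin_num (continuous_integrable _ _ cu).
Qed.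

Lemma RintegralT_lim u L : continuous u -> rint T0 u ->
  ig u (- n%:R) n%:R @[n --> \oo] --> L -> \int[mu]_(x in T0) u x = L.
Proof.
move=> cu iu uL.
have H := @dominated_convergence _ _ R mu T0 mT0
  (fun n => (EFin \o u) \_ (I n)) (EFin \o u) (fun x => `|u x|%:E).
have [|||||_ _] := H.
- move=> n; apply/(measurable_restrictT _ _).1; first exact: measurable_itv.
  by apply: measurable_funTS; apply/measurable_EFinP; exact: continuous_measurable_funR.
- by apply/measurable_EFinP; exact: continuous_measurable_funR.
- apply/aeW => x _; have [N HN] := I_cover x; apply: cvg_near_cst.
  by exists N => // n /= Nn; rewrite patchE mem_set//; exact: HN.
- exact: integrable_norm.
- by apply/aeW => x n _; rewrite patchE; case: ifP => _ /=; rewrite ?normr0 lee_fin.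
have -> : (\int[mu]_(x in T0) (EFin \o u) x)%E = (\int[mu]_(x in T0) u x)%:E.
  by rewrite fineK//; exact: integrable_fin_num.
move=> /fine_cvgP[_] cv.
have E : (fine \o [sequence (\int[mu]_(x in T0) ((EFin \o u) \_ (I n)) x)%E]_n) =
   (fun n => ig u (- n%:R) n%:R).
  apply/funext => n /=; rewrite -(Rintegral_ig cu (nnle n)) /Rintegral.
  by rewrite -integral_mkcond.
rewrite E in cv.
by apply: (cvg_unique _ cv uL).
Qed.

End Improper.

(** * The Poisson kernel as a Fourier transform *)

Section Poisson.
Context {R : realType}.
Notation mu := (@lebesgue_measure R).
Let T0 : set (measurableTypeR R) := setT.
Implicit Types (u : R -> R) (b x y t w : R).

Lemma eq_ig u v c d : continuous u -> continuous v -> c <= d ->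
  (forall x, c <= x <= d -> u x = v x) -> ig u c d = ig v c d.
Proof.
by move=> cu cv cd uv; apply/eqP; rewrite eq_le !le_ig// => x /uv ->.
Qed.

Lemma ig_sym u A : continuous u ->
  ig u (- A) A = ig (fun x => u x + u (0 + (-1) * x)) 0 A.
Proof.
move=> cu; have cuN : continuous (fun x => u (0 + (-1) * x)) by exact: ctsA.
rewrite igD// -(ig_cat u (- A) 0 A) addrC; congr (_ + _).
have := ig_affine 0 (-1) 0 A cu; rewrite mulr0 !add0r !mulN1r => /(congr1 -%R).
by rewrite opprK => ->; rewrite /ig opprB.
Qed.

Variables (c : R) (c0 : 0 < c).

Definition expo w : R := expR (- (c * `|w|)).

Lemma expo_gt0 w : 0 < expo w. Proof. exact: expR_gt0. Qed.

Lemma continuous_expo : continuous expo.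
Proof.
move=> w; apply: (@continuous_comp _ _ _ (fun w => - (c * `|w|)) expR).
  by apply: ctsN; apply: ctsZ; exact: norm_continuous.
exact: continuous_expR.
Qed.

(** The real part of [exp ((i b - c) w) / (i b - c)]; the summands [0 +] match the form of
    [der_affine]. *)
Let Phi b w := expR (0 + (- c) * w) * (b * sin (0 + b * w) - c * cos (0 + b * w)) / (c ^+ 2 + b ^+ 2).

Let den_gt0 b : 0 < c ^+ 2 + b ^+ 2.
Proof. by rewrite ltr_pwDl ?exprn_gt0// sqr_ge0. Qed.

Let der_Phi b : der (Phi b) (fun w => expR (0 + (- c) * w) * cos (0 + b * w)).
Proof.
have de := @der_affine R expR expR 0 (- c) (fun x => is_derive_expR x).
have ds := derZ b (@der_affine R sin cos 0 b (fun x => is_derive_sin x)).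
have dc := derZ c (@der_affine R cos _ 0 b (fun x => is_derive_cos x)).
have := derZ (c ^+ 2 + b ^+ 2)^-1 (derM de (derB ds dc)).
have -> : (fun x => (c ^+ 2 + b ^+ 2)^-1 * (expR (0 + (- c) * x) * (b * sin (0 + b * x) - c * cos (0 + b * x)))) = Phi b.
  by apply/funext => w; rewrite mulrC.
by move=> /der_eq; apply => w; field; rewrite gt_eqF.
Qed.

Let Phi0 b : Phi b 0 = - (c / (c ^+ 2 + b ^+ 2)).
Proof. by rewrite /Phi !mulr0 addr0 expR0 sin0 cos0; ring. Qed.

Let cexp : continuous (fun w => expR (0 + (- c) * w)).
Proof. exact: (der_continuous (@der_affine R expR expR 0 (- c) (fun x => is_derive_expR x))). Qed.

Let cec b : continuous (fun w => expo w * cos (b * w)).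
Proof. by apply: ctsM; [exact: continuous_expo|exact: continuous_cosl]. Qed.

Let ces b : continuous (fun w => expo w * sin (b * w)).
Proof. by apply: ctsM; [exact: continuous_expo|exact: continuous_sinl]. Qed.

Let ig_expo_cos b A : 0 <= A ->
  ig (fun w => expo w * cos (b * w)) (- A) A = 2 * (Phi b A - Phi b 0).
Proof.
move=> A0; rewrite ig_sym//.
have c1 : continuous (fun w => expR (0 + (- c) * w) * cos (0 + b * w)).
  by apply: ctsM => //; under eq_fun do rewrite add0r; exact: continuous_cosl.
rewrite -(ig_der _ _ c1 (der_Phi b)) -igZ//; apply: eq_ig => //.
- by apply: ctsD => //; exact: (@ctsA _ (fun w => expo w * cos (b * w))).
- exact: ctsZ.
- move=> x /andP[x0 _]; rewrite /expo !add0r mulN1r normrN ger0_norm// mulrN cosN mulNr.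
  by ring.
Qed.

Let Phi_cvg0 b : Phi b n%:R @[n --> \oo] --> (0 : R).
Proof.
pose K := (`|b| + c) / (c ^+ 2 + b ^+ 2).
have cv : K * expR (- c) ^+ n @[n --> \oo] --> (0 : R).
  rewrite -(mulr0 K); apply: cvgM; first exact: cvg_cst.
  apply: cvg_expr; rewrite ger0_norm ?expR_ge0// expR_lt1 oppr_lt0; exact: c0.
apply: norm_cvg0; apply: (@squeeze_cvgr _ _ _ _ (cst 0) _ _ _ _ _ cv) => //; last exact: cvg_cst.
apply: nearW => n; rewrite normr_ge0/= /Phi normrM normfV (gtr0_norm (den_gt0 b)).
rewrite normrM ger0_norm ?expR_ge0// add0r (mulrC (- c)) expRM_natl.
rewrite ler_pdivrMr// mulrAC /K divfK ?gt_eqF//.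
rewrite [leLHS]mulrC ler_pM2r ?exprn_gt0 ?expR_gt0// (le_trans (ler_normB _ _))//.
have [c1 s1] := cos_sin_le1 (0 + b * n%:R).
rewrite !normrM (gtr0_norm c0) lerD//; first by rewrite ler_piMr.
by rewrite ler_piMr// ltW.
Qed.

Lemma rint_expo : rint T0 expo.
Proof.
apply: (@rintT_ge0 _ _ (2 / c)); [exact: continuous_expo|by move=> w; exact/ltW/expo_gt0|].
move=> n; have := ig_expo_cos 0 (ler0n R n).
under eq_fun do rewrite mul0r cos0 mulr1.
move=> ->; rewrite Phi0 opprK /Phi mul0r sub0r !expr0n/= !addr0 mul0r addr0 cos0 mulr1.
rewrite ler_pM2l//.
have -> : c / c ^+ 2 = c^-1 by field; rewrite gt_eqF.
rewrite gerDr; apply: mulr_le0_ge0; last by rewrite invr_ge0 sqr_ge0.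
by rewrite mulrN oppr_le0 mulr_ge0 ?expR_ge0// ltW.
Qed.

Lemma rint_expo_bounded u : measurable_fun T0 u -> (forall w, `|u w| <= 1) ->
  rint T0 (fun w => expo w * u w).
Proof.
by move=> mu_ u1; apply: (rint_mul_bounded measurableT (K := 1)) => //; exact: rint_expo.
Qed.

Lemma Rintegral_expo_cos b :
  \int[mu]_(w in T0) (expo w * cos (b * w)) = 2 * c / (c ^+ 2 + b ^+ 2).
Proof.
apply: RintegralT_lim => //.
  apply: rint_expo_bounded; last by move=> w; apply cos_sin_le1.
  by apply: continuous_measurable_funR; exact: continuous_cosl.
under eq_cvg do rewrite ig_expo_cos// Phi0 opprK.
have -> : 2 * c / (c ^+ 2 + b ^+ 2) = 2 * (0 + c / (c ^+ 2 + b ^+ 2)) by ring.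
apply: cvgM; first exact: cvg_cst.
by apply: cvgD => //; exact: cvg_cst.
Qed.

Lemma Rintegral_expo_sin b : \int[mu]_(w in T0) (expo w * sin (b * w)) = 0.
Proof.
apply: RintegralT_lim => //.
  apply: rint_expo_bounded; last by move=> w; apply cos_sin_le1.
  by apply: continuous_measurable_funR; exact: continuous_sinl.
suff H n : ig (fun w => expo w * sin (b * w)) (- n%:R) n%:R = 0.
  by under eq_cvg do rewrite H; exact: cvg_cst.
rewrite ig_sym//.
have -> : (fun x : R => expo x * sin (b * x) + expo (0 + -1 * x) * sin (b * (0 + -1 * x))) = (fun=> 0).
  apply/funext => x; rewrite /expo add0r mulN1r normrN mulrN sinN; ring.
by rewrite ig_cst mul0r.
Qed.

(** The Fourier transform of [expo] at [x - y], which is the Poisson kernel of the half-plane at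
    height [c / (2 pi)]. *)
Definition poisson x y : R := 2 * c / (c ^+ 2 + (2 * pi * (x - y)) ^+ 2).

Lemma poisson_gt0 x y : 0 < poisson x y.
Proof. by rewrite divr_gt0// mulr_gt0. Qed.

Let P x y := pi^-1 * atan (- (2 * pi / c * x) + 2 * pi / c * y).

Let der_P x : der (P x) (poisson x).
Proof.
have := derZ pi^-1 (@der_affine R atan _ (- (2 * pi / c * x)) (2 * pi / c) (fun x => is_derive1_atan x)).
move=> /der_eq; apply => y; rewrite /poisson.
have -> : - (2 * pi / c * x) + 2 * pi / c * y = - (2 * pi * (x - y) / c) by ring.
set z := 2 * pi * (x - y).
have -> : 1 + (- (z / c)) ^+ 2 = (c ^+ 2 + z ^+ 2) / c ^+ 2.
  by field; rewrite gt_eqF.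
have pn0 : pi != 0 :> R by rewrite gt_eqF// pi_gt0.
have dn0 : c ^+ 2 + z ^+ 2 != 0 by rewrite gt_eqF.
have cn0 : c != 0 by rewrite gt_eqF.
by move: dn0 pn0; clearbody z; move: pi => p dn0 pn0; field; rewrite ?pn0 ?dn0 ?cn0.
Qed.

Lemma continuous_poisson x : continuous (poisson x).
Proof.
have -> : poisson x = (fun y => 2 * c * (c ^+ 2 + (2 * pi * (x - y)) ^+ 2)^-1) by [].
apply: ctsZ => y; apply: cvgV; first by rewrite gt_eqF.
have : continuous (fun y => c ^+ 2 + (2 * pi * (x - y)) ^+ 2).
  apply: ctsD; first exact: cst_cts.
  apply: ctsX; apply: ctsZ; apply: ctsB; first exact: cst_cts.
  by move=> ?; exact: cvg_id.
by apply.
Qed.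

Let ig_poisson x d e : ig (poisson x) d e = P x e - P x d.
Proof. by rewrite (ig_der _ _ (@continuous_poisson x) (der_P x)). Qed.

Lemma rint_poisson x : rint T0 (poisson x).
Proof.
apply: (@rintT_ge0 _ _ 1); [exact: continuous_poisson|by move=> y; exact/ltW/poisson_gt0|].
move=> n; rewrite ig_poisson /P -mulrBr mulrC ler_pdivrMr ?pi_gt0// mul1r.
set s := atan _; set t := atan _; have := atan_ltpi2 (- (2 * pi / c * x) + 2 * pi / c * n%:R).
have := atan_gtNpi2 (- (2 * pi / c * x) + 2 * pi / c * - n%:R); rewrite -/s -/t; lra.
Qed.

Let affine_cvgy (a k : R) : 0 < k -> a + k * n%:R @[n --> \oo] --> +oo.
Proof.
move=> k0; apply/cvgryPge => M; near=> n.
have : (M - a) / k <= n%:R by near: n; exact: nbhs_infty_ger.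
by rewrite ler_pdivrMr//; lra.
Unshelve. all: by end_near. Qed.

Lemma Rintegral_poisson x : \int[mu]_(y in T0) poisson x y = 1.
Proof.
apply: RintegralT_lim; [exact: continuous_poisson|exact: rint_poisson|].
have k0 : 0 < 2 * pi / c by rewrite divr_gt0// mulr_gt0// pi_gt0.
have E1 : pi^-1 * (pi / 2) - pi^-1 * (- (pi / 2)) = 1 :> R.
  by have := pi_gt0 R; move: pi => p p0; field; rewrite gt_eqF.
suff cv : P x n%:R - P x (- n%:R) @[n --> \oo] --> pi^-1 * (pi / 2) - pi^-1 * (- (pi / 2)).
  by rewrite E1 in cv; under eq_cvg do rewrite ig_poisson; exact: cv.
apply: cvgB; apply: cvgM; try exact: cvg_cst.
- by apply: (cvg_comp _ _ (affine_cvgy _ k0)); exact: cvgy_atan.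
- have H n : atan (- (2 * pi / c * x) + 2 * pi / c * - n%:R) =
     - atan (2 * pi / c * x + 2 * pi / c * n%:R).
    by rewrite -atanN; congr atan; ring.
  under eq_cvg do rewrite H.
  by apply: cvgN; apply: (cvg_comp _ _ (affine_cvgy _ k0)); exact: cvgy_atan.
Qed.

End Poisson.

(** * Damped inversion for integrable functions by Fubini's theorem *)

Section Duality.
Context {R : realType}.
Notation mu := (@lebesgue_measure R).
Let T0 : set (measurableTypeR R) := setT.
Let mT0 : measurable T0. Proof. exact: measurableT. Qed.
Implicit Types (p q r s u v : R -> R) (x y w : R).

Lemma EFin_Rintegral (D : set (measurableTypeR R)) u : measurable D -> rint D u ->
  (\int[mu]_(x in D) (u x)%:E)%E = (\int[mu]_(x in D) u x)%:E.
Proof. by move=> mD iu; rewrite fineK//; exact: integrable_fin_num iu. Qed.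

Variables (c : R) (c0 : 0 < c).

(** The real part of [(p + i q)(y) * expo c w * exp (2 pi i (x - y) w)]. Integrated first in [w] it
    gives [p y * poisson c x y], the sine part being odd; integrated first in [y] it gives the
    damped inverse transform. *)
Definition osc p q x y w := p y * (expo c w * cos (2 * pi * (x - y) * w)) -
  q y * (expo c w * sin (2 * pi * (x - y) * w)).

(* Real part of the Fourier transform of [p + i q]; the imaginary part is [fourierR q (- p)]. *)
Definition fourierR p q w := \int[mu]_(y in T0) (p y * cos (2 * pi * w * y) + q y * sin (2 * pi * w * y)).

Let mE : measurable_fun T0 (expo c).
Proof. by apply: continuous_measurable_funR; exact: continuous_expo. Qed.

Lemma rint_trig p q (k : R -> R) : continuous k -> rint T0 p -> rint T0 q ->
  rint T0 (fun y => p y * cos (k y) + q y * sin (k y)).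
Proof.
move=> ck ip iq; have mk := continuous_measurable_funR ck.
apply: rintD => //; apply: (rint_mul_bounded mT0 (K := 1)) => //.
- by apply: continuous_measurable_funR => y; apply: (continuous_comp (ck y)); exact: continuous_cos.
- by move=> y _; apply cos_sin_le1.
- by apply: continuous_measurable_funR => y; apply: (continuous_comp (ck y)); exact: continuous_sin.
- by move=> y _; apply cos_sin_le1.
Qed.

Let lin k : continuous (fun y : R => k * y).
Proof. by apply: ctsZ => ?; exact: cvg_id. Qed.

Section Fubini.
Variables (p q : R -> R) (ip : rint T0 p) (iq : rint T0 q) (x : R).

Let F (z : measurableTypeR R * measurableTypeR R) := (osc p q x z.1 z.2)%:E.

Let mF : measurable_fun setT F.
Proof.
have mp := rint_measurable ip; have mq := rint_measurable iq.
have m2E : measurable_fun setT (fun z : measurableTypeR R * measurableTypeR R => expo c z.2).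
  by apply: (measurableT_comp mE); exact: measurable_snd.
have ml : measurable_fun setT (fun z : measurableTypeR R * measurableTypeR R => 2 * pi * (x - z.1) * z.2).
  apply: measurable_funM; last exact: measurable_snd.
  apply: measurable_funM; first exact: measurable_cst.
  by apply: measurable_funB; [exact: measurable_cst|exact: measurable_fst].
apply/measurable_EFinP; apply: measurable_funB; apply: measurable_funM.
- by apply: (measurableT_comp mp); exact: measurable_fst.
- apply: measurable_funM => //; apply: (measurableT_comp _ ml).
  exact: continuous_measurable_fun (@continuous_cos R).
- by apply: (measurableT_comp mq); exact: measurable_fst.
- apply: measurable_funM => //; apply: (measurableT_comp _ ml).
  exact: continuous_measurable_fun (@continuous_sin R).
Qed.

Let osc_le y w : `|osc p q x y w| <= (`|p y| + `|q y|) * expo c w.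
Proof.
have [c1 s1] := cos_sin_le1 (2 * pi * (x - y) * w).
have E0 := ltW (expo_gt0 c w).
rewrite /osc (le_trans (ler_normB _ _))// (mulrDl `|p y|) !normrM (ger0_norm E0).
by apply: lerD; rewrite ler_wpM2l// ler_piMr.
Qed.

Let osc_rint y : rint T0 (osc p q x y).
Proof.
apply: (rint_le mT0 (g := fun w => (`|p y| + `|q y|) * expo c w)) => //.
  have /measurable_EFinP := measurableT_comp mF (pair1_measurable y); exact.
by apply: rintZ => //; exact: rint_expo.
Qed.

Let iF : (mu \x mu)%E.-integrable setT F.
Proof.
apply/integrable12ltyP => //.
apply: (@le_lt_trans _ _ (\int[mu]_(y in T0) ((`|p y| + `|q y|) * \int[mu]_(w in T0) expo c w)%:E)%E).
  apply: ge0_le_integral => //.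
  - by move=> y _; exact: integral_ge0.
  - apply: (measurable_fun_fubini_tonelli_F (fun z => `|F z|%E)) => //.
    exact: measurableT_comp.
  - apply/measurable_EFinP; apply: measurable_funM => //.
    apply: rint_measurable; apply: rintD => //; exact: rint_normr.
  - move=> y _.
    rewrite -RintegralZ//; last exact: rint_expo.
    rewrite -EFin_Rintegral//; last by apply: rintZ => //; exact: rint_expo.
    apply: ge0_le_integral => //.
    + apply: measurableT_comp => //; exact: (measurableT_comp mF (pair1_measurable y)).
    + by apply/measurable_EFinP; apply: measurable_funM.
    + by move=> w _; rewrite /= lee_fin.
rewrite EFin_Rintegral ?ltry//.
have := rintZ mT0 (\int[mu]_(w in T0) expo c w) (rintD mT0 (rint_normr ip) (rint_normr iq)).
by under eq_fun do rewrite mulrC.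
Qed.

Let inner_w y : (\int[mu]_(w in T0) F (y, w))%E = (p y * poisson c x y)%:E.
Proof.
transitivity (\int[mu]_(w in T0) osc p q x y w)%:E; first exact: (EFin_Rintegral mT0 (osc_rint y)).
congr (_%:E); rewrite /osc.
have ic : rint T0 (fun w => expo c w * cos (2 * pi * (x - y) * w)).
  apply: rint_expo_bounded => //; last by move=> w; apply cos_sin_le1.
  by apply: continuous_measurable_funR; exact: continuous_cosl.
have is_ : rint T0 (fun w => expo c w * sin (2 * pi * (x - y) * w)).
  apply: rint_expo_bounded => //; last by move=> w; apply cos_sin_le1.
  by apply: continuous_measurable_funR; exact: continuous_sinl.
rewrite RintegralBr//; [|exact: rintZ|exact: rintZ].
by rewrite !RintegralZ// Rintegral_expo_sin// Rintegral_expo_cos// mulr0 subr0.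
Qed.

Let inner_y w : (\int[mu]_(y in T0) F (y, w))%E =
  (expo c w * (fourierR p q w * cos (2 * pi * x * w) - fourierR q (fun y => - p y) w * sin (2 * pi * x * w)))%:E.
Proof.
have iN : rint T0 (fun y => - p y) by exact: rintN.
have i1 := rint_trig (lin (k := 2 * pi * w)) ip iq.
have i2 := rint_trig (lin (k := 2 * pi * w)) iq iN.
have E y : osc p q x y w = expo c w *
   (cos (2 * pi * x * w) * (p y * cos (2 * pi * w * y) + q y * sin (2 * pi * w * y)) -
    sin (2 * pi * x * w) * (q y * cos (2 * pi * w * y) + - p y * sin (2 * pi * w * y))).
  rewrite /osc.
  have -> : 2 * pi * (x - y) * w = 2 * pi * x * w - 2 * pi * w * y.
    by rewrite (mulrAC (2 * pi) (x - y)) (mulrBr (2 * pi * w)) (mulrAC (2 * pi) x).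
  rewrite cosB sinB; ring.
rewrite /F /=; under eq_integral do rewrite E.
have iall : rint T0 (fun y => cos (2 * pi * x * w) * (p y * cos (2 * pi * w * y) + q y * sin (2 * pi * w * y)) -
    sin (2 * pi * x * w) * (q y * cos (2 * pi * w * y) + - p y * sin (2 * pi * w * y))).
  by apply: rintB => //; exact: rintZ.
rewrite EFin_Rintegral//; last exact: rintZ.
congr (_%:E); rewrite RintegralZ//; congr (_ * _).
rewrite RintegralBr//; [|exact: rintZ|exact: rintZ].
by rewrite !RintegralZ// mulrC; congr (_ - _); rewrite mulrC.
Qed.

(** Measurability in [w] comes out of Fubini's theorem; the majorant uses that both transforms are
    bounded by the integral of [|p| + |q|]. *)
Lemma rint_fourierR : rint T0 (fun w => expo c w *
   (fourierR p q w * cos (2 * pi * x * w) - fourierR q (fun y => - p y) w * sin (2 * pi * x * w))).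
Proof.
have iN : rint T0 (fun y => - p y) by exact: rintN.
pose A := \int[mu]_(y in T0) (`|p y| + `|q y|).
have iA : rint T0 (fun y => `|p y| + `|q y|) by apply: rintD => //; exact: rint_normr.
have bnd u v w : rint T0 u -> rint T0 v -> (forall y, `|u y| + `|v y| <= `|p y| + `|q y|) ->
    `|fourierR u v w| <= A.
  move=> iu iv uv; have it := rint_trig (lin (k := 2 * pi * w)) iu iv.
  apply: le_trans (le_normr_Rintegral mT0 it) _.
  apply: le_Rintegral => //; first exact: rint_normr.
  move=> y _; apply: le_trans (uv y); apply: le_trans (ler_normD _ _) _.
  have [c1 s1] := cos_sin_le1 (2 * pi * w * y).
  by rewrite !normrM lerD// ler_piMr.
apply: (rint_le mT0 (g := fun w => (2 * A) * expo c w)).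
- have := measurable_fubini_G iF; rewrite /fubini_G.
  under eq_fun do rewrite inner_y.
  by move=> /measurable_EFinP.
- move=> w _; rewrite normrM (ger0_norm (ltW (expo_gt0 c w))) mulrC ler_wpM2r ?(ltW (expo_gt0 c w))//.
  have [c1 s1] := cos_sin_le1 (2 * pi * x * w).
  have b1 : `|fourierR p q w| <= A by apply: bnd.
  have b2 : `|fourierR q (fun y => - p y) w| <= A.
    by apply: bnd => // y; rewrite normrN addrC.
  rewrite (le_trans (ler_normB _ _))// !normrM.
  have -> : 2 * A = A + A by ring.
  by apply: lerD; rewrite -[leRHS]mulr1 ler_pM.
- by apply: rintZ => //; exact: rint_expo.
Qed.

Lemma fourierR_duality : \int[mu]_(w in T0) (expo c w *
   (fourierR p q w * cos (2 * pi * x * w) - fourierR q (fun y => - p y) w * sin (2 * pi * x * w))) =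
  \int[mu]_(y in T0) (p y * poisson c x y).
Proof.
rewrite /Rintegral; congr fine.
transitivity (\int[mu]_(w in T0) \int[mu]_(y in T0) F (y, w))%E.
  by apply: eq_integral => w _; rewrite -inner_y.
transitivity (\int[mu]_(y in T0) \int[mu]_(w in T0) F (y, w))%E.
  exact/esym/(Fubini iF).
by apply: eq_integral => y _; exact: inner_w.
Qed.

End Fubini.
End Duality.

(** * Passage of the duality from integrable to square integrable functions *)

Section Representation.
Context {R : realType}.
Notation mu := (@lebesgue_measure R).
Let T0 : set (measurableTypeR R) := setT.
Let mT0 : measurable T0. Proof. exact: measurableT. Qed.
Implicit Types (p q r s u v phi : R -> R) (c x y w : R).

(** At [x = 0] the sine term of [rint_fourierR] drops out, and multiplication by [expR |w|] removes
    the damping with [c = 1]. *)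
Lemma measurable_fourierR p q : rint T0 p -> rint T0 q -> measurable_fun T0 (fourierR p q).
Proof.
move=> ip iq; have /rint_measurable m1 := rint_fourierR (@ltr01 R) ip iq 0.
have mE : measurable_fun T0 (fun w : R => expR `|w|).
  apply: continuous_measurable_funR => w.
  by apply: (continuous_comp (@norm_continuous _ _ w)); exact: continuous_expR.
have := measurable_funM mE m1; apply: eq_measurable_fun => w _.
rewrite /= (_ : 2 * pi * 0 * w = 0); last by rewrite mulr0 mul0r.
rewrite cos0 sin0 mulr1 mulr0 subr0 mulrA /expo mul1r -expRD subrr.
by rewrite expR0 mul1r.
Qed.

Lemma mul_sq_bound (v phi theta : R) : 0 < theta ->
  `|v * phi| <= 2^-1 * (theta * phi ^+ 2 + theta^-1 * v ^+ 2).
Proof.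
move=> t0; rewrite normrM -[phi ^+ 2]real_normK ?num_real// -[v ^+ 2]real_normK ?num_real//.
have := sqr_ge0 (theta * `|phi| - `|v|).
have -> : 2^-1 * (theta * `|phi| ^+ 2 + theta^-1 * `|v| ^+ 2) =
    `|v| * `|phi| + 2^-1 * theta^-1 * (theta * `|phi| - `|v|) ^+ 2.
  by field; rewrite gt_eqF.
by move=> H; rewrite lerDl mulr_ge0// mulr_ge0// invr_ge0 ltW.
Qed.

Lemma rint_mul_sq u v : measurable_fun T0 u -> measurable_fun T0 v ->
  rint T0 (fun w => u w ^+ 2) -> rint T0 (fun w => v w ^+ 2) -> rint T0 (fun w => u w * v w).
Proof.
move=> mu_ mv iu iv; apply: (rint_le mT0 (g := fun w => 2^-1 * (1 * v w ^+ 2 + 1^-1 * u w ^+ 2))).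
- exact: measurable_funM.
- by move=> w _; exact: mul_sq_bound.
- by apply: rintZ => //; apply: rintD => //; exact: rintZ.
Qed.

Let half_le (a b e : R) : a <= e -> b <= e -> 2^-1 * (a + b) <= e.
Proof. by move=> *; lra. Qed.

Let third_le (L M a b d e : R) : a - b + L = d + M ->
  `|a| <= e / 3 -> `|b| <= e / 3 -> `|d| <= e / 3 -> `|L - M| <= e.
Proof.
move=> E a3 b3 d3; have -> : L - M = d - a + b by lra.
by apply: le_trans (ler_normD _ _) _; have := ler_normB d a; lra.
Qed.

(** A weighted Young inequality takes the place of Cauchy-Schwarz. Integrability belongs to the
    conclusion because the norm of [v_ n] is known to be finite only for large [n]. *)
Lemma weak_small (v_ : nat -> R -> R) phi (e : R) :
  (forall n, measurable_fun T0 (v_ n)) -> measurable_fun T0 phi ->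
  rint T0 (fun w => phi w ^+ 2) ->
  (\int[mu]_(w in T0) (v_ n w ^+ 2)%:E)%E @[n --> \oo] --> 0%E -> 0 < e ->
  \forall n \near \oo, rint T0 (fun w => v_ n w * phi w) /\
    `|\int[mu]_(w in T0) (v_ n w * phi w)| <= e.
Proof.
move=> mv mphi iphi /fine_cvgP[vfin /cvgrPdist_le vc] e0.
set A := \int[mu]_(w in T0) (phi w ^+ 2).
have A0 : 0 <= A by apply: Rintegral_ge0 => w _; exact: sqr_ge0.
(* Young's weight: [theta * A <= e], and [theta^-1] times the squared norm of [v_ n] is at most [e]
   once that squared norm is below [theta * e]. *)
pose theta := e / (A + 1); have t0 : 0 < theta by rewrite divr_gt0// ltr_wpDl.
have d0 : 0 < theta * e by rewrite mulr_gt0.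
near=> n.
have iv : rint T0 (fun w => v_ n w ^+ 2).
  apply/integrableP; split; first by apply/measurable_EFinP; exact: measurable_funX.
  under eq_integral do rewrite /= ger0_norm ?sqr_ge0//.
  rewrite ltey; have : (\int[mu]_(w in T0) (v_ n w ^+ 2)%:E)%E \is a fin_num by near: n.
  by case: (\int[mu]_(w in T0) (v_ n w ^+ 2)%:E)%E.
have vle : \int[mu]_(w in T0) (v_ n w ^+ 2) <= theta * e.
  have : `|0 - fine (\int[mu]_(w in T0) (v_ n w ^+ 2)%:E)%E| <= theta * e.
    by near: n; exact: vc.
  by rewrite sub0r normrN; apply: le_trans; exact: ler_norm.
have ivp : rint T0 (fun w => v_ n w * phi w) by exact: rint_mul_sq.
split => //; apply: le_trans (le_normr_Rintegral mT0 ivp) _.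
have ib : rint T0 (fun w => 2^-1 * (theta * phi w ^+ 2 + theta^-1 * v_ n w ^+ 2)).
  by apply: rintZ => //; apply: rintD => //; exact: rintZ.
apply: (@le_trans _ _ (\int[mu]_(w in T0) (2^-1 * (theta * phi w ^+ 2 + theta^-1 * v_ n w ^+ 2)))).
  apply: le_Rintegral => //; first exact: rint_normr.
  by move=> w _; exact: mul_sq_bound.
have i1 : rint T0 (fun w => theta * phi w ^+ 2) by exact: rintZ.
have i2 : rint T0 (fun w => theta^-1 * v_ n w ^+ 2) by exact: rintZ.
rewrite RintegralZ//; last exact: rintD.
rewrite RintegralDr// !RintegralZ// -/A.
have H1 : theta * A <= e.
  by rewrite /theta mulrAC ler_pdivrMr ?ltr_wpDl// ler_pM2l//; lra.
have H2 : theta^-1 * \int[mu]_(w in T0) (v_ n w ^+ 2) <= e.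
  by rewrite ler_pdivrMl.
exact: half_le.
Unshelve. all: by end_near. Qed.

Lemma rint_poisson_sq c x : 0 < c -> rint T0 (fun y => poisson c x y ^+ 2).
Proof.
move=> c0; have mK : measurable_fun T0 (poisson c x).
  by apply: continuous_measurable_funR; exact: continuous_poisson.
apply: (rint_le mT0 (g := fun y => (2 / c) * poisson c x y)).
- exact: measurable_funX.
- move=> y _; rewrite ger0_norm ?sqr_ge0// expr2 ler_wpM2r// ?(ltW (poisson_gt0 c0 x y))//.
  rewrite /poisson ler_pdivrMr; last by rewrite ltr_pwDl ?exprn_gt0// sqr_ge0.
  rewrite mulrDr; have -> : 2 / c * c ^+ 2 = 2 * c by field; rewrite gt_eqF.
  by rewrite lerDl mulr_ge0 ?sqr_ge0// divr_ge0// ltW.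
- by apply: rintZ => //; exact: rint_poisson.
Qed.

Definition sqT u := measurable_fun T0 u /\ rint T0 (fun w => u w ^+ 2).

Definition cvg_sq (u_ : nat -> R -> R) u :=
  (\int[mu]_(w in T0) ((u_ n w - u w) ^+ 2)%:E)%E @[n --> \oo] --> 0%E.

(** For fixed [c] each term of [fourierR_duality] pairs an L^2 convergent sequence with a fixed
    square integrable function, so the identity survives the limit. *)
Lemma poisson_duality c x p r s (p_ q_ : nat -> R -> R) : 0 < c ->
  sqT p -> sqT r -> sqT s ->
  (forall n, rint T0 (p_ n) /\ rint T0 (q_ n)) ->
  cvg_sq p_ p -> cvg_sq (fun n => fourierR (p_ n) (q_ n)) r ->
  cvg_sq (fun n => fourierR (q_ n) (fun y => - p_ n y)) s ->
  \int[mu]_(w in T0) (expo c w * (r w * cos (2 * pi * x * w) - s w * sin (2 * pi * x * w))) =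
  \int[mu]_(y in T0) (p y * poisson c x y).
Proof.
move=> c0 [mp ip] [mr ir] [ms is_] ipq cp cr cs.
pose K := poisson c x.
have mK : measurable_fun T0 K by apply: continuous_measurable_funR; exact: continuous_poisson.
have iK : rint T0 (fun y => K y ^+ 2) by exact: rint_poisson_sq.
pose f1 w := expo c w * cos (2 * pi * x * w); pose f2 w := expo c w * sin (2 * pi * x * w).
have cE := @continuous_expo R c.
have m1 : measurable_fun T0 f1.
  by apply: continuous_measurable_funR; apply: ctsM => //; exact: continuous_cosl.
have m2 : measurable_fun T0 f2.
  by apply: continuous_measurable_funR; apply: ctsM => //; exact: continuous_sinl.
have sqE (t : R -> R) : (forall w, `|t w| <= 1) -> measurable_fun T0 (fun w => expo c w * t w) ->
    rint T0 (fun w => (expo c w * t w) ^+ 2).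
  move=> t1 mt; apply: (rint_le mT0 (g := expo c)); last exact: rint_expo.
    exact: measurable_funX.
  move=> w _; have E0 := ltW (expo_gt0 c w).
  have E1 : expo c w <= 1 by rewrite /expo -expR0 ler_expR oppr_le0 mulr_ge0// ltW.
  rewrite normrX normrM (ger0_norm E0) expr2.
  have El : expo c w * `|t w| <= 1 by rewrite mulr_ile1.
  apply: le_trans (ler_piMl _ El) _; first by rewrite mulr_ge0.
  by rewrite ler_piMr.
have i1 : rint T0 (fun w => f1 w ^+ 2) by apply: sqE => // w; apply cos_sin_le1.
have i2 : rint T0 (fun w => f2 w ^+ 2) by apply: sqE => // w; apply cos_sin_le1.
have irf : rint T0 (fun w => r w * f1 w) by exact: rint_mul_sq.
have isf : rint T0 (fun w => s w * f2 w) by exact: rint_mul_sq.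
have ipK : rint T0 (fun y => p y * K y) by exact: rint_mul_sq.
have -> : (fun w => expo c w * (r w * cos (2 * pi * x * w) - s w * sin (2 * pi * x * w))) =
   (fun w => r w * f1 w - s w * f2 w) by apply/funext => w; rewrite /f1 /f2; ring.
apply/eqP; rewrite -subr_eq0 -normr_le0; apply/ler_addgt0Pl => e e0; rewrite addr0.
pose U n := fourierR (p_ n) (q_ n); pose V n := fourierR (q_ n) (fun y => - p_ n y).
have mU n : measurable_fun T0 (U n).
  by have [? ?] := ipq n; exact: measurable_fourierR.
have mV n : measurable_fun T0 (V n).
  by have [? ?] := ipq n; apply: measurable_fourierR => //; exact: rintN.
have mpn n : measurable_fun T0 (p_ n) by apply: rint_measurable; exact: (ipq n).1.
have e3 : 0 < e / 3 by rewrite divr_gt0.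
have W1 := weak_small (fun n => measurable_funB (mU n) mr) m1 i1 cr e3.
have W2 := weak_small (fun n => measurable_funB (mV n) ms) m2 i2 cs e3.
have W3 := weak_small (fun n => measurable_funB (mpn n) mp) mK iK cp e3.
near \oo => n.
have [j1 b1] : rint T0 (fun w => (U n w - r w) * f1 w) /\
    `|\int[mu]_(w in T0) ((U n w - r w) * f1 w)| <= e / 3 by near: n; exact: W1.
have [j2 b2] : rint T0 (fun w => (V n w - s w) * f2 w) /\
    `|\int[mu]_(w in T0) ((V n w - s w) * f2 w)| <= e / 3 by near: n; exact: W2.
have [j3 b3] : rint T0 (fun y => (p_ n y - p y) * K y) /\
    `|\int[mu]_(y in T0) ((p_ n y - p y) * K y)| <= e / 3 by near: n; exact: W3.
have [ipn iqn] := ipq n.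
have := fourierR_duality c0 ipn iqn x.
have -> : (fun w => expo c w * (fourierR (p_ n) (q_ n) w * cos (2 * pi * x * w) -
    fourierR (q_ n) (fun y => - p_ n y) w * sin (2 * pi * x * w))) =
  (fun w => ((U n w - r w) * f1 w - (V n w - s w) * f2 w) + (r w * f1 w - s w * f2 w)).
  by apply/funext => w; rewrite /f1 /f2 /U /V; ring.
have -> : (fun y => p_ n y * poisson c x y) = (fun y => (p_ n y - p y) * K y + p y * K y).
  by apply/funext => y; rewrite /K; ring.
rewrite (RintegralDr mT0 (rintB mT0 j1 j2) (rintB mT0 irf isf)).
rewrite (RintegralBr mT0 j1 j2) (RintegralDr mT0 j3 ipK) => E.
exact: third_le E b1 b2 b3.
Unshelve. all: by end_near. Qed.

End Representation.

(** * Removal of the damping *)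

Section PointwiseInversion.
Context {R : realType}.
Notation mu := (@lebesgue_measure R).
Let T0 : set (measurableTypeR R) := setT.
Let mT0 : measurable T0. Proof. exact: measurableT. Qed.
Implicit Types (p q r s u v phi : R -> R) (c x y w : R).

(** Away from [x] the kernel is of order [c], uniformly against the kernel with [c = 1], which thus
    provides one majorant for all [c]. *)
Lemma poisson_far c x y (d : R) : 0 < c -> 0 < d -> d <= `|y - x| ->
  poisson c x y <= c * (1 + (2 * pi * d) ^- 2) * poisson 1 x y.
Proof.
move=> c0 d0 dyx; rewrite /poisson; set t := (2 * pi * (x - y)) ^+ 2.
have e0 : 0 < (2 * pi * d) ^+ 2 by rewrite exprn_gt0// !mulr_gt0// pi_gt0.
set e := (2 * pi * d) ^+ 2 in e0 *.
have et : e <= t.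
  rewrite /t -[leRHS]real_normK ?num_real// /e lerXn2r ?nnegrE//.
    by rewrite !mulr_ge0 ?pi_ge0// ltW.
  rewrite normrM (@ger0_norm _ (2 * pi)) ?mulr_ge0 ?pi_ge0// ler_pM2l ?mulr_gt0 ?pi_gt0//.
  by rewrite distrC.
have t0 : 0 < t by exact: lt_le_trans et.
rewrite expr1n mulr1 ler_pdivrMr; last by rewrite addr_gt0// exprn_gt0.
have -> : c * (1 + e^-1) * (2 / (1 + t)) * (c ^+ 2 + t) =
    2 * c * ((1 + e^-1) * (c ^+ 2 + t) / (1 + t)).
  by field; rewrite !gt_eqF// addr_gt0.
rewrite ler_peMr ?mulr_ge0// ?(ltW c0)// ler_pdivlMr ?addr_gt0// mul1r mulrDl mul1r.
have : 1 <= e^-1 * (c ^+ 2 + t).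
  rewrite -(ler_pM2l e0) mulr1 mulVKf ?gt_eqF//.
  by rewrite (le_trans et)// lerDr sqr_ge0.
by move=> h; rewrite addrC lerD// lerDr sqr_ge0.
Qed.

(** Near [x] continuity controls the difference; far from [x] the factor [c] of [poisson_far] does,
    with square integrability of [p] in place of boundedness. *)
Lemma poisson_approx p x (e : R) : continuous p -> sqT p -> 0 < e ->
  exists C, forall c, 0 < c ->
    `|\int[mu]_(y in T0) (p y * poisson c x y) - p x| <= e + c * C.
Proof.
move=> cp [mp ip] e0.
have /cvgrPdist_lt /(_ e e0) /nbhs_normP[d /= d0 Hd] := cp x.
pose M := 1 + (2 * pi * d) ^- 2.
have M0 : 0 <= M by rewrite addr_ge0// invr_ge0 sqr_ge0.
pose K c := poisson c x.
have K0 c y : 0 < c -> 0 <= K c y by move=> c0; exact/ltW/poisson_gt0.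
have mK c : 0 < c -> measurable_fun T0 (K c).
  by move=> c0; apply: continuous_measurable_funR; exact: continuous_poisson.
have sK c : 0 < c -> rint T0 (fun y => K c y ^+ 2) by exact: rint_poisson_sq.
(* [G0] dominates [(|p y| + |p x|) * K 1 y]; the product of [p] and the kernel is bounded by half
   the sum of their squares. *)
pose G0 y := 2^-1 * (1 * K 1 y ^+ 2 + 1^-1 * p y ^+ 2) + `|p x| * K 1 y.
have iG0 : rint T0 G0.
  apply: rintD => //; last by apply: rintZ => //; exact: rint_poisson.
  by apply: rintZ => //; apply: rintD => //; apply: rintZ => //; exact: sK.
exists (M * \int[mu]_(y in T0) G0 y) => c c0.
have ipK : rint T0 (fun y => p y * K c y) by apply: rint_mul_sq => //; [exact: mK|exact: sK].
have iK : rint T0 (K c) by exact: rint_poisson.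
have ixK : rint T0 (fun y => p x * K c y) by exact: rintZ.
have IK : \int[mu]_(y in T0) K c y = 1 by exact: Rintegral_poisson.
have -> : \int[mu]_(y in T0) (p y * poisson c x y) - p x =
    \int[mu]_(y in T0) (p y * K c y - p x * K c y).
  by rewrite (RintegralBr mT0 ipK ixK) RintegralZ// Rintegral_poisson// mulr1.
have ib : rint T0 (fun y => e * K c y + c * M * G0 y).
  by apply: rintD => //; exact: rintZ.
apply: (@le_trans _ _ (\int[mu]_(y in T0) (e * K c y + c * M * G0 y))); last first.
  have i1 : rint T0 (fun y => e * K c y) by exact: rintZ.
  have i2 : rint T0 (fun y => c * M * G0 y) by exact: rintZ.
  by rewrite (RintegralDr mT0 i1 i2) (RintegralZ mT0 e iK) (RintegralZ mT0 _ iG0) IK mulr1 mulrA.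
have id_ := rintB mT0 ipK ixK.
apply: le_trans (le_normr_Rintegral mT0 id_) _.
apply: le_Rintegral => //; first exact: rint_normr.
move=> y _; rewrite -mulrBl normrM (ger0_norm (K0 _ _ c0)).
have G00 : 0 <= G0 y.
  rewrite /G0 invr1 !mul1r; apply: addr_ge0; last by rewrite mulr_ge0 ?K0.
  by rewrite mulr_ge0// addr_ge0// sqr_ge0.
have [yd|yd] := ltP `|y - x| d.
  have := Hd y; rewrite /= distrC => /(_ yd) /ltW pe; rewrite distrC in pe.
  apply: (@le_trans _ _ (e * K c y)); first by rewrite ler_wpM2r// K0.
  by rewrite lerDl !mulr_ge0// ltW.
apply: (@le_trans _ _ (c * M * G0 y)); last by rewrite lerDr mulr_ge0 ?K0// ltW.
have far := poisson_far c0 d0 yd; rewrite -/M -/(K c y) -/(K 1 y) in far.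
apply: (@le_trans _ _ (`|p y - p x| * (c * M * K 1 y))); first by rewrite ler_wpM2l.
rewrite mulrCA ler_wpM2l ?mulr_ge0// ?(ltW c0)//.
apply: (@le_trans _ _ ((`|p y| + `|p x|) * K 1 y)).
  by rewrite ler_wpM2r ?K0//; exact: ler_normB.
rewrite (mulrDl `|p y|) lerD2r.
have := @mul_sq_bound R (p y) (K 1 y) 1 ltr01.
by rewrite normrM (ger0_norm (K0 1 y ltr01)).
Qed.

(** On the band, [0 <= 1 - expo c w <= c * |w| <= c * tau]. *)
Lemma expo_approx tau r s x : 0 < tau -> sqint tau r -> sqint tau s ->
  exists C, forall c, 0 < c ->
  `|\int[mu]_(w in `[- tau, tau]) (expo c w * (r w * cos (2 * pi * x * w) - s w * sin (2 * pi * x * w))) -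
    ttrans tau r (fun w => - s w) x| <= c * C.
Proof.
move=> tau0 sr ss; set D : set (measurableTypeR R) := `[- tau, tau]%classic.
have mD : measurable D by exact: measurable_itv.
have ir := sqint_rint sr; have is_ := sqint_rint ss.
have iT := sqint_rint (sqint_cossin (2 * pi * x) sr (sqintN ss)).
pose t w := r w * cos (2 * pi * x * w) + - s w * sin (2 * pi * x * w).
have iB : rint D (fun w => `|r w| + `|s w|) by apply: rintD => //; exact: rint_normr.
exists (tau * \int[mu]_(w in D) (`|r w| + `|s w|)) => c c0.
have -> : (fun w => expo c w * (r w * cos (2 * pi * x * w) - s w * sin (2 * pi * x * w))) =
    (fun w => t w * expo c w) by apply/funext => w; rewrite /t; ring.
have E01 w : 0 <= expo c w <= 1.
  by rewrite (ltW (expo_gt0 c w))/= /expo -expR0 ler_expR oppr_le0 mulr_ge0// ltW.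
have iE : rint D (fun w => t w * expo c w).
  apply: (rint_mul_bounded mD (K := 1)) => //.
    by apply: mfun_continuous; exact: continuous_expo.
  by move=> w _; have /andP[? ?] := E01 w; rewrite ger0_norm.
rewrite /ttrans -/t -(RintegralBr mD iE iT).
have iD := rintB mD iE iT; apply: le_trans (le_normr_Rintegral mD iD) _.
rewrite mulrA -(RintegralZ mD _ iB).
apply: le_Rintegral => //; [exact: rint_normr|exact: rintZ|move=> w Dw].
rewrite -/(t w) -[X in _ - X]mulr1 -mulrBr normrM mulrC ler_pM//.
  have /andP[E0 E1] := E01 w; rewrite ler0_norm ?subr_le0// opprB.
  have := expR_ge1Dx (- (c * `|w|)); rewrite -/(expo c w) => h.
  apply: (@le_trans _ _ (c * `|w|)); first lra.
  by rewrite ler_pM2l//; move: Dw; rewrite /D /= in_itv/= ler_norml.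
rewrite /t (le_trans (ler_normD _ _))//.
have [c1 s1] := cos_sin_le1 (2 * pi * x * w).
by rewrite !normrM normrN lerD// ler_piMr.
Qed.

Lemma Rintegral_ae_support (D : set (measurableTypeR R)) u : measurable D -> measurable_fun T0 u ->
  {ae mu, forall w, ~ D w -> u w = 0} -> \int[mu]_(w in T0) u w = \int[mu]_(w in D) u w.
Proof.
move=> mD mu_ ae0; rewrite [RHS]Rintegral_mkcond /Rintegral; congr fine.
apply: ae_eq_integral => //.
- exact/measurable_EFinP.
- apply/measurable_EFinP; apply/(measurable_restrictT _ _).1 => //.
  exact: measurable_funS mu_.
- apply: negligibleS ae0 => w nw H; apply: nw => _; rewrite patchE; case: ifPn => //.
  by rewrite notin_setE => /H ->.
Qed.

Lemma sqT_sqint tau u : sqT u -> sqint tau u.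
Proof.
move=> [mu_ iu]; split; first exact: measurable_funS mu_.
exact: integrableS iu.
Qed.

Lemma fourier_representation tau p r s (p_ q_ : nat -> R -> R) : 0 < tau -> continuous p ->
  sqT p -> sqT r -> sqT s ->
  (forall n, rint T0 (p_ n) /\ rint T0 (q_ n)) ->
  cvg_sq p_ p -> cvg_sq (fun n => fourierR (p_ n) (q_ n)) r ->
  cvg_sq (fun n => fourierR (q_ n) (fun y => - p_ n y)) s ->
  {ae mu, forall w, ~ `[- tau, tau]%classic w -> r w = 0 /\ s w = 0} ->
  forall x, p x = ttrans tau r (fun w => - s w) x.
Proof.
move=> tau0 cp sp sr ss ipq c1 c2 c3 ae0 x.
set D : set (measurableTypeR R) := `[- tau, tau]%classic in ae0.
have mD : measurable D by exact: measurable_itv.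
have [C1 H1] := expo_approx x tau0 (sqT_sqint tau sr) (sqT_sqint tau ss).
apply/eqP; rewrite -subr_eq0 -normr_le0; apply/ler_addgt0Pl => e e0; rewrite addr0.
have e2 : 0 < e / 2 by rewrite divr_gt0.
have [C2 H2] := poisson_approx x cp sp e2.
(* Small enough that both errors linear in [c] together cost at most [e / 2]; the absolute values
   and the 1 keep the denominator positive. *)
pose c := (e / 2) / (`|C1| + `|C2| + 1).
have den : 0 < `|C1| + `|C2| + 1 by rewrite ltr_wpDl// addr_ge0.
have c0 : 0 < c by rewrite divr_gt0// divr_gt0.
have cC : c * (C1 + C2) <= e / 2.
  rewrite /c mulrAC ler_pdivrMr// ler_pM2l ?divr_gt0//.
  by have := ler_norm C1; have := ler_norm C2; lra.
have mu_ : measurable_fun T0 (fun w => expo c w * (r w * cos (2 * pi * x * w) - s w * sin (2 * pi * x * w))).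
  have [mr _] := sr; have [ms _] := ss.
  apply: measurable_funM; first by apply: continuous_measurable_funR; exact: continuous_expo.
  apply: measurable_funB; apply: measurable_funM => //.
    by apply: continuous_measurable_funR; exact: continuous_cosl.
  by apply: continuous_measurable_funR; exact: continuous_sinl.
have E := poisson_duality x c0 sp sr ss ipq c1 c2 c3.
have {}H2 := H2 _ c0.
rewrite -E (Rintegral_ae_support mD mu_) in H2; last first.
  apply: negligibleS ae0 => w nw H; apply: nw => /H[-> ->].
  by rewrite !mul0r subrr mulr0.
have {}H1 := H1 c c0.
set A := Rintegral _ _ _ in H1 H2.
rewrite distrC in H2.
have -> : p x - ttrans tau r (fun w => - s w) x =
  (p x - A) + (A - ttrans tau r (fun w => - s w) x) by rewrite subrKA.
by apply: le_trans (ler_normD _ _) _; rewrite mulrDr in cC; lra.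
Qed.

End PointwiseInversion.

(** * Band-limited functions *)

Section BandlimitedFunctions.
Context {R : realType}.
Notation mu := (@lebesgue_measure R).
Let T0 : set (measurableTypeR R) := setT.
Let mT0 : measurable T0. Proof. exact: measurableT. Qed.
Notation normc := ComplexField.Normc.normc.
Notation Rec := complex.Re.
Notation Imc := complex.Im.
Implicit Types (f g : R -> R[i]) (x y w : R) (z : R[i]).

Lemma normc_sqr z : normc z ^+ 2 = Rec z ^+ 2 + Imc z ^+ 2.
Proof. by case: z => a b /=; rewrite sqr_sqrtr// addr_ge0// sqr_ge0. Qed.

Lemma ReB z1 z2 : Rec (z1 - z2) = Rec z1 - Rec z2.
Proof. by case: z1 => a b; case: z2. Qed.

Lemma ImB z1 z2 : Imc (z1 - z2) = Imc z1 - Imc z2.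
Proof. by case: z1 => a b; case: z2. Qed.

Lemma ler_normc_Re z : `|Rec z| <= normc z.
Proof.
rewrite -(ler_pXn2r (n := 2))// ?nnegrE ?normc_ge0//; last by case: z => a b; rewrite sqrtr_ge0.
by rewrite real_normK ?num_real// normc_sqr lerDl sqr_ge0.
Qed.

Lemma ler_normc_Im z : `|Imc z| <= normc z.
Proof.
rewrite -(ler_pXn2r (n := 2))// ?nnegrE ?normc_ge0//; last by case: z => a b; rewrite sqrtr_ge0.
by rewrite real_normK ?num_real// normc_sqr lerDr sqr_ge0.
Qed.

Lemma cnorm2_sqr f : (cnorm2 f * cnorm2 f = \int[mu]_w (Rec (f w) ^+ 2 + Imc (f w) ^+ 2)%:E)%E.
Proof.
have <- : (poweR (cnorm2 f) 2 = cnorm2 f * cnorm2 f)%E.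
  have := Lnorm_ge0 mu 2%:E (fun w => (normc (f w))%:E); rewrite -/(cnorm2 f).
  case: (cnorm2 f) => [r|//|//] /=.
    by rewrite lee_fin => r0; rewrite powR_mulrn// expr2 EFinM.
  by move=> _; rewrite mulyy pnatr_eq0.
rewrite /cnorm2 poweR_Lnorm ?pnatr_eq0//; apply: eq_integral => w _ /=.
rewrite ger0_norm ?poweR_EFin; last by case: (f w) => a b; rewrite sqrtr_ge0.
by rewrite powR_mulrn ?normc_sqr//; case: (f w) => a b; rewrite sqrtr_ge0.
Qed.

Lemma cnorm2_ge_Re f : cmeasurable f -> (\int[mu]_w (Rec (f w) ^+ 2)%:E <= cnorm2 f * cnorm2 f)%E.
Proof.
move=> [m1 m2]; rewrite cnorm2_sqr; apply: ge0_le_integral => //.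
- by move=> w _; rewrite lee_fin sqr_ge0.
- by apply/measurable_EFinP; exact: measurable_funX.
- by apply/measurable_EFinP; apply: measurable_funD; exact: measurable_funX.
- by move=> w _; rewrite lee_fin lerDl sqr_ge0.
Qed.

Lemma cnorm2_ge_Im f : cmeasurable f -> (\int[mu]_w (Imc (f w) ^+ 2)%:E <= cnorm2 f * cnorm2 f)%E.
Proof.
move=> [m1 m2]; rewrite cnorm2_sqr; apply: ge0_le_integral => //.
- by move=> w _; rewrite lee_fin sqr_ge0.
- by apply/measurable_EFinP; exact: measurable_funX.
- by apply/measurable_EFinP; apply: measurable_funD; exact: measurable_funX.
- by move=> w _; rewrite lee_fin lerDr sqr_ge0.
Qed.

Lemma sqT_finite (u : R -> R) : measurable_fun T0 u ->
  (\int[mu]_w (u w ^+ 2)%:E < +oo)%E -> sqT u.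
Proof.
move=> mu_ fin; split=> //; apply/integrableP; split.
  by apply/measurable_EFinP; exact: measurable_funX.
apply: le_lt_trans fin; apply: ge0_le_integral => //.
- by apply: measurableT_comp => //; apply/measurable_EFinP; exact: measurable_funX.
- by apply/measurable_EFinP; exact: measurable_funX.
- by move=> w _ /=; rewrite lee_fin ger0_norm// sqr_ge0.
Qed.

Lemma cL2_sqT f : cL2 f -> sqT (fun w => Rec (f w)) /\ sqT (fun w => Imc (f w)).
Proof.
move=> [mf fin].
have fin2 : (cnorm2 f * cnorm2 f < +oo)%E.
  have := Lnorm_ge0 mu 2%:E (fun w => (normc (f w))%:E); rewrite -/(cnorm2 f).
  by case: (cnorm2 f) fin => [r _ _|//|//]; rewrite -EFinM ltry.
have [m1 m2] := mf; split; apply: sqT_finite => //.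
- exact: le_lt_trans (cnorm2_ge_Re mf) fin2.
- exact: le_lt_trans (cnorm2_ge_Im mf) fin2.
Qed.

Lemma cmeasurableB f g : cmeasurable f -> cmeasurable g -> cmeasurable (fun w => f w - g w).
Proof.
move=> [f1 f2] [g1 g2]; split.
- by rewrite (_ : (fun _ => _) = (fun w => Rec (f w) - Rec (g w)));
    [exact: measurable_funB|apply/funext => w; rewrite ReB].
- by rewrite (_ : (fun _ => _) = (fun w => Imc (f w) - Imc (g w)));
    [exact: measurable_funB|apply/funext => w; rewrite ImB].
Qed.

Lemma cnorm2_cvg_sq (f_ : nat -> R -> R[i]) f : (forall n, cmeasurable (f_ n)) -> cmeasurable f ->
  cnorm2 (fun w => f_ n w - f w) @[n --> \oo] --> 0%E ->
  cvg_sq (fun n w => Rec (f_ n w)) (fun w => Rec (f w)) /\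
  cvg_sq (fun n w => Imc (f_ n w)) (fun w => Imc (f w)).
Proof.
move=> mf_ mf c0.
have c1 : (cnorm2 (fun w => (f_ n w - f w)%R) * cnorm2 (fun w => (f_ n w - f w)%R))%E @[n --> \oo] --> 0%E.
  by rewrite -(mule0 0%E); apply: cvgeM => //; rewrite mule_def_fin.
have mB n := cmeasurableB (mf_ n) mf.
split; apply: (squeeze_cvge _ (cvg_cst 0%E) c1); apply: nearW => n; apply/andP; split.
- by apply: integral_ge0 => w _; rewrite lee_fin sqr_ge0.
- apply: le_trans (cnorm2_ge_Re (mB n)); under [leRHS]eq_integral do rewrite ReB.
  exact: lexx.
- by apply: integral_ge0 => w _; rewrite lee_fin sqr_ge0.
- apply: le_trans (cnorm2_ge_Im (mB n)); under [leRHS]eq_integral do rewrite ImB.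
  exact: lexx.
Qed.

Lemma fourierRN (p q : R -> R) w : rint T0 p -> rint T0 q ->
  fourierR (fun x => - p x) (fun x => - q x) w = - fourierR p q w.
Proof.
move=> ip iq; rewrite /fourierR -[RHS]mulN1r -RintegralZ//.
  by congr Rintegral; apply/funext => y; rewrite mulN1r opprD -!mulNr.
apply: rint_trig => //.
by apply: ctsZ => ?; exact: cvg_id.
Qed.

Lemma fourier_Re f w : Rec (fourier f w) = fourierR (fun x => Rec (f x)) (fun x => Imc (f x)) w.
Proof.
rewrite /fourier /cintegral /= /fourierR; congr Rintegral; apply/funext => y.
by case: (f y) => a b /=; rewrite cosN sinN mulrN opprK.
Qed.

Lemma fourier_Im f w : Imc (fourier f w) = fourierR (fun x => Imc (f x)) (fun x => - Rec (f x)) w.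
Proof.
rewrite /fourier /cintegral /= /fourierR; congr Rintegral; apply/funext => y.
by case: (f y) => a b /=; rewrite cosN sinN mulrN mulNr addrC.
Qed.

Lemma cmeasurable_fourier f : cL1 f -> cmeasurable (fourier f).
Proof.
move=> [i1 i2]; split.
- rewrite (_ : (fun _ => _) = fourierR (fun x => Rec (f x)) (fun x => Imc (f x))).
    exact: measurable_fourierR.
  by apply/funext => w; exact: fourier_Re.
- rewrite (_ : (fun _ => _) = fourierR (fun x => Imc (f x)) (fun x => - Rec (f x))).
    by apply: measurable_fourierR => //; exact: rintN.
  by apply/funext => w; exact: fourier_Im.
Qed.

(** A Lindelöf argument: each point off the support lies in a rational interval on which [g]
    vanishes almost everywhere, and these are countably many. [F] enumerates the exceptional sets,
    with the empty set at all other codes. *)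
Lemma ae_support_vanish g a b : ae_support g `<=` `[a, b] ->
  {ae mu, forall w, ~ `[a, b]%classic w -> g w = 0}.
Proof.
move=> sg.
pose J (q : rat * rat) : set R := `]ratr q.1, ratr q.2[%classic.
pose B (q : rat * rat) := [set w | J q w /\ g w != 0].
pose F n := if unpickle n is Some q then if `[< mu.-negligible (B q) >] then B q else set0
  else set0.
have nF n : mu.-negligible (F n).
  rewrite /F; case: unpickle => [q|]; last exact: negligible_set0.
  by case: ifPn => [/asboolP//|_]; exact: negligible_set0.
apply: negligibleS (negligible_bigcup nF) => w /= nw.
have [wab gw] : ~ `[a, b]%classic w /\ g w != 0.
  by apply: contrapT => H; apply: nw => wab; apply: contrapT => /eqP gw; apply: H.
have : ~ ae_support g w by move=> /sg.
rewrite /ae_support /= => /existsNP[U] /not_implyP[oU] /contrapT ae0.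
have [oU1 Uw] := oU.
have [e /= e0 He] := (nbhs_ballP _ _).1 (open_nbhs_nbhs oU).
have [q1 q1P] := @rat_in_itvoo R (w - e) w ltac:(by rewrite ltrBlDr ltrDl).
have [q2 q2P] := @rat_in_itvoo R w (w + e) ltac:(by rewrite ltrDl).
move: q1P q2P; rewrite !in_itv/= => /andP[a1 a2] /andP[b1 b2].
have FB q : mu.-negligible (B q) -> F (pickle q) = B q.
  by rewrite /F pickleK => nB; case: ifPn => // /asboolP /(_ nB).
exists (pickle (q1, q2)); first exact: I.
rewrite FB; first by split; rewrite // /J /= in_itv/= a2 b1.
apply: negligibleS ae0 => v [Jv gv] H.
move/eqP: gv; apply; apply: H; apply: He; rewrite /ball /=.
by move: Jv; rewrite /J /= in_itv/= => /andP[v1 v2]; rewrite ltr_norml; apply/andP; split; lra.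
Qed.

Lemma entire_continuous (F : R[i] -> R[i]) : entire F -> forall x e, 0 < e ->
  exists2 d, 0 < d & forall y, `|x - y| < d -> normc (F x%:C%C - F y%:C%C) < e.
Proof.
move=> eF x e e0.
have cF : {for x%:C%C, continuous (F : R[i]^o -> R[i]^o)}.
  by apply: differentiable_continuous; apply/derivable1_diffP; exact: eF.
have e0' : 0 < e%:C%C :> R[i] by rewrite ltcR.
move/cvgrPdist_lt : cF => /(_ _ e0') /nbhs_ballP[/= d d0 H].
(* In the order of [R[i]] a positive element has zero imaginary part, so the radius [d] is a real
   number. *)
have [d1 d1E] : exists d1, d = d1%:C%C.
  by exists (Rec d); case: d d0 {H} => a b /=; rewrite ltcE/= => /andP[/eqP -> _].
exists d1; first by move: d0; rewrite d1E ltcR.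
move=> y yx; rewrite -ltcR; apply: H; rewrite /ball /= d1E.
by rewrite -rmorphB/= normc_def/= expr0n/= addr0 sqrtr_sqr ltcR.
Qed.

Lemma bandlimited_ttrans sigma f : 0 < sigma -> bandlimited sigma f ->
  let tau := sigma / (2 * pi) in
  exists r s, [/\ sqint tau r, sqint tau s,
    (fun x => Rec (f x)) = ttrans tau r (fun w => - s w) &
    (fun x => Imc (f x)) = ttrans tau s r].
Proof.
move=> sig0 [_ [F eF fF] [g [cf cg [h [hP hf hg]]] sg]] tau.
have tau0 : 0 < tau by rewrite divr_gt0// mulr_gt0// pi_gt0.
have cmh n : cmeasurable (h n) by have [_ []] := hP n.
have [[r1 r2] [s1 s2]] := (cL2_sqT cf, cL2_sqT cg).
have [p1 p2] := cnorm2_cvg_sq cmh cf.1 hf.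
have [q1 q2] := cnorm2_cvg_sq (fun n => cmeasurable_fourier (hP n).1) cg.1 hg.
have ae0 := ae_support_vanish sg.
have cRe : continuous (fun x => Rec (f x)).
  move=> x; apply/cvgrPdist_lt => e e0; have [d d0 H] := entire_continuous eF x e0.
  apply/nbhs_ballP; exists d => //= y yx; rewrite -ReB (le_lt_trans (ler_normc_Re _))// !fF.
  exact: H.
have cIm : continuous (fun x => Imc (f x)).
  move=> x; apply/cvgrPdist_lt => e e0; have [d d0 H] := entire_continuous eF x e0.
  apply/nbhs_ballP; exists d => //= y yx; rewrite -ImB (le_lt_trans (ler_normc_Im _))// !fF.
  exact: H.
have sqN u : sqT u -> sqT (fun w => - u w).
  move=> [mu_ iu]; split; first exact: measurableT_comp.
  by under eq_fun do rewrite sqrrN.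
pose ha n x := Rec (h n x); pose hb n x := Imc (h n x).
have ih n : rint T0 (ha n) /\ rint T0 (hb n) by have [[]] := hP n.
have {}q1 : cvg_sq (fun n => fourierR (ha n) (hb n)) (fun w => Rec (g w)).
  rewrite (_ : (fun _ => _) = (fun n w => Rec (fourier (h n) w)))//.
  by apply/funext => n; apply/funext => w; rewrite fourier_Re.
have {}q2 : cvg_sq (fun n => fourierR (hb n) (fun y => - ha n y)) (fun w => Imc (g w)).
  rewrite (_ : (fun _ => _) = (fun n w => Imc (fourier (h n) w)))//.
  by apply/funext => n; apply/funext => w; rewrite fourier_Im.
(* The imaginary part of [f] is the real part of [- i f], whose approximants are [hb - i ha] and
   whose transform is [- i g]; this is the third convergence needed for that instance. *)
have q3 : cvg_sq (fun n => fourierR (fun y => - ha n y) (fun y => - hb n y)) (fun w => - Rec (g w)).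
  rewrite /cvg_sq; under eq_fun do under eq_integral do
    rewrite (fourierRN _ (ih _).1 (ih _).2) -opprD sqrrN.
  exact: q1.
exists (fun w => Rec (g w)), (fun w => Imc (g w)); split; [exact: sqT_sqint|exact: sqT_sqint|..].
- apply/funext => x; apply: (fourier_representation tau0 cRe r1 s1 s2 ih p1 q1 q2).
  by apply: negligibleS ae0 => w nw H; apply: nw => /H ->.
- apply/funext => x.
  have -> : ttrans tau (fun w => Imc (g w)) (fun w => Rec (g w)) =
      ttrans tau (fun w => Imc (g w)) (fun w => - - Rec (g w)).
    by congr ttrans; apply/funext => w; rewrite opprK.
  have ih' n : rint T0 (hb n) /\ rint T0 (fun y => - ha n y).
    by have [i1 i2] := ih n; split=> //; exact: rintN.
  apply: (fourier_representation tau0 cIm r2 s2 (sqN _ s1) ih' p2 q2 q3).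
  by apply: negligibleS ae0 => w nw H; apply: nw => /H -> /=; rewrite oppr0.
Qed.

End BandlimitedFunctions.

Theorem corollary3p1 (R : realType) (sigma : R) (k : nat) (nu : R)
    (x : int -> R) :
  0 < sigma -> (1 <= k)%N -> is_wirtinger_cimmino k nu ->
  (forall i : int, x i < x (i + 1)) ->
  (ereal_sup (range (fun i : int => (x (i + 1) - x i)%:E))
     <= (nu / sigma)%:E)%E ->
  uniqueness_set (k - 1) sigma (range x).
Proof.
move=> sig0; case: k => [//|m] _ nuP xlt xsup f bf fz y; rewrite subn1/= in fz.
have [r [s [sr ss fR fI]]] := bandlimited_ttrans sig0 bf.
have tau0 : 0 < sigma / (2 * pi) by rewrite divr_gt0// mulr_gt0// pi_gt0.
have gap i : x (i + 1) - x i <= nu / (2 * pi * (sigma / (2 * pi))).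
  have -> : 2 * pi * (sigma / (2 * pi)) = sigma.
    by rewrite mulrC divfK// gt_eqF// mulr_gt0// pi_gt0.
  by rewrite -lee_fin; apply: le_trans xsup; apply: ereal_sup_ubound; exists i.
have fz' i l : (l <= m)%N ->
    derive1n l (fun y => complex.Re (f y)) (x i) = 0 /\ derive1n l (fun y => complex.Im (f y)) (x i) = 0.
  move=> lm; have : range x (x i) by exists i.
  by move=> /fz /(_ lm); rewrite /cderive1n => -[-> ->].
(* The zeros are inherited by real and imaginary part separately, and each is a [ttrans], so the
   real uniqueness result applies to both. *)
have Re0 : complex.Re (f y) = 0.
  rewrite -[LHS]/((fun y => complex.Re (f y)) y) fR.
  apply: (ttrans_uniqueness tau0 sr (sqintN ss) nuP xlt gap) => i l lm.
  by rewrite -fR (fz' i l lm).1.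
have Im0 : complex.Im (f y) = 0.
  rewrite -[LHS]/((fun y => complex.Im (f y)) y) fI.
  apply: (ttrans_uniqueness tau0 ss sr nuP xlt gap) => i l lm.
  by rewrite -fI (fz' i l lm).2.
by move: Re0 Im0; case: (f y) => a b /= -> ->.
Qed.
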